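(* Let $\mathbf{k}$ be a field and let $q\in\mathbf{k}\setminus\{0\}$ have finite quantum characteristic $e$. There is an isomorphism of $\mathbb{Z}$-graded $\mathbf{k}$-algebras $$\mathrm{HH}^{\ast}(A_e)\cong\mathbf{k}[z_1,z_2,\dots,z_{e-1},x,y]/J,$$ where $\deg z_i=0$, $\deg x=1$, $\deg y=2$, and $J$ is the ideal $$J=\left\langle z_iz_j,\ z_ix,\ z_iy,\ x^2,\ xy^{e-1},\ y^e\ \middle|\ 1\le i,j\le e-1\right\rangle.$$
   Context: For a $\mathbf{k}$-algebra $R$ put $R^{\mathrm{en}} = R\otimes_{\mathbf{k}} R^{\mathrm{op}}$, $\mathrm{HH}^i(R)=\mathrm{Ext}^i_{R^{\mathrm{en}}}(R,R)$ and $\mathrm{HH}^{\ast}(R)=\bigoplus_{i\ge 0}\mathrm{HH}^i(R)$, a graded algebra under the Yoneda product. The quantum characteristic is $e=\inf\{i\in\mathbb{Z}_{\ge1}\mid 1+q+\cdots+q^{i-1}=0\text{ in }\mathbf{k}\}$ (so $e\ge2$). $A_e$ is the $\mathbf{k}$-algebra given by the quiver with vertices $1,\dots,e$ and arrows $\alpha(i):i\to i+1$, $\alpha^-(i):i+1\to i$ for $1\le i\le e-1$, with relations $\alpha(i)\alpha(i-1)=0$, $\alpha^-(i-1)\alpha^-(i)=0$, $\alpha(i-1)\alpha^-(i-1)=\alpha^-(i)\alpha(i)$ for $2\le i\le e-1$, and $\alpha(e-1)\alpha^-(e-1)=0$ (paths are composed from right to left). *)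

(* Defs.v *)
From HB Require Import structures.
From mathcomp Require Import all_boot all_order all_algebra.
From mathcomp Require Import boolp finmap monalg.
Set Implicit Arguments.
Unset Strict Implicit.
Unset Printing Implicit Defensive.
Import GRing.Theory.
Local Open Scope ring_scope.
Local Open Scope quotient_scope.

Section LinearExtension.
Variables (E : nzRingType) (X : choiceType) (V : lmodType E).

Definition lext (f : X -> V) (g : {malg E[X]}) : V :=
  \sum_(x <- msupp g) g@_x *: f x.

Lemma lextEw (f : X -> V) (g : {malg E[X]}) (d : {fset X}) :
  (msupp g `<=` d)%fset -> lext f g = \sum_(x <- d) g@_x *: f x.
Proof.
move=> le_gd; rewrite /lext (big_fset_incl _ le_gd) //.
by move=> x _ /mcoeff_outdom ->; rewrite scale0r.
Qed.

Lemma lext_is_linear (f : X -> V) : linear (lext f).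
Proof.
move=> a u v; pose d := (msupp (a *: u + v) `|` (msupp u `|` msupp v))%fset.
rewrite (@lextEw f _ d) ?fsubsetUl // (@lextEw f u d); last first.
  by rewrite fsubsetU // orbC fsubsetUl.
rewrite (@lextEw f v d); last by rewrite fsubsetU // orbC fsubsetUr.
rewrite scaler_sumr -big_split; apply: eq_bigr => x _ /=.
by rewrite mcoeffD mcoeffZ scalerDl scalerA.
Qed.
HB.instance Definition _ (f : X -> V) :=
  GRing.isLinear.Build E {malg E[X]} V _ (lext f) (lext_is_linear f).

Lemma lextU (f : X -> V) x : lext f << x >> = f x.
Proof.
by rewrite (lextEw _ msuppU_le) big_seq_fset1 mcoeffUU scale1r.
Qed.

Lemma malg_linE (g : {malg E[X]}) : g = \sum_(x <- msupp g) g@_x *: << x >>.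
Proof.
rewrite {1}[g]monalgE; apply: eq_bigr => x _.
by apply/malgP => y; rewrite mcoeffZ !mcoeffU mulrnAr mulr1.
Qed.

Lemma malg_lin_eq (h h' : {malg E[X]} -> V) :
  linear h -> linear h' -> (forall x, h << x >> = h' << x >>) -> h =1 h'.
Proof.
move=> hl hl' e g.
pose H : {linear {malg E[X]} -> V} := HB.pack h (GRing.isLinear.Build _ _ _ _ h hl).
pose H' : {linear {malg E[X]} -> V} :=
  HB.pack h' (GRing.isLinear.Build _ _ _ _ h' hl').
rewrite -[h g]/(H g) -[h' g]/(H' g) [g]malg_linE !linear_sum.
by apply: eq_bigr => x _; rewrite !linearZ /=; congr (_ *: _); apply: e.
Qed.

End LinearExtension.

Section LinearQuotient.
Variables (K : pzRingType) (V : lmodType K).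

Record submodule := Submodule {
  smem :> V -> Prop;
  smem0 : smem 0;
  smemD : forall u v, smem u -> smem v -> smem (u + v);
  smemZ : forall a u, smem u -> smem (a *: u) }.

Variable S : submodule.

Lemma smemN u : S u -> S (- u).
Proof. by rewrite -scaleN1r; apply: smemZ. Qed.
Lemma smemB u v : S u -> S v -> S (u - v).
Proof. by move=> su sv; apply: smemD => //; apply: smemN. Qed.

Definition lq_rel : rel V := fun u v => `[< S (u - v) >].
Lemma lq_refl : reflexive lq_rel.
Proof. by move=> u; apply/asboolP; rewrite subrr; apply: smem0. Qed.
Lemma lq_sym : symmetric lq_rel.
Proof.
by move=> u v; apply/asboolP/asboolP => /smemN; rewrite opprB.
Qed.
Lemma lq_trans : transitive lq_rel.
Proof.
move=> v u w /asboolP suv /asboolP svw; apply/asboolP.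
by rewrite -[u](subrK v) -addrA; apply: smemD.
Qed.
Canonical lq_equiv := EquivRel lq_rel lq_refl lq_sym lq_trans.

Definition lquot : Type := {eq_quot lq_equiv}.
HB.instance Definition _ := Choice.on lquot.
HB.instance Definition _ := EqQuotient.on lquot.

Definition lpi (u : V) : lquot := \pi_lquot u.

Lemma lpiP u v : lpi u = lpi v <-> S (u - v).
Proof.
rewrite /lpi; split; first by move/eqmodP => /asboolP.
by move=> suv; apply/eqmodP/asboolP.
Qed.

Lemma lpi_repr x : lpi (repr x) = x.
Proof. exact: reprK. Qed.

Lemma repr_lpi u : S (repr (lpi u) - u).
Proof. by apply/lpiP; rewrite lpi_repr. Qed.

Lemma lpi_surj x : exists u, x = lpi u.
Proof. by exists (repr x); rewrite lpi_repr. Qed.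

Definition lq_add (x y : lquot) := lpi (repr x + repr y).
Definition lq_opp (x : lquot) := lpi (- repr x).
Definition lq_scale (a : K) (x : lquot) := lpi (a *: repr x).

Lemma lq_addE u v : lq_add (lpi u) (lpi v) = lpi (u + v).
Proof.
by apply/lpiP; rewrite opprD addrACA; apply: smemD; apply: repr_lpi.
Qed.
Lemma lq_oppE u : lq_opp (lpi u) = lpi (- u).
Proof. by apply/lpiP; rewrite -opprD; apply/smemN/repr_lpi. Qed.
Lemma lq_scaleE a u : lq_scale a (lpi u) = lpi (a *: u).
Proof. by apply/lpiP; rewrite -scalerBr; apply/smemZ/repr_lpi. Qed.

Lemma lq_addA : associative lq_add.
Proof.
move=> x y z; case: (lpi_surj x) (lpi_surj y) (lpi_surj z).
by move=> u -> [v ->] [w ->]; rewrite !lq_addE addrA.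
Qed.
Lemma lq_addC : commutative lq_add.
Proof.
move=> x y; case: (lpi_surj x) (lpi_surj y).
by move=> u -> [v ->]; rewrite !lq_addE addrC.
Qed.
Lemma lq_add0 : left_id (lpi 0) lq_add.
Proof. by move=> x; case: (lpi_surj x) => u ->; rewrite lq_addE add0r. Qed.
Lemma lq_addN : left_inverse (lpi 0) lq_opp lq_add.
Proof.
by move=> x; case: (lpi_surj x) => u ->; rewrite lq_oppE lq_addE addNr.
Qed.
HB.instance Definition _ :=
  GRing.isZmodule.Build lquot lq_addA lq_addC lq_add0 lq_addN.

Let lq_plus u v : lpi u + lpi v = lpi (u + v).
Proof. exact: lq_addE. Qed.

Lemma lq_scaleA a b x : lq_scale a (lq_scale b x) = lq_scale (a * b) x.
Proof. by case: (lpi_surj x) => u ->; rewrite !lq_scaleE scalerA. Qed.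
Lemma lq_scale1 : left_id 1 lq_scale.
Proof. by move=> x; case: (lpi_surj x) => u ->; rewrite lq_scaleE scale1r. Qed.
Lemma lq_scaleDr : right_distributive lq_scale +%R.
Proof.
move=> a x y; case: (lpi_surj x) (lpi_surj y) => u -> [v ->].
by rewrite !(lq_scaleE, lq_plus) scalerDr.
Qed.
Lemma lq_scaleDl x : {morph lq_scale^~ x : a b / a + b}.
Proof.
by move=> a b; case: (lpi_surj x) => u ->; rewrite !(lq_scaleE, lq_plus) scalerDl.
Qed.
HB.instance Definition _ := GRing.Zmodule_isLmodule.Build K lquot
  lq_scaleA lq_scale1 lq_scaleDr lq_scaleDl.

Lemma lpi_is_linear : linear lpi.
Proof. by move=> a u v; rewrite -lq_plus -lq_scaleE. Qed.
HB.instance Definition _ := GRing.isLinear.Build K V lquot _ lpi lpi_is_linear.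

Lemma lpi_eq0 u : lpi u = 0 <-> S u.
Proof. by rewrite -[0]/(lpi 0) lpiP subr0. Qed.

End LinearQuotient.

Section AlgebraQuotient.
Variables (K : comNzRingType) (A : algType K) (S : A -> Prop).

Inductive two_sided_ideal : A -> Prop :=
| ideal_zero : two_sided_ideal 0
| ideal_step a s b x :
    S s -> two_sided_ideal x -> two_sided_ideal (a * s * b + x).

Lemma ideal_add x y :
  two_sided_ideal x -> two_sided_ideal y -> two_sided_ideal (x + y).
Proof.
elim=> [|a s b {}x Ss _ IH] iy; first by rewrite add0r.
by rewrite -addrA; apply: ideal_step => //; apply: IH.
Qed.

Lemma ideal_mul c d x : two_sided_ideal x -> two_sided_ideal (c * x * d).
Proof.
elim=> [|a s b {}x Ss _ IH]; first by rewrite mulr0 mul0r; constructor.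
by rewrite mulrDr mulrDl !mulrA -(mulrA _ b d); apply: ideal_step.
Qed.

Lemma ideal_scale (c : K) x : two_sided_ideal x -> two_sided_ideal (c *: x).
Proof.
move=> /(@ideal_mul (c%:A) 1).
by rewrite mulr1 -scalerAl mul1r.
Qed.

Lemma ideal_gen s : S s -> two_sided_ideal s.
Proof.
move=> Ss; rewrite -[s]addr0 -[s]mulr1 -[s]mul1r.
by apply: ideal_step => //; constructor.
Qed.

Definition ideal_submodule : submodule A :=
  Submodule ideal_zero ideal_add ideal_scale.

(* The proof that the ideal is proper is a parameter because algType only has
   nonzero algebras. *)
Definition quotalg (proper : ~ two_sided_ideal 1) : Type := lquot ideal_submodule.

Variable proper : ~ two_sided_ideal 1.
Local Notation Q := (quotalg proper).
HB.instance Definition _ := GRing.Lmodule.on Q.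

Definition qpi (x : A) : Q := lpi ideal_submodule x.

Lemma qpiP x y : qpi x = qpi y <-> two_sided_ideal (x - y).
Proof. exact: lpiP. Qed.
Lemma qpi_surj (x : Q) : exists u, x = qpi u.
Proof. exact: lpi_surj. Qed.

Definition qa_mul (x y : Q) : Q := qpi (repr (x : lquot _) * repr (y : lquot _)).

Lemma qa_mulE x y : qa_mul (qpi x) (qpi y) = qpi (x * y).
Proof.
apply/qpiP; set x' := repr _; set y' := repr _.
have -> : x' * y' - x * y = 1 * (x' - x) * y' + x * (y' - y) * 1.
  by rewrite mul1r mulr1 mulrBl mulrBr addrA subrK.
by apply: ideal_add; apply/ideal_mul/(repr_lpi ideal_submodule).
Qed.

Lemma qpiD x y : qpi (x + y) = qpi x + qpi y.
Proof. exact: (linearD (lpi ideal_submodule)). Qed.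
Lemma qpiZ a x : qpi (a *: x) = a *: qpi x.
Proof. exact: (linearZ_LR (lpi ideal_submodule)). Qed.

Lemma qa_mulA : associative qa_mul.
Proof.
move=> x y z; case: (qpi_surj x) (qpi_surj y) (qpi_surj z).
by move=> u -> [v ->] [w ->]; rewrite !qa_mulE mulrA.
Qed.
Lemma qa_mul1l : left_id (qpi 1) qa_mul.
Proof. by move=> x; case: (qpi_surj x) => u ->; rewrite qa_mulE mul1r. Qed.
Lemma qa_mul1r : right_id (qpi 1) qa_mul.
Proof. by move=> x; case: (qpi_surj x) => u ->; rewrite qa_mulE mulr1. Qed.
Lemma qa_mulDl : left_distributive qa_mul +%R.
Proof.
move=> x y z; case: (qpi_surj x) (qpi_surj y) (qpi_surj z).
by move=> u -> [v ->] [w ->]; rewrite !(=^~ qpiD, qa_mulE) mulrDl.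
Qed.
Lemma qa_mulDr : right_distributive qa_mul +%R.
Proof.
move=> x y z; case: (qpi_surj x) (qpi_surj y) (qpi_surj z).
by move=> u -> [v ->] [w ->]; rewrite !(=^~ qpiD, qa_mulE) mulrDr.
Qed.
Lemma qa_one_neq0 : qpi 1 != 0.
Proof. by apply/eqP => /(lpi_eq0 ideal_submodule). Qed.
HB.instance Definition _ := GRing.Zmodule_isNzRing.Build Q
  qa_mulA qa_mul1l qa_mul1r qa_mulDl qa_mulDr qa_one_neq0.

Lemma qpiM x y : qpi (x * y) = qpi x * qpi y.
Proof. exact/esym/qa_mulE. Qed.

Lemma qa_scaleAl (a : K) (x y : Q) : a *: (x * y) = (a *: x) * y.
Proof.
case: (qpi_surj x) (qpi_surj y) => u -> [v ->].
by rewrite -qpiM -!qpiZ -qpiM scalerAl.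
Qed.
HB.instance Definition _ := GRing.Lmodule_isLalgebra.Build K Q qa_scaleAl.
Lemma qa_scaleAr (a : K) (x y : Q) : a *: (x * y) = x * (a *: y).
Proof.
case: (qpi_surj x) (qpi_surj y) => u -> [v ->].
by rewrite -qpiM -!qpiZ -qpiM scalerAr.
Qed.
HB.instance Definition _ := GRing.Lalgebra_isAlgebra.Build K Q qa_scaleAr.

Lemma qpi_is_linear : linear qpi.
Proof. exact: lpi_is_linear. Qed.
HB.instance Definition _ := GRing.isLinear.Build K A Q _ qpi qpi_is_linear.
Lemma qpi_is_monoid_morphism : monoid_morphism qpi.
Proof. by split => // x y; apply: qpiM. Qed.
HB.instance Definition _ :=
  GRing.isMonoidMorphism.Build A Q qpi qpi_is_monoid_morphism.

Lemma two_sided_ideal_ker (B : nzRingType) (chi : {rmorphism A -> B}) :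
  (forall s, S s -> chi s = 0) -> forall x, two_sided_ideal x -> chi x = 0.
Proof.
move=> chiS x; elim=> [|a s b {}x Ss _ IH]; first exact: rmorph0.
by rewrite rmorphD !rmorphM IH (chiS s Ss) mulr0 mul0r addr0.
Qed.

Lemma proper_ideal (B : nzRingType) (chi : {rmorphism A -> B}) :
  (forall s, S s -> chi s = 0) -> ~ two_sided_ideal 1.
Proof.
move=> chiS /(two_sided_ideal_ker chiS)/eqP.
by rewrite rmorph1 oner_eq0.
Qed.

End AlgebraQuotient.

(* Bases with a partial associative product, such as the paths of a quiver:
   the units are the (finitely many) identities, and exactly one of them can
   be multiplied on a given side with a given element. *)
Record pmonoid := PMonoid {
  pm_sort :> choiceType;
  pm_mul : pm_sort -> pm_sort -> option pm_sort;
  pm_units : seq pm_sort;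
  pm_mulA : forall x y z,
    obind (pm_mul x) (pm_mul y z) = obind (pm_mul^~ z) (pm_mul x y);
  pm_mul1l : forall x, pmap (pm_mul^~ x) pm_units = [:: x];
  pm_mul1r : forall x, pmap (pm_mul x) pm_units = [:: x];
  pm_units_neq0 : pm_units <> [::] }.

Section PartialMonoidAlgebra.
Variables (K : comNzRingType) (G : pmonoid).

(* Free K-module on G; the product of two basis elements is their product in G,
   or 0 when that is undefined. *)
Definition pmalg : Type := {malg K[G]}.
HB.instance Definition _ := GRing.Lmodule.on pmalg.

Definition pmbase (x : G) : pmalg := << x >>.
Definition obase (o : option G) : pmalg := oapp pmbase 0 o.

Definition pm_amul (p q : pmalg) : pmalg :=
  lext (fun x => lext (fun y => obase (pm_mul x y)) q) p.
Definition pm_aone : pmalg := \sum_(x <- pm_units G) pmbase x.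

Lemma pm_amulBB x y : pm_amul (pmbase x) (pmbase y) = obase (pm_mul x y).
Proof. by rewrite /pm_amul !lextU. Qed.

Lemma pm_amul_linl q : linear (pm_amul^~ q).
Proof. exact: lext_is_linear. Qed.
Lemma pm_amul_linr p : linear (pm_amul p).
Proof.
move=> a u v; rewrite /pm_amul /lext scaler_sumr -big_split /=.
apply: eq_bigr => x _; rewrite -!/(lext _ _) linearD linearZ /= scalerDr.
by rewrite !scalerA mulrC.
Qed.

Lemma pmalg_eq (V : lmodType K) (h h' : pmalg -> V) : linear h -> linear h' ->
  (forall x, h (pmbase x) = h' (pmbase x)) -> h =1 h'.
Proof. exact: malg_lin_eq. Qed.

Let comp_lin (U V W : lmodType K) (f : V -> W) (g : U -> V) :
  linear f -> linear g -> linear (f \o g).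
Proof. by move=> hf hg a u v /=; rewrite hg hf. Qed.
Let lin0 (V W : lmodType K) (f : V -> W) : linear f -> f 0 = 0.
Proof.
move=> hf; have := hf (-1) 0 0.
by rewrite scaler0 addr0 scaleN1r addNr.
Qed.
Let linD (V W : lmodType K) (f : V -> W) u v : linear f -> f (u + v) = f u + f v.
Proof. by move=> hf; have := hf 1 u v; rewrite !scale1r. Qed.

Lemma pm_amulA : associative pm_amul.
Proof.
move=> p q r.
have ll := pm_amul_linl; have lr := pm_amul_linr.
move: p; apply: (@pmalg_eq _ (fun p => pm_amul p (pm_amul q r))
  (fun p => pm_amul (pm_amul p q) r)) => [//||x].
  exact: (comp_lin (ll r) (ll q)).
move: q; apply: (@pmalg_eq _ (fun q => pm_amul (pmbase x) (pm_amul q r))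
  (fun q => pm_amul (pm_amul (pmbase x) q) r)) => [||y].
- exact: (comp_lin (lr (pmbase x)) (ll r)).
- exact: (comp_lin (ll r) (lr (pmbase x))).
move: r; apply: (@pmalg_eq _
  (fun r => pm_amul (pmbase x) (pm_amul (pmbase y) r))
  (fun r => pm_amul (pm_amul (pmbase x) (pmbase y)) r)) => [||z].
- exact: (comp_lin (lr (pmbase x)) (lr (pmbase y))).
- exact: lr.
rewrite !pm_amulBB.
have e1 (o : option G) : pm_amul (pmbase x) (obase o) = obase (obind (pm_mul x) o).
  by case: o => [u|]; [exact: pm_amulBB | exact: lin0 (lr _)].
have e2 (o : option G) : pm_amul (obase o) (pmbase z) = obase (obind (fun t : G => pm_mul t z) o).
  by case: o => [u|]; [exact: pm_amulBB | exact: lin0 (ll _)].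
by rewrite e1 e2; congr obase; apply: pm_mulA.
Qed.

Let sum_obase (s : seq G) (f : G -> option G) :
  \sum_(x <- s) obase (f x) = \sum_(x <- pmap f s) pmbase x.
Proof.
elim: s => [|x s IH]; first by rewrite !big_nil.
by rewrite big_cons IH /=; case: (f x) => [y|] /=; rewrite ?big_cons ?add0r.
Qed.

Lemma pm_amul1l : left_id pm_aone pm_amul.
Proof.
apply: (@pmalg_eq _ (pm_amul pm_aone) id) => [||x]; first exact: pm_amul_linr.
  by [].
rewrite /pm_aone (big_morph (pm_amul^~ (pmbase x)) (id1 := 0) (op1 := +%R)).
- under eq_bigr do rewrite pm_amulBB.
  by rewrite sum_obase pm_mul1l big_seq1.
- by move=> u v; apply: linD (pm_amul_linl _).
- exact: lin0 (pm_amul_linl _).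
Qed.
Lemma pm_amul1r : right_id pm_aone pm_amul.
Proof.
apply: (@pmalg_eq _ (pm_amul^~ pm_aone) id) => [||x]; first exact: pm_amul_linl.
  by [].
rewrite /pm_aone (big_morph (pm_amul (pmbase x)) (id1 := 0) (op1 := +%R)).
- under eq_bigr do rewrite pm_amulBB.
  by rewrite sum_obase pm_mul1r big_seq1.
- by move=> u v; apply: linD (pm_amul_linr _).
- exact: lin0 (pm_amul_linr _).
Qed.
Lemma pm_amulDl : left_distributive pm_amul +%R.
Proof. by move=> p q r; apply: linD (pm_amul_linl _). Qed.
Lemma pm_amulDr : right_distributive pm_amul +%R.
Proof. by move=> p q r; apply: linD (pm_amul_linr _). Qed.
Lemma pm_aone_neq0 : pm_aone != 0.
Proof.
have [x _] : exists x : G, True.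
  by have := @pm_units_neq0 G; case: pm_units => // x; exists x.
apply/eqP => e; have := pm_amul1l (pmbase x).
rewrite e (lin0 (pm_amul_linl _)) => /(congr1 (mcoeff x)).
by rewrite mcoeff0 mcoeffUU => /esym/eqP; rewrite oner_eq0.
Qed.
HB.instance Definition _ := GRing.Zmodule_isNzRing.Build pmalg
  pm_amulA pm_amul1l pm_amul1r pm_amulDl pm_amulDr pm_aone_neq0.

Let linZ (V W : lmodType K) (f : V -> W) a u : linear f -> f (a *: u) = a *: f u.
Proof. by move=> hf; rewrite -[a *: u]addr0 hf (lin0 hf) addr0. Qed.
Lemma pm_scaleAl (a : K) (p q : pmalg) : a *: (p * q) = (a *: p) * q.
Proof. by rewrite [RHS](linZ _ _ (pm_amul_linl q)). Qed.
HB.instance Definition _ := GRing.Lmodule_isLalgebra.Build K pmalg pm_scaleAl.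
Lemma pm_scaleAr (a : K) (p q : pmalg) : a *: (p * q) = p * (a *: q).
Proof. by rewrite [RHS](linZ _ _ (pm_amul_linr p)). Qed.
HB.instance Definition _ := GRing.Lalgebra_isAlgebra.Build K pmalg pm_scaleAr.

Lemma pmbaseM x y : pmbase x * pmbase y = obase (pm_mul x y).
Proof. exact: pm_amulBB. Qed.
Lemma pmalg_one : 1 = \sum_(x <- pm_units G) pmbase x.
Proof. by []. Qed.

End PartialMonoidAlgebra.

Section LinearKernel.
Variables (E : pzRingType) (U V : lmodType E) (f : {linear U -> V}).

Definition ker_pred : {pred U} := fun u => f u == 0.
Lemma ker_pred_submod : submod_closed ker_pred.
Proof.
split; first by rewrite unfold_in linear0.
move=> a u v; rewrite !unfold_in linearD linearZ /= => /eqP -> /eqP ->.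
by rewrite scaler0 addr0.
Qed.
HB.instance Definition _ := GRing.isSubmodClosed.Build E U ker_pred ker_pred_submod.

Definition lker : Type := {u : U | u \in ker_pred}.
HB.instance Definition _ := [isSub of lker for @sval U (fun u => u \in ker_pred)].
HB.instance Definition _ := [Choice of lker by <:].
HB.instance Definition _ := [SubChoice_isSubLmodule of lker by <:].

Definition lker_val : {linear lker -> U} := val.
Lemma lker_valP (u : lker) : f (lker_val u) = 0.
Proof. exact/eqP/(valP u). Qed.
Lemma lker_ex u : f u = 0 -> exists v : lker, lker_val v = u.
Proof. by move=> /eqP fu; exists (exist _ u fu). Qed.
End LinearKernel.

Definition mklin (E : pzRingType) (U V : lmodType E) (f : U -> V)
    (hf : linear f) : {linear U -> V} :=
  HB.pack f (GRing.isLinear.Build E U V _ f hf).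

Section Resolutions.
Variable E : nzRingType.

Definition projective (P : lmodType E) : Prop :=
  forall (U V : lmodType E) (s : {linear U -> V}) (f : {linear P -> V}),
    (forall v, exists u, s u = v) ->
    exists g : {linear P -> U}, forall x, s (g x) = f x.

Record projective_resolution (M : lmodType E) := ProjectiveResolution {
  res_obj :> nat -> lmodType E;
  res_d : forall n, {linear res_obj n.+1 -> res_obj n};
  res_aug : {linear res_obj 0%N -> M};
  res_projective : forall n, projective (res_obj n);
  res_aug_surj : forall m, exists x, res_aug x = m;
  res_exact0 : forall x, res_aug x = 0 <-> exists y, x = res_d 0%N y;
  res_exact : forall n x, res_d n x = 0 <-> exists y, x = res_d n.+1 y }.

Lemma projective_lift (P U V W : lmodType E) (s : {linear U -> V})
    (t : {linear V -> W}) (f : P -> V) :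
  projective P -> linear f -> (forall v, t v = 0 -> exists u, v = s u) ->
  (forall u, t (s u) = 0) -> (forall x, t (f x) = 0) ->
  exists g : P -> U, linear g /\ forall x, s (g x) = f x.
Proof.
move=> projP lf ex ts tf.
pose mk (T : Type) (h : T -> V) (th : forall x, t (h x) = 0) (x : T) : lker t :=
  exist _ (h x) (introT eqP (th x)).
have mkl (T : lmodType E) (h : T -> V) th : linear h -> linear (@mk T h th).
  by move=> lh a u v; apply: val_inj; rewrite /= lh.
have ls : linear s by move=> a u v; rewrite linearD linearZ.
have [|g gP] := projP _ _ (mklin (mkl _ s ts ls)) (mklin (mkl _ f tf lf)).
  move=> [v vP]; have [u uE] := ex v (eqP vP).
  by exists u; apply: val_inj; rewrite /= uE.
exists g; split=> [a u v|x]; first by rewrite linearD linearZ.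
by have /(congr1 val) := gP x.
Qed.

Lemma malg_projective (X : choiceType) : projective {malg E[X]}.
Proof.
move=> U V s f surj.
have [h hP] := choice (fun x : X => surj (f << x >>)).
exists (lext h : {linear _ -> _}) => g; move: g.
apply: malg_lin_eq.
- by move=> a u v; rewrite linearD linearZ /= linearD linearZ.
- by move=> a u v; rewrite linearD linearZ.
- by move=> x; rewrite /= lextU.
Qed.

(* The standard free resolution: F_0 is free on the elements of M, F_1 is free
   on the elements of ker (F_0 -> M), and F_{n+2} is free on the elements of
   ker (F_{n+1} -> F_n). *)
Record lmap := LMap { ldom : lmodType E; lcod : lmodType E;
                      lfun : {linear ldom -> lcod} }.

Definition next_lmap (s : lmap) : lmap :=
  @LMap {malg E[lker (lfun s)]} (ldom s) (lext (lker_val (lfun s))).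

Definition free_lmap (M : lmodType E) (n : nat) : lmap :=
  iter n next_lmap (@LMap {malg E[M]} M (lext id)).

Lemma next_lmap_exact s x :
  lfun s x = 0 <-> exists y, x = lfun (next_lmap s) y.
Proof.
split=> [/lker_ex [u <-]|[y ->]]; first by exists << u >>; rewrite /= lextU.
rewrite /= /lext linear_sum big1 // => u _.
by rewrite linearZ_LR lker_valP scaler0.
Qed.

Lemma free_projective M n : projective (ldom (free_lmap M n)).
Proof. by case: n => [|n]; apply: malg_projective. Qed.

Lemma free_aug_surj (M : lmodType E) (m : M) :
  exists x, lfun (free_lmap M 0%N) x = m.
Proof. by exists << m >>; rewrite /= lextU. Qed.

Definition free_resolution (M : lmodType E) : projective_resolution M :=
  @ProjectiveResolution M (fun n => ldom (free_lmap M n))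
    (fun n => lfun (free_lmap M n.+1)) (lfun (free_lmap M 0%N))
    (@free_projective M) (@free_aug_surj M)
    (@next_lmap_exact (free_lmap M 0%N))
    (fun n => @next_lmap_exact (free_lmap M n.+1)).

End Resolutions.

Section RawLinear.
Variables (E : pzRingType) (U V : lmodType E) (f : U -> V).
Hypothesis lf : linear f.
Lemma rawlin0 : f 0 = 0. Proof. exact: (linear0 (mklin lf)). Qed.
Lemma rawlinD u v : f (u + v) = f u + f v.
Proof. exact: (linearD (mklin lf)). Qed.
Lemma rawlinB u v : f (u - v) = f u - f v.
Proof. exact: (linearB (mklin lf)). Qed.
Lemma rawlinZ a u : f (a *: u) = a *: f u.
Proof. exact: (linearZ_LR (mklin lf)). Qed.
Lemma rawlin_sum I (r : seq I) (P : pred I) F :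
  f (\sum_(i <- r | P i) F i) = \sum_(i <- r | P i) f (F i).
Proof. exact: (linear_sum (mklin lf)). Qed.
End RawLinear.

Lemma linear_zero (E : pzRingType) (U V : lmodType E) :
  linear (fun _ : U => 0 : V).
Proof. by move=> a u v; rewrite scaler0 addr0. Qed.
Lemma linear_sumf (E : pzRingType) (U V : lmodType E) I (r : seq I)
    (F : I -> U -> V) :
  (forall i, linear (F i)) -> linear (fun x => \sum_(i <- r) F i x).
Proof.
move=> lF a u v; rewrite scaler_sumr -big_split; apply: eq_bigr => i _.
exact: lF.
Qed.
Lemma linear_comp (E : pzRingType) (U V W : lmodType E) (g : V -> W) (f : U -> V) :
  linear g -> linear f -> linear (fun x => g (f x)).
Proof. by move=> lg lf a u v; rewrite lf lg. Qed.
Lemma linear_add (E : pzRingType) (U V : lmodType E) (f g : U -> V) :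
  linear f -> linear g -> linear (fun x => f x + g x).
Proof. by move=> lf lg a u v; rewrite lf lg scalerDr addrACA. Qed.
Lemma linear_opp (E : pzRingType) (U V : lmodType E) (f : U -> V) :
  linear f -> linear (fun x => - f x).
Proof. by move=> lf a u v; rewrite lf opprD scalerN. Qed.
Lemma linear_bundled (E : pzRingType) (U V : lmodType E) (f : {linear U -> V}) :
  linear f.
Proof. by move=> a u v; rewrite linearD linearZ. Qed.

Lemma dep_choice (T : nat -> Type) (R : forall m, T m -> T m.+1 -> Prop) (t0 : T 0%N) :
  (forall m s, exists s', R m s s') ->
  exists t : forall m, T m, t 0%N = t0 /\ forall m, R m (t m) (t m.+1).
Proof.
move=> step; exists (nat_rect T t0 (fun m s => sval (cid (step m s)))).
by split=> // m /=; case: cid.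
Qed.

Section Ext.
Variables (K : comNzRingType) (E : algType K) (M : lmodType E).
Variable P : projective_resolution M.
Local Notation d := (res_d P).
Local Notation aug := (res_aug P).

Definition kscale (V : lmodType E) (c : K) (v : V) : V := (c%:A : E) *: v.

Lemma kscaleC (V : lmodType E) c (a : E) (v : V) :
  kscale c (a *: v) = a *: kscale c v.
Proof. by rewrite /kscale !scalerA -scalerAr -scalerAl mul1r mulr1. Qed.

Lemma linear_kscale (U V : lmodType E) c (f : U -> V) :
  linear f -> linear (fun x => kscale c (f x)).
Proof. by move=> lf a u v; rewrite lf /kscale scalerDr -!/(kscale _ _) kscaleC. Qed.

Lemma rawlin_kscale (U V : lmodType E) c (f : U -> V) x :
  linear f -> f (kscale c x) = kscale c (f x).
Proof. by move=> lf; rewrite /kscale rawlinZ. Qed.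

Lemma kscale0 (V : lmodType E) c : kscale c 0 = 0 :> V.
Proof. exact: scaler0. Qed.

(* The direct sum over n of the modules of n-cocycles of Hom_E(P, M). *)
Record cocycle := Cocycle {
  cc :> forall n, P n -> M;
  cc_linear : forall n, linear (@cc n);
  cc_finite : exists N, forall n x, (N <= n)%N -> @cc n x = 0;
  cc_closed : forall n x, @cc n (d n x) = 0 }.

Arguments cc_linear : clear implicits.

HB.instance Definition _ := gen_eqMixin cocycle.
HB.instance Definition _ := gen_choiceMixin cocycle.

Lemma cocycleP (f g : cocycle) : (forall n x, f n x = g n x) -> f = g.
Proof.
case: f g => [f fl ff fc] [g gl gf gc] /= e.
have {}e : f = g by apply: functional_extensionality_dep => n; apply: funext.
by subst g; congr Cocycle; apply: Prop_irrelevance.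
Qed.

Lemma cc_zero_finite : exists N, forall n (x : P n), (N <= n)%N -> 0 = 0 :> M.
Proof. by exists 0. Qed.
Definition cc_zero := @Cocycle (fun _ _ => 0)
  (fun n => @linear_zero _ (P n) M) cc_zero_finite (fun _ _ => erefl).

Lemma cc_opp_finite (f : cocycle) :
  exists N, forall n x, (N <= n)%N -> - f n x = 0.
Proof. by have [N fN] := cc_finite f; exists N => n x /fN ->; rewrite oppr0. Qed.
Lemma cc_opp_closed (f : cocycle) n x : - f n (d n x) = 0.
Proof. by rewrite cc_closed oppr0. Qed.
Definition cc_opp (f : cocycle) := @Cocycle (fun n x => - f n x)
  (fun n => linear_opp (cc_linear f n)) (cc_opp_finite f) (cc_opp_closed f).

Lemma cc_add_finite (f g : cocycle) :
  exists N, forall n x, (N <= n)%N -> f n x + g n x = 0.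
Proof.
have [N fN] := cc_finite f; have [N' gN] := cc_finite g.
exists (N + N')%N => n x le; rewrite fN ?gN ?addr0 //.
  by apply: leq_trans le; apply: leq_addl.
by apply: leq_trans le; apply: leq_addr.
Qed.
Lemma cc_add_closed (f g : cocycle) n x : f n (d n x) + g n (d n x) = 0.
Proof. by rewrite !cc_closed addr0. Qed.
Definition cc_add (f g : cocycle) := @Cocycle (fun n x => f n x + g n x)
  (fun n => linear_add (cc_linear f n) (cc_linear g n))
  (cc_add_finite f g) (cc_add_closed f g).

Lemma cc_scale_finite c (f : cocycle) :
  exists N, forall n x, (N <= n)%N -> kscale c (f n x) = 0.
Proof. by have [N fN] := cc_finite f; exists N => n x /fN ->; rewrite kscale0. Qed.
Lemma cc_scale_closed c (f : cocycle) n x : kscale c (f n (d n x)) = 0.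
Proof. by rewrite cc_closed kscale0. Qed.
Definition cc_scale (c : K) (f : cocycle) := @Cocycle (fun n x => kscale c (f n x))
  (fun n => linear_kscale c (cc_linear f n))
  (cc_scale_finite c f) (cc_scale_closed c f).

Lemma cc_addA : associative cc_add.
Proof. by move=> f g h; apply: cocycleP => n x /=; rewrite addrA. Qed.
Lemma cc_addC : commutative cc_add.
Proof. by move=> f g; apply: cocycleP => n x /=; rewrite addrC. Qed.
Lemma cc_add0 : left_id cc_zero cc_add.
Proof. by move=> f; apply: cocycleP => n x /=; rewrite add0r. Qed.
Lemma cc_addN : left_inverse cc_zero cc_opp cc_add.
Proof. by move=> f; apply: cocycleP => n x /=; rewrite addNr. Qed.
HB.instance Definition _ :=
  GRing.isZmodule.Build cocycle cc_addA cc_addC cc_add0 cc_addN.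

Lemma cc_scaleA a b f : cc_scale a (cc_scale b f) = cc_scale (a * b) f.
Proof.
apply: cocycleP => n x /=.
by rewrite /kscale scalerA -scalerAl mul1r scalerA.
Qed.
Lemma cc_scale1 : left_id 1 cc_scale.
Proof. by move=> f; apply: cocycleP => n x; rewrite /= /kscale !scale1r. Qed.
Lemma cc_scaleDr : right_distributive cc_scale +%R.
Proof. by move=> a f g; apply: cocycleP => n x; rewrite /= /kscale scalerDr. Qed.
Lemma cc_scaleDl f : {morph cc_scale^~ f : a b / a + b}.
Proof.
by move=> a b; apply: cocycleP => n x; rewrite /= /kscale !scalerDl.
Qed.
HB.instance Definition _ := GRing.Zmodule_isLmodule.Build K cocycle
  cc_scaleA cc_scale1 cc_scaleDr cc_scaleDl.

Definition is_coboundary (f : cocycle) : Prop :=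
  exists h : forall n, P n -> M,
    [/\ forall n, linear (h n), forall x, f 0%N x = 0
      & forall n x, f n.+1 x = h n (d n x)].

Lemma coboundary0 : is_coboundary 0.
Proof. by exists (fun _ _ => 0); split=> // n; apply: linear_zero. Qed.
Lemma coboundaryD f g :
  is_coboundary f -> is_coboundary g -> is_coboundary (f + g).
Proof.
move=> [h [hl f0 fS]] [h' [hl' g0 gS]].
exists (fun n x => h n x + h' n x); split=> [n|x|n x].
- exact: linear_add.
- by rewrite /= f0 g0 addr0.
- by rewrite /= fS gS.
Qed.
Lemma coboundaryZ c f : is_coboundary f -> is_coboundary (c *: f).
Proof.
move=> [h [hl f0 fS]]; exists (fun n x => kscale c (h n x)); split=> [n|x|n x].
- exact: linear_kscale.
- by rewrite /= f0 kscale0.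
- by rewrite /= fS.
Qed.
Definition coboundaries : submodule cocycle :=
  Submodule coboundary0 coboundaryD coboundaryZ.

(* The differential with target M in degree 0. *)
Definition dtarget (m : nat) : lmodType E := if m is m'.+1 then P m' else M.
Definition dfull (m : nat) : {linear P m -> dtarget m} :=
  match m with 0 => aug | m'.+1 => d m' end.

Lemma dfull_exact m x : dfull m x = 0 <-> exists y, x = d m y.
Proof. by case: m x => [|m] x; [apply: res_exact0 | apply: res_exact]. Qed.
Lemma dfull_d m y : dfull m (d m y) = 0.
Proof. by apply/dfull_exact; exists y. Qed.
Lemma dd m y : d m (d m.+1 y) = 0.
Proof. exact: (dfull_d y). Qed.

(* A lift of the cocycle f to a chain endomorphism of P: the component of
   degree n of f is lifted to the maps P_{m+n} -> P_m, m >= 0, which commute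
   with the differentials, without signs. *)
Record cc_lift (f : cocycle) := CcLift {
  lf :> forall N m, P N -> P m;
  lf_linear : forall N m, linear (@lf N m);
  lf_low : forall N m x, (N < m)%N -> @lf N m x = 0;
  lf_high : exists a, forall N m x, (m + a <= N)%N -> @lf N m x = 0;
  lf_aug : forall N x, aug (@lf N 0%N x) = f N x;
  lf_d : forall N m x, d m (@lf N.+1 m.+1 x) = @lf N m (d N x) }.

Arguments lf_linear {f} _ _ _.

Lemma cc_lift_exists f : exists _ : cc_lift f, True.
Proof.
have [a fa] := cc_finite f.
pose good m (F : forall N, P N -> P m) :=
  [/\ forall N, linear (F N),
      forall N x, (N < m)%N -> F N x = 0,
      forall N x, (m + a <= N)%N -> F N x = 0
    & forall N x, dfull m (F N (d N x)) = 0].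
have [t0 t0P] : exists t : {F | good 0%N F},
    forall N x, aug (sval t N x) = f N x.
  have ex N : exists g : P N -> P 0%N, [/\ linear g,
      (a <= N)%N -> forall x, g x = 0 & forall x, aug (g x) = f N x].
    case: (leqP a N) => [le|lt].
      exists (fun _ => 0); split=> // [|x]; first exact: linear_zero.
      by rewrite linear0 fa.
    have [g gP] := @res_projective _ _ P N _ _ aug (mklin (cc_linear f N))
      (@res_aug_surj _ _ P).
    by exists g; split=> //; apply: linear_bundled.
  pose F N := sval (cid (ex N)); have FP N := svalP (cid (ex N)).
  suff gF : good 0%N F.
    by exists (exist _ F gF) => N x; case: (FP N) => _ _; apply.
  split=> [N|//|N x le|N x]; first by case: (FP N).
    by case: (FP N) => _ FN _; apply: FN.
  by case: (FP N) => _ _ e; rewrite [LHS]e cc_closed.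
pose R m (s : {F | good m F}) (s' : {F | good m.+1 F}) :=
  forall N x, d m (sval s' N.+1 x) = sval s N (d N x).
have [|t [te tR]] := @dep_choice _ R t0.
  move=> m [F [Fl Flow Fhigh Fd]].
  have ex N : exists g : P N -> P m.+1, [/\ linear g,
      (N < m.+1)%N -> forall x, g x = 0, (m.+1 + a <= N)%N -> forall x, g x = 0
      & match N return (P N -> P m.+1) -> Prop with
        | 0 => fun _ => True
        | N'.+1 => fun g => forall x, d m (g x) = F N' (d N' x) end g].
    case: N => [|N].
      by exists (fun _ => 0); split=> //; apply: linear_zero.
    have [lo|lo] := ltnP N m.
      exists (fun _ => 0); split=> // [|x]; first exact: linear_zero.
      by rewrite linear0 Flow.
    have [hi|hi] := leqP (m + a) N.
      exists (fun _ => 0); split=> // [|x]; first exact: linear_zero.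
      by rewrite linear0 Fhigh.
    have [|g [gl gP]] := @projective_lift _ (P N.+1) _ _ _ (d m) (dfull m)
      (fun x => F N (d N x)) (@res_projective _ _ P N.+1)
      (linear_comp (Fl N) (@linear_bundled _ _ _ (d N))) _ (@dfull_d m) (Fd N).
      by move=> v /dfull_exact.
    exists g; split=> //; first by rewrite ltnS ltnNge lo.
    by rewrite addSn ltnS leqNgt hi.
  pose G N := sval (cid (ex N)); have GP N := svalP (cid (ex N)).
  suff gG : good m.+1 G.
    by exists (exist _ G gG) => N x; case: (GP N.+1) => _ _ _; apply.
  split=> [N|N x lt|N x le|N x].
  - by case: (GP N).
  - by case: (GP N) => _ GN _ _; apply: GN.
  - by case: (GP N) => _ _ GN _; apply: GN.
  - case: N x => [|N] x.
      by case: (GP 0%N) => _ G0 _ _; rewrite [G _ _]G0 // linear0.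
    case: (GP N.+1) => _ _ _ e; rewrite [LHS]e dd.
    by rewrite (rawlin0 (Fl N)).
have tP m := svalP (t m).
unshelve eexists; last by [].
exists (fun N m => sval (t m) N).
- by move=> N m; case: (tP m).
- by move=> N m x; case: (tP m) => _ + _ _; apply.
- by exists a => N m x; case: (tP m) => _ _ + _; apply.
- by move=> N x; rewrite te t0P.
- by move=> N m x; apply: tR.
Qed.

Definition the_lift (f : cocycle) : cc_lift f := projT1 (cid (cc_lift_exists f)).

(* f o G, for a lift G of the cocycle g. *)
Definition ccomp_fun (f g : cocycle) (G : cc_lift g) (N : nat) (x : P N) : M :=
  \sum_(0 <= m < N.+1) f m (G N m x).

Lemma ccomp_linear f g (G : cc_lift g) N : linear (@ccomp_fun f g G N).
Proof.
apply: linear_sumf => m.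
by apply: linear_comp (cc_linear f m) _; apply: lf_linear.
Qed.

Lemma ccomp_finite f g (G : cc_lift g) :
  exists N, forall n x, (N <= n)%N -> @ccomp_fun f g G n x = 0.
Proof.
have [b fb] := cc_finite f; have [a Ga] := lf_high G.
exists (b + a)%N => n x le; rewrite /ccomp_fun big1_seq // => m _.
have [bm|mb] := leqP b m; first exact: fb.
rewrite Ga ?(rawlin0 (cc_linear f m)) //.
by apply: leq_trans le; rewrite leq_add2r ltnW.
Qed.

Lemma ccomp_closed f g (G : cc_lift g) n x : @ccomp_fun f g G n (d n x) = 0.
Proof.
rewrite /ccomp_fun big1_seq // => m _.
by rewrite -(lf_d G) cc_closed.
Qed.

Definition ccomp f g (G : cc_lift g) :=
  @Cocycle (@ccomp_fun f g G) (ccomp_linear f G) (ccomp_finite f G)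
    (ccomp_closed f G).

Lemma ccomp_coboundaryl f g (G : cc_lift g) :
  is_coboundary f -> is_coboundary (ccomp f G).
Proof.
move=> [h [hl f0 fS]].
exists (fun N x => \sum_(0 <= m < N.+1) h m (G N m x)); split=> [N|x|N x].
- apply: linear_sumf => m.
  by apply: linear_comp (hl m) _; apply: lf_linear.
- by rewrite /= /ccomp_fun big_nat1 f0.
- rewrite /= /ccomp_fun [LHS]big_nat_recl //= f0 add0r.
  by apply: eq_bigr => m _; rewrite fS lf_d.
Qed.

Lemma homotopy_exists g (G : cc_lift g) : is_coboundary g ->
  exists H : forall N m, P N -> P m, (forall N m, linear (H N m)) /\
    forall m,
      (forall x, G 0%N m x = d m (H 0%N m.+1 x)) /\
      (forall N x, G N.+1 m x = d m (H N.+1 m.+1 x) + H N m (d N x)).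
Proof.
move=> [h [hl g0 gS]].
pose pre m (H : forall N, P N -> P m) N : P N -> P m :=
  match N return P N -> P m with
  | 0 => fun _ => 0
  | N'.+1 => fun x => H N' (d N' x)
  end.
have prel m H : (forall N, linear (H N)) -> forall N, linear (@pre m H N).
  move=> Hl [|N]; first exact: linear_zero.
  by apply: linear_comp (Hl N) _; apply: linear_bundled.
have pred m H N x : (forall N, linear (H N)) -> @pre m H N.+1 (d N.+1 x) = 0.
  by move=> Hl /=; rewrite dd (rawlin0 (Hl N)).
pose good m (H : forall N, P N -> P m) := (forall N, linear (H N)) /\
  forall N x, dfull m (G N m x - @pre m H N x) = 0.
have [t0 _] : exists t : {H | good 0%N H}, True.
  have ex N : exists k : {linear P N -> P 0%N}, forall x, aug (k x) = h N x.
    exact: (@res_projective _ _ P N _ _ aug (mklin (hl N)) (@res_aug_surj _ _ P)).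
  have [k kP] : exists k : forall N, {linear P N -> P 0%N},
      forall N x, aug (k N x) = h N x.
    by exists (fun N => sval (cid (ex N))) => N; case: cid.
  suff gk : good 0%N (fun N => k N) by exists (exist _ _ gk).
  split=> [N|[|N] x]; first exact: linear_bundled.
    by rewrite subr0 [LHS]lf_aug g0.
  by rewrite linearB /= lf_aug kP gS subrr.
pose R m (s : {H | good m H}) (s' : {H | good m.+1 H}) :=
  forall N x, d m (sval s' N x) = G N m x - pre m (sval s) N x.
have [|t [_ tR]] := @dep_choice _ R t0.
  move=> m [H [Hl HP]].
  have ex N : exists k : P N -> P m.+1,
      linear k /\ forall x, d m (k x) = G N m x - pre m H N x.
    apply: (@projective_lift _ (P N) _ _ _ (d m) (dfull m)).
    - exact: res_projective.
    - by apply: linear_add (lf_linear G N m) _; apply: linear_opp; apply: prel.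
    - by move=> v /dfull_exact.
    - exact: dfull_d.
    - exact: HP.
  pose k N := sval (cid (ex N)); have kP N := svalP (cid (ex N)).
  suff gk : good m.+1 k by exists (exist _ _ gk) => N x; case: (kP N) => _; apply.
  split=> [N|[|N] x]; first by case: (kP N).
    by rewrite subr0 lf_low ?linear0.
  rewrite linearB /= lf_d.
  by case: (kP N) => _ ->; rewrite opprB addrC subrK; case: N x => [//|N x]; apply: pred.
exists (fun N m => sval (t m) N); split=> [N m|m].
  by have [] := svalP (t m).
by split=> [x|N x]; rewrite tR /= ?subr0 ?subrK.
Qed.

Lemma ccomp_coboundaryr f g (G : cc_lift g) :
  is_coboundary g -> is_coboundary (ccomp f G).
Proof.
move=> /(homotopy_exists G) [H [Hl HP]].
exists (fun N x => \sum_(0 <= m < N.+2) f m (H N m x)); split=> [N|x|N x].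
- by apply: linear_sumf => m; apply: linear_comp (cc_linear f m) _.
- by rewrite /= /ccomp_fun big_nat1 (HP 0%N).1 cc_closed.
- rewrite /= /ccomp_fun; apply: eq_bigr => m _.
  by rewrite (HP m).2 (rawlinD (cc_linear f m)) cc_closed add0r.
Qed.

Lemma lift_scale_add c g g' (G : cc_lift g) (G' : cc_lift g') :
  exists L : cc_lift (c *: g + g'), forall N m x,
    L N m x = kscale c (G N m x) + G' N m x.
Proof.
unshelve eexists.
  exists (fun N m (x : P N) => kscale c (G N m x) + G' N m x : P m).
  - move=> N m; apply: linear_add; last exact: lf_linear.
    by apply: linear_kscale; apply: lf_linear.
  - by move=> N m x lt; rewrite !lf_low // kscale0 addr0.
  - have [a Ga] := lf_high G; have [b Gb] := lf_high G'.
    exists (a + b)%N => N m x le; rewrite Ga ?Gb ?kscale0 ?addr0 //.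
      by apply: leq_trans le; rewrite leq_add2l leq_addl.
    by apply: leq_trans le; rewrite leq_add2l leq_addr.
  - move=> N x; rewrite linearD /= rawlin_kscale; last exact: linear_bundled.
    by rewrite !lf_aug.
  - move=> N m x; rewrite linearD /= rawlin_kscale; last exact: linear_bundled.
    by rewrite !lf_d.
by [].
Qed.

Lemma lift_comp f g (F : cc_lift f) (G : cc_lift g) :
  exists L : cc_lift (ccomp f G), forall N l x,
    L N l x = \sum_(0 <= m < N.+1) F m l (G N m x).
Proof.
unshelve eexists.
  exists (fun N l (x : P N) => \sum_(0 <= m < N.+1) F m l (G N m x)).
  - move=> N l; apply: linear_sumf => m.
    by apply: linear_comp; apply: lf_linear.
  - move=> N l x lt; rewrite big1_seq // => m /andP[_].
    rewrite mem_index_iota => /andP[_ mN]; apply: lf_low.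
    exact: leq_ltn_trans lt.
  - have [a Fa] := lf_high F; have [b Gb] := lf_high G.
    exists (a + b)%N => N l x le; rewrite big1_seq // => m _.
    have [le1|lt1] := leqP (l + a) m; first exact: Fa.
    rewrite Gb ?(rawlin0 (lf_linear F m l)) //.
    by apply: leq_trans le; rewrite addnA leq_add2r ltnW.
  - move=> N x; rewrite linear_sum; apply: eq_bigr => m _; exact: lf_aug.
  - move=> N l x; rewrite linear_sum [LHS]big_nat_recl //=.
    rewrite (lf_low F) // linear0 add0r.
    by apply: eq_bigr => m _ /=; rewrite !lf_d.
by [].
Qed.

Definition cc_one_fun (n : nat) : P n -> M :=
  match n with 0 => aug | _.+1 => fun _ => 0 end.
Lemma cc_one_linear n : linear (@cc_one_fun n).
Proof. by case: n => [|n]; [apply: linear_bundled | apply: linear_zero]. Qed.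
Lemma cc_one_finite : exists N, forall n x, (N <= n)%N -> @cc_one_fun n x = 0.
Proof. by exists 1%N; case. Qed.
Lemma cc_one_closed n x : @cc_one_fun n (d n x) = 0.
Proof. by case: n x => [|n] x //; apply: (@dfull_d 0%N). Qed.
Definition cc_one := Cocycle cc_one_linear cc_one_finite cc_one_closed.

Lemma cc_one_lift : exists L : cc_lift cc_one, forall N x,
  L N N x = x /\ forall m, m != N -> L N m x = 0.
Proof.
pose L N m : P N -> P m :=
  match eq_comparable N m with
  | left e => fun x => eq_rect N (fun k => P k : Type) x m e
  | right _ => fun _ => 0
  end.
have LNN N x : L N N x = x.
  rewrite /L; case: eq_comparable => [e|/(_ erefl)//].
  by rewrite (eq_axiomK e).
have Lne N m x : m != N -> L N m x = 0.
  rewrite /L; case: eq_comparable => // e ne.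
  by case/eqP: ne; apply: esym.
unshelve eexists.
  exists L.
  - move=> N m; have [<-|ne] := eqVneq m N.
      by move=> a u v; rewrite !LNN.
    by move=> a u v; rewrite !Lne // scaler0 addr0.
  - by move=> N m x lt; apply: Lne; rewrite gtn_eqF.
  - exists 1%N => N m x; rewrite addn1 => lt; apply: Lne.
    by rewrite ltn_eqF.
  - by case=> [|N] x; rewrite ?LNN // Lne // linear0.
  - move=> N m; have [<- x|ne x] := eqVneq m N; first by rewrite !LNN.
    by rewrite !Lne ?linear0.
by move=> N x; split=> [|m ne]; [apply: LNN | apply: Lne].
Qed.

(* Ext_E^*(M, M): the cohomology of Hom_E(P, M) in all degrees, where the
   product of the classes of f and g is the class of f o G, for G a lift of g.
   As algType only has nonzero algebras, M is required to be nonzero. *)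
Definition ext_alg (M_neq0 : exists m : M, m != 0) : Type := lquot coboundaries.

Variable M_neq0 : exists m : M, m != 0.
Local Notation Ext := (ext_alg M_neq0).
HB.instance Definition _ := GRing.Lmodule.on Ext.

Definition ext_class (f : cocycle) : Ext := lpi coboundaries f.

Lemma ext_classP f g : ext_class f = ext_class g <-> is_coboundary (f - g).
Proof. exact: lpiP. Qed.
Lemma ext_class_surj (x : Ext) : exists f, x = ext_class f.
Proof. exact: lpi_surj. Qed.

Definition ext_mul (x y : Ext) : Ext :=
  ext_class (ccomp (repr (x : lquot _)) (the_lift (repr (y : lquot _)))).

Lemma ext_mulE f g (G : cc_lift g) :
  ext_mul (ext_class f) (ext_class g) = ext_class (ccomp f G).
Proof.
apply/ext_classP; set f' := repr _; set g' := repr _; set G' := the_lift g'.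
have [L LE] := lift_scale_add (-1) G G'.
have -> : ccomp f' G' - ccomp f G = ccomp (f' - f) G' + ccomp f L.
  apply: cocycleP => N x; rewrite /= /ccomp_fun -sumrN -!big_split /=.
  apply: eq_bigr => m _; rewrite LE /kscale scaleN1r scaleN1r [- G N m x + _]addrC.
  by rewrite (rawlinB (cc_linear f m)) addrA subrK.
apply: coboundaryD; [apply: ccomp_coboundaryl | apply: ccomp_coboundaryr].
  exact: (repr_lpi coboundaries f).
by rewrite scaleN1r addrC; apply: (repr_lpi coboundaries g).
Qed.

Lemma ext_classD f g : ext_class (f + g) = ext_class f + ext_class g.
Proof. exact: (linearD (lpi coboundaries)). Qed.
Lemma ext_classZ a f : ext_class (a *: f) = a *: ext_class f.
Proof. exact: (linearZ_LR (lpi coboundaries)). Qed.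

Lemma ext_mulA : associative ext_mul.
Proof.
move=> x y z; have [f ->] := ext_class_surj x; have [g ->] := ext_class_surj y.
have [h ->] := ext_class_surj z; have [L LE] := lift_comp (the_lift g) (the_lift h).
rewrite (ext_mulE g (the_lift h)) (ext_mulE f (the_lift g)).
rewrite (ext_mulE f L) (ext_mulE _ (the_lift h)); congr ext_class.
apply: cocycleP => N x0; rewrite /= /ccomp_fun /=.
under eq_bigr => l _ do rewrite LE (rawlin_sum (cc_linear f l)).
rewrite exchange_big /=; apply: eq_big_nat => m /andP[_ mN].
rewrite /ccomp_fun (big_cat_nat (n := m.+1)) //= [X in _ + X]big1_seq ?addr0 //.
move=> l /andP[_]; rewrite mem_index_iota => /andP[lt _].
by rewrite lf_low // (rawlin0 (cc_linear f l)).
Qed.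

Lemma ext_mul1l : left_id (ext_class cc_one) ext_mul.
Proof.
move=> x; have [f ->] := ext_class_surj x.
rewrite (ext_mulE _ (the_lift f)); congr ext_class.
apply: cocycleP => N x0; rewrite /= /ccomp_fun big_nat_recl //= lf_aug.
by rewrite big1 ?addr0.
Qed.

Lemma ext_mul1r : right_id (ext_class cc_one) ext_mul.
Proof.
move=> x; have [f ->] := ext_class_surj x; have [L LE] := cc_one_lift.
rewrite (ext_mulE _ L); congr ext_class.
apply: cocycleP => N x0; rewrite /= /ccomp_fun big_nat_recr //= (LE N x0).1.
rewrite big1_seq ?add0r // => m /andP[_]; rewrite mem_index_iota => /andP[_ lt].
by rewrite (LE N x0).2 ?ltn_eqF // (rawlin0 (cc_linear f m)).
Qed.

Lemma ext_mul_scale_addl c x y z :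
  ext_mul (c *: x + y) z = c *: ext_mul x z + ext_mul y z.
Proof.
have [f ->] := ext_class_surj x; have [g ->] := ext_class_surj y.
have [h ->] := ext_class_surj z; rewrite -ext_classZ -ext_classD.
rewrite !(ext_mulE _ (the_lift h)) -ext_classZ -ext_classD; congr ext_class.
apply: cocycleP => N x0; rewrite /= /ccomp_fun /= /kscale scaler_sumr -big_split.
by [].
Qed.

Lemma ext_mul_scale_addr c x y z :
  ext_mul x (c *: y + z) = c *: ext_mul x y + ext_mul x z.
Proof.
have [f ->] := ext_class_surj x; have [g ->] := ext_class_surj y.
have [h ->] := ext_class_surj z; rewrite -ext_classZ -ext_classD.
have [L LE] := lift_scale_add c (the_lift g) (the_lift h).
rewrite (ext_mulE _ L) (ext_mulE _ (the_lift g)) (ext_mulE _ (the_lift h)).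
rewrite -ext_classZ -ext_classD; congr ext_class.
apply: cocycleP => N x0; rewrite /= /ccomp_fun /kscale scaler_sumr -big_split /=.
apply: eq_bigr => m _.
by rewrite LE (rawlinD (cc_linear f m)) (rawlin_kscale _ _ (cc_linear f m)).
Qed.

Lemma ext_mulDl : left_distributive ext_mul +%R.
Proof.
by move=> x y z; have := ext_mul_scale_addl 1 x y z; rewrite !scale1r.
Qed.
Lemma ext_mulDr : right_distributive ext_mul +%R.
Proof.
by move=> x y z; have := ext_mul_scale_addr 1 x y z; rewrite !scale1r.
Qed.

Lemma ext_one_neq0 : ext_class cc_one != 0.
Proof.
apply/eqP => /(lpi_eq0 coboundaries) [h [_ h0 _]].
case: M_neq0 => m /eqP; apply; have [x <-] := res_aug_surj P m.
exact: h0.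
Qed.
HB.instance Definition _ := GRing.Zmodule_isNzRing.Build Ext
  ext_mulA ext_mul1l ext_mul1r ext_mulDl ext_mulDr ext_one_neq0.

Lemma ext_scaleAl (a : K) (x y : Ext) : a *: (x * y) = (a *: x) * y.
Proof.
have := ext_mul_scale_addl a x 0 y; rewrite addr0 => e; rewrite [RHS]e.
by rewrite [X in _ = _ + X](mul0r y) addr0.
Qed.
HB.instance Definition _ := GRing.Lmodule_isLalgebra.Build K Ext ext_scaleAl.
Lemma ext_scaleAr (a : K) (x y : Ext) : a *: (x * y) = x * (a *: y).
Proof.
have := ext_mul_scale_addr a x y 0; rewrite addr0 => e; rewrite [RHS]e.
by rewrite [X in _ = _ + X](mulr0 x) addr0.
Qed.
HB.instance Definition _ := GRing.Lalgebra_isAlgebra.Build K Ext ext_scaleAr.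

Lemma ext_classM f g (G : cc_lift g) :
  ext_class (ccomp f G) = ext_class f * ext_class g.
Proof. exact/esym/ext_mulE. Qed.

(* The component Ext_E^n(M, M): the classes of the n-cocycles. *)
Definition ext_degree (n : nat) (x : Ext) : Prop :=
  exists f : cocycle, x = ext_class f /\ forall m u, m <> n -> f m u = 0.

End Ext.

Section Enveloping.
Variables (K : comNzRingType) (A : algType K).

(* The pair (a, b) is the tensor of a in A and b in A^op. *)
Definition env_mul (x y : A * A) : option (A * A) :=
  Some (x.1 * y.1, y.2 * x.2).
Lemma env_mulA x y z :
  obind (env_mul x) (env_mul y z) = obind (env_mul^~ z) (env_mul x y).
Proof. by rewrite /env_mul /= !mulrA. Qed.
Lemma env_mul1l x : pmap (env_mul^~ x) [:: (1, 1)] = [:: x].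
Proof. by case: x => a b; rewrite /= mul1r mulr1. Qed.
Lemma env_mul1r x : pmap (env_mul x) [:: (1, 1)] = [:: x].
Proof. by case: x => a b; rewrite /= mul1r mulr1. Qed.
Lemma env_units_neq0 : [:: (1 : A, 1 : A)] <> [::].
Proof. by []. Qed.
Definition env_pmonoid : pmonoid :=
  @PMonoid (A * A)%type env_mul [:: (1, 1)] env_mulA env_mul1l env_mul1r
    env_units_neq0.

Definition env_pair (a b : A) : pmalg K env_pmonoid :=
  pmbase K ((a, b) : env_pmonoid).

Inductive env_rel : pmalg K env_pmonoid -> Prop :=
| env_addl a a' b : env_rel (env_pair (a + a') b - env_pair a b - env_pair a' b)
| env_addr a b b' : env_rel (env_pair a (b + b') - env_pair a b - env_pair a b')
| env_scalel c a b : env_rel (env_pair (c *: a) b - c *: env_pair a b)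
| env_scaler c a b : env_rel (env_pair a (c *: b) - c *: env_pair a b).

(* The action of A (x) A^op on A: (a (x) b) r = a r b. *)
Definition env_act (p : pmalg K env_pmonoid) (r : A) : A :=
  lext (fun x : A * A => x.1 * r * x.2) p.

Lemma env_act_linear r : linear (env_act^~ r).
Proof. exact: lext_is_linear. Qed.
Lemma env_act_pair a b r : env_act (env_pair a b) r = a * r * b.
Proof. exact: lextU. Qed.
Lemma env_act_linearr p : linear (env_act p).
Proof.
move=> c u v; rewrite /env_act /lext scaler_sumr -big_split.
apply: eq_bigr => x _ /=.
by rewrite mulrDr mulrDl scalerDr -scalerAr -scalerAl scalerA mulrC -scalerA.
Qed.

Lemma env_actM p q r : env_act (p * q) r = env_act p (env_act q r).
Proof.
have ll x : linear (env_act^~ x) := env_act_linear x.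
have lr := env_act_linearr.
move: p; apply: (@pmalg_eq _ _ _ (fun p => env_act (p * q) r)
  (fun p => env_act p (env_act q r))) => [c u v||x].
- by rewrite mulrDl -scalerAl ll.
- exact: ll.
move: q; apply: (@pmalg_eq _ _ _ (fun q => env_act (pmbase K x * q) r)
  (fun q => env_act (pmbase K x) (env_act q r))) => [c u v|c u v|y].
- by rewrite mulrDr -scalerAr ll.
- by rewrite ll lr.
rewrite pmbaseM /=; case: x y => [a b] [a' b'].
by rewrite !env_act_pair !mulrA.
Qed.

Lemma env_act1 r : env_act 1 r = r.
Proof. by rewrite pmalg_one big_seq1 env_act_pair mul1r mulr1. Qed.

Lemma env_act_rel s r : env_rel s -> env_act s r = 0.
Proof.
have ll := env_act_linear r.
case=> [a a' b|a b b'|c a b|c a b];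
  rewrite !(rawlinB ll) ?(rawlinZ ll) !env_act_pair.
- by rewrite !mulrDl -addrA -opprD subrr.
- by rewrite mulrDr -addrA -opprD subrr.
- by rewrite !scalerAl subrr.
- by rewrite -scalerAr subrr.
Qed.

Lemma env_act_ideal p r : two_sided_ideal env_rel p -> env_act p r = 0.
Proof.
elim=> [|a s b x Ss _ IH]; first exact: (rawlin0 (env_act_linear r)).
rewrite (rawlinD (env_act_linear r)) IH addr0 !env_actM (env_act_rel _ Ss).
exact: (rawlin0 (env_act_linearr a)).
Qed.

Lemma env_proper : ~ two_sided_ideal env_rel 1.
Proof. by move=> /(env_act_ideal 1)/eqP; rewrite env_act1 oner_eq0. Qed.

(* A (x)_K A^op *)
Definition enveloping : algType K := quotalg env_proper.

(* A as a left module over its enveloping algebra. *)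
Definition regular_bimodule : Type := A.
HB.instance Definition _ := GRing.Zmodule.on regular_bimodule.

Definition bimod_scale (x : enveloping) (r : regular_bimodule) :
  regular_bimodule := env_act (repr (x : lquot _)) r.

Lemma bimod_scaleE p r : bimod_scale (qpi env_proper p) r = env_act p r.
Proof.
apply/eqP; rewrite -subr_eq0 -(rawlinB (env_act_linear r)); apply/eqP.
exact/env_act_ideal/(repr_lpi (ideal_submodule env_rel)).
Qed.

Lemma bimod_scaleA x y r : bimod_scale x (bimod_scale y r) = bimod_scale (x * y) r.
Proof.
have [u ->] := qpi_surj x; have [v ->] := qpi_surj y.
by rewrite -qpiM !bimod_scaleE env_actM.
Qed.
Lemma bimod_scale1 : left_id 1 bimod_scale.
Proof. by move=> r; rewrite [LHS]bimod_scaleE env_act1. Qed.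
Lemma bimod_scaleDr : right_distributive bimod_scale +%R.
Proof.
move=> x r s; have [u ->] := qpi_surj x.
by rewrite !bimod_scaleE; apply: (rawlinD (env_act_linearr u)).
Qed.
Lemma bimod_scaleDl r : {morph bimod_scale^~ r : x y / x + y}.
Proof.
move=> x y; have [u ->] := qpi_surj x; have [v ->] := qpi_surj y.
by rewrite -qpiD !bimod_scaleE; apply: (rawlinD (env_act_linear r)).
Qed.
HB.instance Definition _ := GRing.Zmodule_isLmodule.Build enveloping
  regular_bimodule bimod_scaleA bimod_scale1 bimod_scaleDr bimod_scaleDl.

Lemma regular_bimodule_neq0 : exists r : regular_bimodule, r != 0.
Proof. by exists (1 : A); apply: oner_neq0. Qed.

(* Ext is computed with the standard free resolution; any other projective
   resolution gives the same graded algebra up to isomorphism. *)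
Definition HH : algType K :=
  ext_alg (free_resolution (regular_bimodule : lmodType enveloping))
    regular_bimodule_neq0.

Definition HH_degree (n : nat) (u : HH) : Prop := ext_degree n u.

End Enveloping.

Record quiver := Quiver {
  vertex : finType;
  arrow : choiceType;
  source : arrow -> vertex;
  target : arrow -> vertex;
  vertex_gt0 : (0 < #|vertex|)%N }.

Section Paths.
Variable Q : quiver.

(* Arrows are composed from right to left: a path from s to t is written
   a_n ... a_1 with source a_1 = s, source a_{i+1} = target a_i and
   target a_n = t, and is encoded as (t, [:: a_n; ...; a_1], s). *)
Fixpoint is_walk (t : vertex Q) (w : seq (arrow Q)) (s : vertex Q) : bool :=
  if w is a :: w' then (target a == t) && is_walk (source a) w' s else t == s.

Record qpath := QPath {
  path_data : vertex Q * seq (arrow Q) * vertex Q;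
  path_ok : is_walk path_data.1.1 path_data.1.2 path_data.2 }.
HB.instance Definition _ := [isSub for path_data].
HB.instance Definition _ := [Choice of qpath by <:].

Definition path_target (p : qpath) := (path_data p).1.1.
Definition path_word (p : qpath) := (path_data p).1.2.
Definition path_source (p : qpath) := (path_data p).2.

Lemma is_walk_cat t w m w' s :
  is_walk t w m -> is_walk m w' s -> is_walk t (w ++ w') s.
Proof.
elim: w t => [|a w IH] t /=; first by move/eqP->.
by case/andP=> -> /IH; apply.
Qed.

Definition path_cat_data (p q : qpath) :=
  (path_target p, path_word p ++ path_word q, path_source q).

Lemma path_cat_ok (p q : qpath) : path_source p == path_target q ->
  is_walk (path_cat_data p q).1.1 (path_cat_data p q).1.2 (path_cat_data p q).2.
Proof.
move=> /eqP e; apply: is_walk_cat (path_ok p) _.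
by move: (path_ok q); rewrite -/(path_target q) -e.
Qed.

Definition path_mul (p q : qpath) : option qpath :=
  if path_source p == path_target q then insub (path_cat_data p q) else None.

Lemma path_mulE (p q : qpath) (e : path_source p == path_target q) :
  path_mul p q = Some (QPath (path_cat_ok e)).
Proof. rewrite /path_mul e; apply: etrans (insubT _ _) _; first exact: path_cat_ok.
by move=> ok; congr Some; apply: val_inj. Qed.
Lemma path_mulN (p q : qpath) :
  path_source p != path_target q -> path_mul p q = None.
Proof. by rewrite /path_mul => /negbTE ->. Qed.

Lemma path_mulA p q r :
  obind (path_mul p) (path_mul q r) = obind (path_mul^~ r) (path_mul p q).
Proof.
have [eqr|nqr] := boolP (path_source q == path_target r);
  have [epq|npq] := boolP (path_source p == path_target q).
- rewrite (path_mulE eqr) (path_mulE epq) /=.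
  rewrite (path_mulE (q := QPath (path_cat_ok eqr)) epq).
  rewrite (path_mulE (p := QPath (path_cat_ok epq)) eqr).
  by congr Some; apply: val_inj; rewrite /= /path_cat_data /= /path_word /= catA.
- by rewrite (path_mulE eqr) (path_mulN npq) /= path_mulN.
- by rewrite (path_mulE epq) (path_mulN nqr) /= path_mulN.
- by rewrite (path_mulN npq) (path_mulN nqr).
Qed.

Definition trivial_path (i : vertex Q) : qpath := @QPath (i, [::], i) (eqxx i).

Lemma arrow_path_ok (a : arrow Q) : is_walk (target a) [:: a] (source a).
Proof. by rewrite /= !eqxx. Qed.
Definition arrow_path (a : arrow Q) : qpath :=
  @QPath (target a, [:: a], source a) (arrow_path_ok a).

Lemma path_mul_trivl i p :
  path_mul (trivial_path i) p = if i == path_target p then Some p else None.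
Proof.
have [e|ne] := boolP (i == path_target p); last exact: path_mulN.
rewrite (path_mulE (p := trivial_path i) e); congr Some; apply: val_inj.
rewrite /= /path_cat_data /path_target /path_word /path_source /= (eqP e).
by rewrite /path_target; case: (path_data p) => [[]].
Qed.
Lemma path_mul_trivr i p :
  path_mul p (trivial_path i) = if i == path_source p then Some p else None.
Proof.
rewrite eq_sym; have [e|ne] := boolP (path_source p == i); last exact: path_mulN.
rewrite (path_mulE (q := trivial_path i) e); congr Some; apply: val_inj.
rewrite /= /path_cat_data /path_target /path_word /path_source /= cats0 -(eqP e).
by rewrite /path_source; case: (path_data p) => [[]].
Qed.

Let pmap_one (T : eqType) (S : Type) (a : T) (x : S) (s : seq T) : uniq s ->
  pmap (fun i => if i == a then Some x else None) s =
  if a \in s then [:: x] else [::].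
Proof.
elim: s => //= b s IH /andP[bs /IH ->]; rewrite in_cons eq_sym.
by case: eqVneq => [->|_] //=; rewrite (negbTE bs).
Qed.

Definition trivial_paths := [seq trivial_path i | i <- enum (vertex Q)].

Lemma path_mul1l p : pmap (path_mul^~ p) trivial_paths = [:: p].
Proof.
have -> : pmap (path_mul^~ p) trivial_paths =
    pmap (fun i => if i == path_target p then Some p else None) (enum (vertex Q)).
  by rewrite /trivial_paths; elim: (enum _) => //= i s ->; rewrite path_mul_trivl.
by rewrite pmap_one ?enum_uniq // mem_enum.
Qed.
Lemma path_mul1r p : pmap (path_mul p) trivial_paths = [:: p].
Proof.
have -> : pmap (path_mul p) trivial_paths =
    pmap (fun i => if i == path_source p then Some p else None) (enum (vertex Q)).
  by rewrite /trivial_paths; elim: (enum _) => //= i s ->; rewrite path_mul_trivr.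
by rewrite pmap_one ?enum_uniq // mem_enum.
Qed.
Lemma trivial_paths_neq0 : trivial_paths <> [::].
Proof.
move=> /(congr1 size); rewrite size_map -cardE => e.
by have := vertex_gt0 Q; rewrite e.
Qed.

Definition paths : pmonoid := @PMonoid qpath path_mul trivial_paths
  path_mulA path_mul1l path_mul1r trivial_paths_neq0.

Variable K : comNzRingType.

Definition path_algebra : algType K := pmalg K paths.

Definition arrow_elt (a : arrow Q) : path_algebra :=
  pmbase K (arrow_path a : paths).

(* The algebra morphism to K which maps the trivial path at i to 1 and all the
   other paths to 0. *)
Definition path_char (i : vertex Q) (u : path_algebra) : K^o :=
  lext (fun p : paths => if p == trivial_path i then 1 else 0 : K^o) u.

Lemma path_char_is_linear i : linear (path_char i).
Proof. exact: lext_is_linear. Qed.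
HB.instance Definition _ i :=
  GRing.isLinear.Build K path_algebra K^o _ (path_char i) (path_char_is_linear i).

Lemma path_char_path i (p : paths) :
  path_char i (pmbase K p) = if p == trivial_path i then 1 else 0.
Proof. exact: lextU. Qed.

Lemma path_char_is_monoid_morphism i : monoid_morphism (path_char i).
Proof.
split.
  rewrite pmalg_one linear_sum /= big_map.
  under eq_bigr do rewrite path_char_path.
  rewrite big_enum /= (bigD1 i) //= eqxx big1 ?addr0 // => j ne.
  case: eqP => // /(congr1 path_target) /= e.
  by move/eqP: ne; case.
move=> u v; have lc := path_char_is_linear i.
move: u; apply: (@pmalg_eq _ _ _ (fun u => path_char i (u * v))
  (fun u => path_char i u * path_char i v)) => [c u w|c u w|p].
- by rewrite mulrDl -scalerAl lc.
- by rewrite lc mulrDl -scalerAl.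
move: v; apply: (@pmalg_eq _ _ _ (fun v => path_char i (pmbase K p * v))
  (fun v => path_char i (pmbase K p) * path_char i v)) => [c u w|c u w|q].
- by rewrite mulrDr -scalerAr lc.
- by rewrite lc mulrDr -scalerAr.
rewrite pmbaseM !path_char_path.
have [->|np] := eqVneq p (trivial_path i).
  rewrite mul1r /= path_mul_trivl; have [e|ne] := eqVneq i (path_target q).
    by rewrite /= path_char_path.
  rewrite /= linear0; case: eqP => // e.
  by rewrite e eqxx in ne.
rewrite mul0r /=; have [e|ne] := boolP (path_source p == path_target q); last first.
  by rewrite path_mulN //= linear0.
rewrite (path_mulE e) /= path_char_path; case: eqP => // /(congr1 val) /= [pt].
move=> pw qs; case/eqP: np; apply: val_inj => /=.
have {}pw : path_word p = [::] by case: (path_word p) pw.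
have es : path_source p = i.
  have := path_ok p; rewrite -/(path_target p) -/(path_word p) -/(path_source p).
  by rewrite pw pt /= => /eqP.
have -> : path_data p = (path_target p, path_word p, path_source p).
  by rewrite /path_target /path_word /path_source; case: (path_data p) => [[]].
by rewrite pt pw es.
Qed.
HB.instance Definition _ i := GRing.isMonoidMorphism.Build path_algebra K^o
  (path_char i) (path_char_is_monoid_morphism i).

Lemma path_char_arrow i a : path_char i (arrow_elt a) = 0.
Proof. by rewrite path_char_path; case: eqP => // /(congr1 path_word). Qed.

Lemma path_char_arrow2 i a b : path_char i (arrow_elt a * arrow_elt b) = 0.
Proof. by rewrite rmorphM /= path_char_arrow mul0r. Qed.

End Paths.

Section AlgebraAe.
Variables (K : comNzRingType) (e : nat).

(* Vertices and arrows are numbered from 0: the vertices 0, ..., e-1 stand for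
   1, ..., e, and inl i, inr i with i < e-1 stand for alpha(i+1), alpha^-(i+1).
   The value for e = 0 is irrelevant. *)
Definition Ae_source (a : 'I_e.-1 + 'I_e.-1) : 'I_e.-1.+1 :=
  match a with inl i => widen_ord (leqnSn _) i | inr i => lift ord0 i end.
Definition Ae_target (a : 'I_e.-1 + 'I_e.-1) : 'I_e.-1.+1 :=
  match a with inl i => lift ord0 i | inr i => widen_ord (leqnSn _) i end.
Lemma Ae_vertex_gt0 : (0 < #|'I_e.-1.+1|)%N.
Proof. by rewrite card_ord. Qed.
Definition Ae_quiver : quiver :=
  @Quiver 'I_e.-1.+1 ('I_e.-1 + 'I_e.-1)%type Ae_source Ae_target Ae_vertex_gt0.

Local Notation kQ := (path_algebra Ae_quiver K).
Definition alpha (i : 'I_e.-1) : kQ := arrow_elt K (inl i : arrow Ae_quiver).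
Definition alpham (i : 'I_e.-1) : kQ := arrow_elt K (inr i : arrow Ae_quiver).

Inductive Ae_rel : kQ -> Prop :=
| Ae_rel_alpha (i j : 'I_e.-1) : j = i.+1 :> nat ->
    Ae_rel (alpha j * alpha i)
| Ae_rel_alpham (i j : 'I_e.-1) : j = i.+1 :> nat ->
    Ae_rel (alpham i * alpham j)
| Ae_rel_comm (i j : 'I_e.-1) : j = i.+1 :> nat ->
    Ae_rel (alpha i * alpham i - alpham j * alpha j)
| Ae_rel_last (i : 'I_e.-1) : i.+1 = e.-1 ->
    Ae_rel (alpha i * alpham i).

Lemma Ae_proper : ~ two_sided_ideal Ae_rel 1.
Proof.
apply: (@proper_ideal _ _ _ _ (path_char (K := K) (ord0 : vertex Ae_quiver))).
move=> _ [i j _|i j _|i j _|i _].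
- exact: path_char_arrow2.
- exact: path_char_arrow2.
- by rewrite rmorphB [X in X - _]path_char_arrow2 [X in _ - X]path_char_arrow2 subrr.
- exact: path_char_arrow2.
Qed.

Definition Ae : algType K := quotalg Ae_proper.
End AlgebraAe.

Definition is_quantum_char (k : fieldType) (q : k) (e : nat) : Prop :=
  [/\ (0 < e)%N, \sum_(j < e) q ^+ j = 0
    & forall i, (0 < i)%N -> \sum_(j < i) q ^+ j = 0 -> (e <= i)%N].

From mathcomp Require Import mpoly.

Section Target.
Variables (k : fieldType) (e : nat).

Local Notation kzxy := (mpoly.mpoly (e.-1 + 2) k).

(* The variables z_1, ..., z_{e-1}, x, y, in this order. *)
Definition zvar (i : 'I_e.-1) : kzxy := 'X_(lshift 2 i).
Definition xvar : kzxy := 'X_(rshift e.-1 (ord0 : 'I_2)).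
Definition yvar : kzxy := 'X_(rshift e.-1 (ord_max : 'I_2)).

(* For e > 0, e.-1.+1 is e. *)
Inductive J_gen : kzxy -> Prop :=
| J_zz i j : J_gen (zvar i * zvar j)
| J_zx i : J_gen (zvar i * xvar)
| J_zy i : J_gen (zvar i * yvar)
| J_xx : J_gen (xvar ^+ 2)
| J_xy : J_gen (xvar * yvar ^+ e.-1)
| J_yy : J_gen (yvar ^+ e.-1.+1).

Lemma J_proper : ~ two_sided_ideal J_gen 1.
Proof.
apply: (@proper_ideal _ _ _ _ (meval (fun _ => 0 : k))).
by move=> _ [i j|i|i|||];
  rewrite ?rmorphXn ?rmorphM /= ?mevalXU ?mul0r // expr0n.
Qed.

Definition poly_mod_J : algType k := quotalg J_proper.

Definition var_degree (i : 'I_(e.-1 + 2)) : nat :=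
  match split i with inl _ => 0 | inr j => j.+1 end.

(* The degree of a monomial for deg z_i = 0, deg x = 1, deg y = 2. *)
Definition mon_degree (m : mpoly.multinom (e.-1 + 2)) : nat :=
  (\sum_i m i * var_degree i)%N.

Definition poly_mod_J_degree (n : nat) (u : poly_mod_J) : Prop :=
  exists p : kzxy,
    u = qpi J_proper p /\ forall m, m \in msupp p -> mon_degree m = n.
End Target.

(* Main.v *)
(* Write A for A_e. Its minimal projective bimodule resolution has in degree n
   the sum of the A eps_i (x) eps_j A over the pairs (i, j) for which the
   Clebsch-Gordan rule |i - j| <= n < i + j, n = i + j mod 2, holds (within
   1 <= i, j <= e), and its differential moves i or j by one, multiplying by the
   corresponding arrow on the left or on the right. It is exact because a right
   A-linear contraction of the "left" part of the differential is a contraction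
   of the whole up to an error raising the radical filtration of the left
   factor, which is nilpotent.

   A cocycle of degree n then is a family of elements of eps_i A eps_j subject
   to linear equations along the moves; modulo coboundaries it is determined by
   one scalar in each degree m < 2e - 1, and by e - 1 further scalars (the
   coefficients of the socle elements) in degree 0. The class y comes from the
   inclusion of the pairs of degree n into those of degree n + 2, x from a left
   move, and z_i from multiplication by the i-th socle element. All three lift
   to chain maps that shift the resolution, so their products can be read off.
   Finally Ext is the same algebra for any two projective resolutions. *)
Require Import Defs.
From HB Require Import structures.
From mathcomp Require Import all_boot all_order all_algebra.
From mathcomp Require Import zify.
From mathcomp Require Import boolp finmap monalg mpoly.
Set Implicit Arguments.
Unset Strict Implicit.
Unset Printing Implicit Defensive.
Import GRing.Theory.
Local Open Scope ring_scope.

(** The terms of the resolution are images of idempotents [om_proj n] on one free module [F], whose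
    basis is indexed by all pairs of naturals. Moves, contraction and chain maps are maps from [F]
    to itself, so no transport between modules of different degrees is needed. The rule for the
    pairs says that the simple sl_2-module of dimension n + 1 occurs in the tensor product of those
    of dimensions i and j. The ends of the quiver are delicate: at vertex 1 the relation between the
    two loops has only one side, and vertex e has no loop. In the first case the bounds on i + j and
    i - j exclude the pair where the relation would be used; in the second the offending arrow is 0.
    Left moves do not touch the second tensor factor, right moves multiply it by an arrow. As
    products of three arrows vanish, three corrections turn a contraction of the left moves into
    exactness. The equations of cocycles and coboundaries are difference equations along the
    diagonals, and primitives are partial sums. *)

Section IdealKernel.
Variables (K : comNzRingType) (A : algType K) (I : Type) (base : I -> A).
Hypothesis base_span : forall P : A -> Prop,
  (forall c u v, P u -> P v -> P (c *: u + v)) -> P 0 ->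
  (forall x, P (base x)) -> forall u, P u.

(** The quotients of the path algebra and of the algebra of formal tensors both receive their linear
    maps through this test. The condition is linear in each multiplier, so basis elements
    suffice. *)
Lemma linear_ideal_eq0 (S : A -> Prop) (V : lmodType K) (chi : A -> V) :
  linear chi -> (forall x y s, S s -> chi (base x * s * base y) = 0) ->
  forall z, two_sided_ideal S z -> chi z = 0.
Proof.
move=> lchi chiS z; elim=> [|a s b {}z Ss _ IH]; first exact: rawlin0.
rewrite (rawlinD lchi) IH addr0.
move: a; apply: base_span => [c u v IHu IHv||x].
- by rewrite !mulrDl -!scalerAl (rawlinD lchi) (rawlinZ lchi) IHu IHv scaler0 addr0.
- by rewrite !mul0r (rawlin0 lchi).
move: b; apply: base_span => [c u v IHu IHv||y].
- by rewrite !mulrDr -!scalerAr (rawlinD lchi) (rawlinZ lchi) IHu IHv scaler0 addr0.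
- by rewrite !mulr0 (rawlin0 lchi).
exact: chiS.
Qed.
End IdealKernel.

Lemma pmbase_span (K : comNzRingType) (G : pmonoid) (P : pmalg K G -> Prop) :
  (forall c u v, P u -> P v -> P (c *: u + v)) -> P 0 ->
  (forall x, P (pmbase K x)) -> forall u, P u.
Proof.
move=> PD P0 PB u; rewrite [u](malg_linE (E := K)).
elim: (enum_fset _) => [|x s IH]; first by rewrite big_nil.
by rewrite big_cons; apply: PD => //; apply: PB.
Qed.

(** * Zigzag algebras *)

Inductive zshape := Ver | Up | Down | Loop.

(* The sign in [up_down_eq], absent from A_e, is obtained by rescaling the
   arrows; with it the left moves of the resolution, and likewise the right
   ones, square to zero. Arrows and idempotents with indices out of range are 0. *)
Record zigzag (A : pzRingType) (e : nat) := Zigzag {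
  eps : nat -> A; up : nat -> A; down : nat -> A;
  epsM : forall i j, eps i * eps j = if i == j then eps i else 0;
  eps_out : forall i, ~~ (0 < i <= e)%N -> eps i = 0;
  sum_eps : \sum_(i < e.+1) eps i = 1;
  eps_up : forall i j, eps j * up i = if j == i.+1 then up i else 0;
  up_eps : forall i j, up i * eps j = if i == j then up i else 0;
  eps_down : forall i j, eps j * down i = if i == j then down i else 0;
  down_eps : forall i j, down i * eps j = if j == i.+1 then down i else 0;
  up_out : forall i, ~~ (0 < i < e)%N -> up i = 0;
  down_out : forall i, ~~ (0 < i < e)%N -> down i = 0;
  up_succ_up : forall i, up i.+1 * up i = 0;
  down_down_succ : forall i, down i * down i.+1 = 0;
  up_down_eq : forall i, (0 < i)%N -> up i * down i = - (down i.+1 * up i.+1) }.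

Section ZigzagTheory.
Variables (A : pzRingType) (e : nat) (Z : zigzag A e).
Local Notation eps := (eps Z).
Local Notation up := (up Z).
Local Notation down := (down Z).

Definition loop i := down i * up i.

Lemma up_up i j : up i * up j = 0.
Proof.
have <- : eps j.+1 * up j = up j by rewrite eps_up eqxx.
rewrite mulrA up_eps; case: eqP => [->|_]; last by rewrite mul0r.
exact: up_succ_up.
Qed.

Lemma down_down i j : down i * down j = 0.
Proof.
have <- : eps j * down j = down j by rewrite eps_down eqxx.
rewrite mulrA down_eps; case: eqP => [->|_]; last by rewrite mul0r.
exact: down_down_succ.
Qed.

Lemma down_up i j : down i * up j = if i == j then loop i else 0.
Proof.
have <- : eps j.+1 * up j = up j by rewrite eps_up eqxx.
rewrite mulrA down_eps eqSS eq_sym; case: eqP => [->|_] //; last by rewrite mul0r.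
Qed.

Lemma up_down i j : up i * down j = if (i == j) && (0 < i)%N then - loop i.+1 else 0.
Proof.
have <- : eps j * down j = down j by rewrite eps_down eqxx.
rewrite mulrA up_eps; case: eqP => [->|_] /=; last by rewrite mul0r.
case: ifP => [|/negbT j0]; first exact: up_down_eq.
by rewrite up_out ?mul0r ?(negbTE j0).
Qed.

Lemma loop_up i j : loop i * up j = 0.
Proof. by rewrite -mulrA up_up mulr0. Qed.

Lemma down_loop i j : down i * loop j = 0.
Proof. by rewrite mulrA down_down mul0r. Qed.

Lemma loop_down i j : loop i * down j = 0.
Proof.
rewrite -mulrA up_down; case: ifP => _; last by rewrite mulr0.
by rewrite mulrN down_loop oppr0.
Qed.

Lemma up_loop i j : up i * loop j = 0.
Proof.
rewrite mulrA up_down; case: ifP => _; last by rewrite mul0r.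
by rewrite mulNr loop_up oppr0.
Qed.

Lemma loop_loop i j : loop i * loop j = 0.
Proof. by rewrite {1}/loop -mulrA up_loop mulr0. Qed.

Lemma loop_out i : ~~ (0 < i < e)%N -> loop i = 0.
Proof. by move=> /up_out; rewrite /loop => ->; rewrite mulr0. Qed.

Lemma eps_loop i j : eps j * loop i = if i == j then loop i else 0.
Proof. by rewrite mulrA eps_down; case: ifP; rewrite ?mul0r. Qed.

Lemma loop_eps i j : loop i * eps j = if i == j then loop i else 0.
Proof. by rewrite -mulrA up_eps; case: ifP; rewrite ?mulr0. Qed.
End ZigzagTheory.

(** The functionals [zchi] form the dual basis, so that the spanning elements are independent. The
    index is always the source: the element of index i is fixed by [eps zz i] on the right, whence
    [down zz i.-1] for [Down]. *)
Record zigzag_basis (k : comNzRingType) (A : algType k) (e : nat) := ZigzagBasis {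
  zz :> zigzag A e;
  zchi : zshape -> nat -> A -> k;
  zchi_linear : forall s i, linear (zchi s i : A -> k^o);
  zchiE : forall a, a = \sum_(i < e.+1)
     (zchi Ver i a *: eps zz i + zchi Up i a *: up zz i + zchi Down i a *: down zz i.-1
      + zchi Loop i a *: loop zz i);
  zchi_eps : forall s i j, (0 < j <= e)%N ->
    zchi s i (eps zz j) = (if s is Ver then i == j else false)%:R;
  zchi_up : forall s i j, (0 < j < e)%N ->
    zchi s i (up zz j) = (if s is Up then i == j else false)%:R;
  zchi_down : forall s i j, (0 < j < e)%N ->
    zchi s i (down zz j) = (if s is Down then i == j.+1 else false)%:R;
  zchi_loop : forall s i j, (0 < j < e)%N ->
    zchi s i (loop zz j) = (if s is Loop then i == j else false)%:R }.

(** * The zigzag basis of the quiver algebra *)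

Section ZigzagOfQuiver.
Variables (k : fieldType) (e : nat).
Hypothesis e_gt1 : (1 < e)%N.
Local Notation Q := (Ae_quiver e).

(* Abstract stand-ins for the path algebra and its quotient, whose definitions
   must not be unfolded. *)
Variables (kQ A : algType k) (pelt : qpath Q -> kQ).
Variable pfun : (qpath Q -> k) -> kQ -> k^o.
Variables (rel : kQ -> Prop) (pi : {lrmorphism kQ -> A}).
Hypothesis peltM : forall p q, pelt p * pelt q = oapp pelt 0 (path_mul p q).
Hypothesis pelt1 : 1 = \sum_i pelt (trivial_path i).
Hypothesis pfun_linear : forall f, linear (pfun f).
Hypothesis pfun_pelt : forall f p, pfun f (pelt p) = f p.
Hypothesis pelt_span : forall P : kQ -> Prop,
  (forall c u v, P u -> P v -> P (c *: u + v)) -> P 0 ->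
  (forall x, P (pelt x)) -> forall u, P u.
Hypothesis pi_surj : forall a, exists u, a = pi u.
Hypothesis pi_ker : forall u, pi u = 0 <-> two_sided_ideal rel u.

Let arr (a : arrow Q) : kQ := pelt (arrow_path a).
Let ar (i : 'I_e.-1) := arr (inl i).
Let arm (i : 'I_e.-1) := arr (inr i).
Hypothesis relP : forall u, rel u <->
  [\/ exists i j : 'I_e.-1, j = i.+1 :> nat /\ u = ar j * ar i,
      exists i j : 'I_e.-1, j = i.+1 :> nat /\ u = arm i * arm j,
      exists i j : 'I_e.-1, j = i.+1 :> nat /\ u = ar i * arm i - arm j * ar j
    | exists i : 'I_e.-1, i.+1 = e.-1 /\ u = ar i * arm i].

(** On words of length two the value depends on the endpoints only, hence it agrees on the two sides
    of the commutation relation. The test [t == u] kills products of two arrows in the same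
    direction, [i < e] kills the loop at the last vertex, and the signs undo the scaling in
    [Adown]. *)
Definition pchi (s : zshape) (i : nat) (t : vertex Q) (w : seq (arrow Q)) (u : vertex Q) : k :=
  match s, w with
  | Ver, [::] => (i == u.+1)%:R
  | Up, [:: inl a] => (i == a.+1)%:R
  | Down, [:: inr a] => (-1) ^+ i.-1 * (i == a.+2)%:R
  | Loop, [:: _; _] => (-1) ^+ i * [&& t == u, i == u.+1 & (i < e)%N]%:R
  | _, _ => 0
  end.

Lemma path_trivial (x : qpath Q) : path_word x = [::] -> path_target x = path_source x.
Proof.
have := path_ok x; rewrite -/(path_target x) -/(path_word x) -/(path_source x).
by move=> + w; rewrite w => /eqP.
Qed.

Lemma pchi_long s i t w u : (2 < size w)%N -> pchi s i t w u = 0.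
Proof. by case: s w => [] [|[] ? [|? []]]. Qed.

Definition path_chi s i : kQ -> k^o :=
  pfun (fun p => pchi s i (path_target p) (path_word p) (path_source p)).

Lemma path_chi_linear s i : linear (path_chi s i).
Proof. exact: pfun_linear. Qed.

Lemma path_chi_pelt s i p : path_chi s i (pelt p) =
  pchi s i (path_target p) (path_word p) (path_source p).
Proof. exact: pfun_pelt. Qed.

(** Relations are combinations of paths of length two and [pchi] vanishes on longer words, so only
    trivial paths contribute as multipliers. *)
Lemma path_chi_square s i (x y : qpath Q) (a b : arrow Q) : source a = target b ->
  path_chi s i (pelt x * (arr a * arr b) * pelt y) =
  if [&& path_source x == target a, source b == path_target y, path_word x == [::]
       & path_word y == [::]] then
    pchi s i (target a) [:: a; b] (source b)
  else 0.
Proof.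
have l0 := rawlin0 (path_chi_linear s i).
move=> /eqP sab; rewrite peltM.
have e1 : path_source (arrow_path a) == path_target (arrow_path b) by [].
rewrite (path_mulE e1); set p := QPath _.
have pt : path_target p = target a by [].
have ps : path_source p = source b by [].
have pw : path_word p = [:: a; b] by [].
rewrite -pt -ps -pw; move: p pt ps pw => p _ _ pw /=.
rewrite peltM; have [sx|nsx] := boolP (path_source x == _); last first.
  by rewrite (path_mulN nsx) /= mul0r l0.
rewrite (path_mulE sx) /= peltM.
have [sp|nsp] := boolP (path_source p == path_target y); last first.
  have nsp' : path_source (QPath (path_cat_ok sx)) != path_target y by [].
  by rewrite (path_mulN nsp') l0.
have sp' : path_source (QPath (path_cat_ok sx)) == path_target y by [].
rewrite (path_mulE sp') [oapp _ _ _]/= path_chi_pelt.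
have -> : path_word (QPath (path_cat_ok sp')) = path_word x ++ path_word p ++ path_word y.
  by rewrite catA.
rewrite -[path_target _]/(path_target x) -[path_source _]/(path_source y) pw.
have [wx|nx] := eqVneq (path_word x) [::].
  have [wy|ny] := eqVneq (path_word y) [::].
    by rewrite wx wy /= (path_trivial wx) (eqP sx) (eqP sp) (path_trivial wy).
  by rewrite pchi_long // wx /=; case: (path_word y) ny.
rewrite pchi_long // !size_cat /=; case: (path_word x) nx => //= ? ? _.
by rewrite !addnS.
Qed.

Lemma path_chi_rel s i u : two_sided_ideal rel u -> path_chi s i u = 0.
Proof.
suff H x y w : rel w -> path_chi s i (pelt x * w * pelt y) = 0.
  exact: (linear_ideal_eq0 pelt_span (path_chi_linear s i) H).
move=> /relP[].
- case=> a [b [eab ->]].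
  have sab : source (inl b : arrow Q) = target (inl a : arrow Q) by apply: val_inj; rewrite /= eab.
  rewrite path_chi_square //; case: ifP => // _.
  case: s => //=; case: eqP => [|_]; last by rewrite mulr0.
  by move=> /(congr1 val) /= E; rewrite /bump eab /= add1n in E; lia.
- case=> a [b [eab ->]].
  have sab : source (inr a : arrow Q) = target (inr b : arrow Q) by apply: val_inj; rewrite /= eab.
  rewrite path_chi_square //; case: ifP => // _.
  case: s => //=; case: eqP => [|_]; last by rewrite mulr0.
  by move=> /(congr1 val) /= E; rewrite /bump eab /= !add1n in E; lia.
- case=> a [b [eab ->]].
  have sab : source (inl a : arrow Q) = target (inr a : arrow Q) by [].
  have sab' : source (inr b : arrow Q) = target (inl b : arrow Q) by [].
  have ee : target (inl a : arrow Q) = target (inr b : arrow Q).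
    by apply: val_inj; rewrite /= /bump eab.
  have ee' : source (inr a : arrow Q) = source (inl b : arrow Q).
    by apply: val_inj; rewrite /= /bump eab.
  rewrite mulrBr mulrBl (rawlinB (path_chi_linear s i)) !path_chi_square // ee ee'.
  by case: ifP => // _; rewrite ?subrr //; case: s => //=; rewrite subrr.
- case=> a [ea ->].
  have sab : source (inl a : arrow Q) = target (inr a : arrow Q) by [].
  rewrite path_chi_square //; case: ifP => // _.
  case: s => //=; case: ltnP => [ie|]; last by rewrite !andbF mulr0.
  case: (i =P _) => [ii|_]; last by rewrite andbF mulr0.
  by move: ie; rewrite ii /= /bump add1n ea; lia.
Qed.

Definition Achi s i (a : A) : k := path_chi s i (projT1 (cid (pi_surj a))).

Lemma Achi_pi s i u : Achi s i (pi u) = path_chi s i u.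
Proof.
rewrite /Achi; case: cid => v /= /eqP; rewrite -subr_eq0 -rmorphB => /eqP/pi_ker.
move=> /(path_chi_rel s i)/eqP.
by rewrite (rawlinB (path_chi_linear s i)) subr_eq0 => /eqP.
Qed.

Lemma Achi_linear s i : linear (Achi s i : A -> k^o).
Proof.
move=> c a b; have [u ->] := pi_surj a; have [v ->] := pi_surj b.
by rewrite -linearZ_LR -rmorphD !Achi_pi path_chi_linear.
Qed.

Definition Aeps (i : nat) : A :=
  if i is i'.+1 then
    oapp (fun v : 'I_e.-1.+1 => pi (pelt (trivial_path (v : vertex Q)))) 0 (insub i')
  else 0.
Definition Aup (i : nat) : A :=
  if i is i'.+1 then oapp (fun a => pi (ar a)) 0 (insub i') else 0.
Definition Adown (i : nat) : A :=
  if i is i'.+1 then oapp (fun a => (-1) ^+ i *: pi (arm a)) 0 (insub i') else 0.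

Let Ae_ (v : 'I_e.-1.+1) : Aeps v.+1 = pi (pelt (trivial_path (v : vertex Q))).
Proof. by rewrite /Aeps valK. Qed.
Let Au_ (a : 'I_e.-1) : Aup a.+1 = pi (ar a).
Proof. by rewrite /Aup valK. Qed.
Let Ad_ (a : 'I_e.-1) : Adown a.+1 = (-1) ^+ a.+1 *: pi (arm a).
Proof. by rewrite /Adown valK. Qed.

Lemma Aeps_out i : ~~ (0 < i <= e)%N -> Aeps i = 0.
Proof. by case: i => //= i ie; rewrite insubF //; lia. Qed.
Lemma Aup_out i : ~~ (0 < i < e)%N -> Aup i = 0.
Proof. by case: i => //= i ie; rewrite insubF //; lia. Qed.
Lemma Adown_out i : ~~ (0 < i < e)%N -> Adown i = 0.
Proof. by case: i => //= i ie; rewrite insubF //; lia. Qed.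

Variant Aeps_spec i : A -> Type :=
| Aeps_no of ~~ (0 < i <= e)%N : Aeps_spec i 0
| Aeps_yes (v : vertex Q) of i = (v : 'I__).+1 : Aeps_spec i (pi (pelt (trivial_path v))).
Lemma AepsP i : Aeps_spec i (Aeps i).
Proof.
have [ie|ie] := boolP (0 < i <= e)%N; last by rewrite Aeps_out //; constructor.
case: i ie => // i ie; have ie' : (i < e.-1.+1)%N by lia.
by rewrite (Ae_ (Ordinal ie')); constructor.
Qed.
Variant Aup_spec i : A -> Type :=
| Aup_no of ~~ (0 < i < e)%N : Aup_spec i 0
| Aup_yes (a : 'I_e.-1) of i = a.+1 : Aup_spec i (pi (ar a)).
Lemma AupP i : Aup_spec i (Aup i).
Proof.
have [ie|ie] := boolP (0 < i < e)%N; last by rewrite Aup_out //; constructor.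
case: i ie => // i ie; have ie' : (i < e.-1)%N by lia.
by rewrite (Au_ (Ordinal ie')); constructor.
Qed.
Variant Adown_spec i : A -> Type :=
| Adown_no of ~~ (0 < i < e)%N : Adown_spec i 0
| Adown_yes (a : 'I_e.-1) of i = a.+1 : Adown_spec i ((-1) ^+ i *: pi (arm a)).
Lemma AdownP i : Adown_spec i (Adown i).
Proof.
have [ie|ie] := boolP (0 < i < e)%N; last by rewrite Adown_out //; constructor.
case: i ie => // i ie; have ie' : (i < e.-1)%N by lia.
by rewrite (Ad_ (Ordinal ie')); constructor.
Qed.

Lemma trivM v p : pelt (trivial_path v) * pelt p = if v == path_target p then pelt p else 0.
Proof. by rewrite peltM path_mul_trivl; case: ifP. Qed.
Lemma Mtriv v p : pelt p * pelt (trivial_path v) = if v == path_source p then pelt p else 0.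
Proof. by rewrite peltM path_mul_trivr; case: ifP. Qed.

Let vtx (v : vertex Q) : nat := (v : 'I_e.-1.+1).
Let vtx_lt v : (vtx v < e)%N.
Proof. by have := ltn_ord (v : 'I_e.-1.+1); rewrite /vtx; lia. Qed.
Let vtx_eq v w : (v == w) = (vtx v == vtx w). Proof. exact: val_eqE. Qed.
Let if0 (b : bool) : (if b then 0 else 0) = 0 :> A. Proof. by case: b. Qed.
Let if_pi (b : bool) u : (if b then pi u else 0) = pi (if b then u else 0).
Proof. by case: b; rewrite ?raddf0. Qed.
Let if_Z (b : bool) c (u : A) : (if b then c *: u else 0) = c *: (if b then u else 0).
Proof. by case: b; rewrite ?scaler0. Qed.

Let vtl (a : 'I_e.-1) : vtx (path_target (arrow_path (inl a : arrow Q))) = a.+1.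
Proof. by rewrite /vtx /= /bump. Qed.
Let vsl (a : 'I_e.-1) : vtx (path_source (arrow_path (inl a : arrow Q))) = a.
Proof. by []. Qed.
Let vtr (a : 'I_e.-1) : vtx (path_target (arrow_path (inr a : arrow Q))) = a.
Proof. by []. Qed.
Let vsr (a : 'I_e.-1) : vtx (path_source (arrow_path (inr a : arrow Q))) = a.+1.
Proof. by rewrite /vtx /= /bump. Qed.

Lemma AepsM i j : Aeps i * Aeps j = if i == j then Aeps i else 0.
Proof.
case: AepsP => [_|v ->]; first by rewrite mul0r if0.
case: AepsP => [je|w ->].
  by rewrite mulr0; case: eqP je => // <-; have := vtx_lt v; rewrite /vtx; lia.
rewrite -(rmorphM pi) trivM eqSS if_pi -/(vtx v) -/(vtx w) -vtx_eq.
by case: eqP => // ->.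
Qed.

Lemma sum_Aeps : \sum_(i < e.+1) Aeps i = 1.
Proof.
rewrite big_ord_recl /= add0r -(rmorph1 pi) pelt1 raddf_sum.
have e1 : e = e.-1.+1 by lia.
transitivity (\sum_(i < e.-1.+1) Aeps i.+1); last by apply: eq_bigr => v _; rewrite Ae_.
by rewrite -!(big_mkord xpredT (fun i => Aeps i.+1)) -e1.
Qed.

Lemma Aeps_up i j : Aeps j * Aup i = if j == i.+1 then Aup i else 0.
Proof.
case: AupP => [_|a ->]; first by rewrite mulr0 if0.
case: AepsP => [je|w ->].
  by rewrite mul0r; case: eqP je => // ->; have := ltn_ord a; lia.
rewrite -(rmorphM pi) trivM eqSS if_pi vtx_eq -/(vtx w).
by rewrite vtl.
Qed.

Lemma Aup_eps i j : Aup i * Aeps j = if i == j then Aup i else 0.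
Proof.
case: AupP => [_|a ->]; first by rewrite mul0r if0.
case: AepsP => [je|w ->].
  by rewrite mulr0; case: eqP je => // <-; have := ltn_ord a; lia.
rewrite -(rmorphM pi) Mtriv eqSS if_pi vtx_eq -/(vtx w) eq_sym.
by rewrite vsl.
Qed.

Lemma Aeps_down i j : Aeps j * Adown i = if i == j then Adown i else 0.
Proof.
case: AdownP => [_|a ->]; first by rewrite mulr0 if0.
case: AepsP => [je|w ->].
  by rewrite mul0r; case: eqP je => // <-; have := ltn_ord a; lia.
rewrite if_Z -scalerAr -(rmorphM pi) trivM eqSS if_pi vtx_eq -/(vtx w) eq_sym.
by rewrite vtr.
Qed.

Lemma Adown_eps i j : Adown i * Aeps j = if j == i.+1 then Adown i else 0.
Proof.
case: AdownP => [_|a ->]; first by rewrite mul0r if0.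
case: AepsP => [je|w ->].
  by rewrite mulr0; case: eqP je => // ->; have := ltn_ord a; lia.
rewrite if_Z -scalerAl -(rmorphM pi) Mtriv eqSS if_pi vtx_eq -/(vtx w).
by rewrite vsr.
Qed.

Let pi_rel u : rel u -> pi u = 0. Proof. by move=> ru; apply/pi_ker/ideal_gen. Qed.

Lemma Aup_up i : Aup i.+1 * Aup i = 0.
Proof.
case: AupP => [_|b [eb]]; first by rewrite mul0r.
case: AupP => [_|a ea]; first by rewrite mulr0.
by rewrite -(rmorphM pi); apply/pi_rel/relP/Or41; exists a, b; rewrite -eb ea.
Qed.

Lemma Adown_down i : Adown i * Adown i.+1 = 0.
Proof.
case: AdownP => [_|a ea]; first by rewrite mul0r.
case: AdownP => [_|b [eb]]; first by rewrite mulr0.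
rewrite -scalerAl -scalerAr -(rmorphM pi) /= pi_rel ?scaler0 //.
by apply/relP/Or42; exists a, b; rewrite -eb ea.
Qed.

Lemma Aup_down i : (0 < i)%N -> Aup i * Adown i = - (Adown i.+1 * Aup i.+1).
Proof.
move=> i0; case: AupP => [ie|a ea].
  by rewrite (@Adown_out i.+1) ?mul0r ?oppr0 //; lia.
case: AdownP => [ie|a' ea']; first by have := ltn_ord a; lia.
have -> : a' = a by apply: ord_inj; lia.
case: AdownP => [ie|b [eb]].
  rewrite mul0r oppr0 -scalerAr -(rmorphM pi) /= pi_rel ?scaler0 //.
  by apply/relP/Or44; exists a; split=> //; have := ltn_ord a; lia.
case: AupP => [ie|b' [eb']]; first by have := ltn_ord b; lia.
have -> : b' = b by apply: ord_inj; lia.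
rewrite -scalerAr -scalerAl -!(rmorphM pi) /= exprS mulN1r scaleNr opprK.
have -> : pi (ar a * arm a) = pi (arm b * ar b); last by [].
apply/eqP; rewrite -subr_eq0 -(rmorphB pi) /= pi_rel //.
by apply/relP/Or43; exists a, b; rewrite -eb ea.
Qed.

Lemma Achi_eps s i j : (0 < j <= e)%N ->
  Achi s i (Aeps j) = (if s is Ver then i == j else false)%:R.
Proof.
case: AepsP => [/negP//|v ej] _; rewrite Achi_pi path_chi_pelt.
by case: s => //=; rewrite ej.
Qed.

Lemma Achi_up s i j : (0 < j < e)%N ->
  Achi s i (Aup j) = (if s is Up then i == j else false)%:R.
Proof.
case: AupP => [/negP//|v ej] _; rewrite Achi_pi path_chi_pelt.
by case: s => //=; rewrite ej.
Qed.

Lemma Achi_down s i j : (0 < j < e)%N ->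
  Achi s i (Adown j) = (if s is Down then i == j.+1 else false)%:R.
Proof.
case: AdownP => [/negP//|v ej] _.
rewrite (rawlinZ (Achi_linear s i)) Achi_pi path_chi_pelt.
case: s => //=; rewrite ?scaler0 // ej.
case: eqP => [->|_]; last by rewrite mulr0 scaler0.
rewrite mulr1 -[LHS]/((-1) ^+ v.+1 * (-1) ^+ v.+1).
by rewrite -exprD addnn -mul2n exprM sqrrN !expr1n.
Qed.

Lemma Achi_loop s i j : (0 < j < e)%N ->
  Achi s i (Adown j * Aup j) = (if s is Loop then i == j else false)%:R.
Proof.
move=> je; case: AupP => [/negP//|a ej]; case: AdownP => [/negP//|b ej'].
have -> : b = a by apply: ord_inj; lia.
rewrite -scalerAl -(rmorphM pi) /= (rawlinZ (Achi_linear s i)) Achi_pi.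
have sab : source (inr a : arrow Q) = target (inl a : arrow Q) by [].
set x := trivial_path (source (inl a : arrow Q)).
have e1 : arm a * ar a = pelt x * (arm a * ar a) * pelt x.
  rewrite mulrA trivM ifT; last by apply/eqP/val_inj.
  by rewrite -mulrA Mtriv ifT.
rewrite e1 path_chi_square // ifT; last first.
  by rewrite /= !andbT; apply/andP; split; apply/eqP/val_inj.
case: s => //=; rewrite ?scaler0 // ej.
set b' := [&& _, _ & _]; have -> : b' = (i == a.+1).
  apply/and3P/eqP => [[_ /eqP -> _] //|->]; split=> //.
  by have := ltn_ord a; lia.
case: eqP => [ij|_]; last by rewrite mulr0 scaler0.
rewrite mulr1 ?ij -[LHS]/((-1) ^+ a.+1 * (-1) ^+ a.+1).
by rewrite -exprD addnn -mul2n exprM sqrrN !expr1n.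
Qed.

Lemma Aup_arr (a : 'I_e.-1) : pi (arr (inl a)) = Aup a.+1.
Proof. by rewrite Au_. Qed.

Lemma Adown_arr (a : 'I_e.-1) : pi (arr (inr a)) = (-1) ^+ a.+1 *: Adown a.+1.
Proof. by rewrite Ad_ scalerA -exprD addnn -mul2n exprM sqrrN !expr1n scale1r. Qed.

Lemma path_nil (t u : vertex Q) (ok : is_walk t [::] u) :
  @QPath Q (t, [::], u) ok = trivial_path u.
Proof. by apply: val_inj; move/eqP: (ok) => /= ->. Qed.

Lemma path_elt_cons t a w u (ok : is_walk t (a :: w) u) :
  exists ok' : is_walk (source a) w u,
    pelt (@QPath Q (t, a :: w, u) ok) = arr a * pelt (@QPath Q (source a, w, u) ok').
Proof.
case/andP: (ok) => /eqP ta ok'; exists ok'; rewrite peltM.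
have e1 : path_source (arrow_path a) == path_target (@QPath Q (source a, w, u) ok').
  by [].
by rewrite (path_mulE e1) /=; congr pelt; apply: val_inj; rewrite /= -ta.
Qed.

Definition quiver_zigzag : zigzag A e :=
  Zigzag AepsM Aeps_out sum_Aeps Aeps_up Aup_eps Aeps_down Adown_eps Aup_out Adown_out
    Aup_up Adown_down Aup_down.
Local Notation Z := quiver_zigzag.

Definition Acombo (a : A) := \sum_(i < e.+1)
     (Achi Ver i a *: Aeps i + Achi Up i a *: Aup i + Achi Down i a *: Adown i.-1
      + Achi Loop i a *: loop Z i).

Lemma Acombo_linear : linear Acombo.
Proof.
have scl s i (v : A) : linear (fun a => Achi s i a *: v).
  by move=> c a b; rewrite (Achi_linear s i) scalerDl -scalerA.
by apply: linear_sumf => i; do 3?apply: linear_add; apply: scl.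
Qed.

Let sum_delta (F : nat -> A) j : (j < e.+1)%N ->
  \sum_(i < e.+1) ((i : nat) == j)%:R *: F i = F j.
Proof.
move=> je; rewrite (bigD1 (Ordinal je)) //= eqxx scale1r big1 ?addr0 // => i ne.
by rewrite -[_ == _]/(i == Ordinal je) (negbTE ne) scale0r.
Qed.
Let combo0 : Acombo 0 = 0. Proof. exact: (rawlin0 Acombo_linear). Qed.

Lemma Acombo_eps j : Acombo (Aeps j) = Aeps j.
Proof.
have [je|/Aeps_out ->//] := boolP (0 < j <= e)%N.
rewrite -[RHS](@sum_delta Aeps j); last by lia.
by apply: eq_bigr => i _; rewrite !Achi_eps //= !scale0r !addr0.
Qed.
Lemma Acombo_up j : Acombo (Aup j) = Aup j.
Proof.
have [je|/Aup_out ->//] := boolP (0 < j < e)%N.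
rewrite -[RHS](@sum_delta Aup j); last by lia.
by apply: eq_bigr => i _; rewrite !Achi_up //= !scale0r !addr0 add0r.
Qed.
Lemma Acombo_down j : Acombo (Adown j) = Adown j.
Proof.
have [je|/Adown_out ->//] := boolP (0 < j < e)%N.
rewrite -[RHS](@sum_delta (fun i => Adown i.-1) j.+1); last by lia.
by apply: eq_bigr => i _; rewrite !Achi_down //= !scale0r !addr0 !add0r.
Qed.
Lemma Acombo_loop j : Acombo (loop Z j) = loop Z j.
Proof.
have [je|/(loop_out Z) ->//] := boolP (0 < j < e)%N.
rewrite -[RHS](@sum_delta (loop Z) j); last by lia.
by apply: eq_bigr => i _; rewrite !Achi_loop //= !scale0r !addr0 !add0r.
Qed.

(** [Acombo] is linear and fixes idempotents, arrows and loops. It remains to treat paths by length: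
    up to length two their images are scalar multiples of such elements or zero, and any product of
    three arrows vanishes. *)
Lemma AchiE a : a = Acombo a.
Proof.
have CZ c u : u = Acombo u -> c *: u = Acombo (c *: u).
  by move=> Cu; rewrite (rawlinZ Acombo_linear) -Cu.
have Cif (b : bool) u : u = Acombo u -> (if b then u else 0) = Acombo (if b then u else 0).
  by case: b => //; rewrite combo0.
have [u ->] := pi_surj a; move: u; apply: pelt_span => [c u v IHu IHv||p].
- by rewrite linearP /= Acombo_linear -IHu -IHv.
- by rewrite rmorph0 combo0.
have arrP (b : arrow Q) : (exists j, pi (arr b) = up Z j) \/
    (exists c j, pi (arr b) = c *: down Z j).
  by case: b => b; [left|right]; [exists b.+1 | exists ((-1) ^+ b.+1), b.+1];
    rewrite ?Aup_arr ?Adown_arr.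
have triv v : pi (pelt (trivial_path v)) = eps Z (vtx v).+1 by rewrite [RHS]Ae_.
case: p => [[[t [|x [|y [|z w]]]] v] ok].
- by rewrite (path_nil ok) triv Acombo_eps.
- have [ok1 ->] := path_elt_cons ok; rewrite (rmorphM pi) /=.
  rewrite (path_nil ok1).
  rewrite triv; have [[i ->]|[c [i ->]]] := arrP x.
    by rewrite up_eps; apply/Cif/esym/Acombo_up.
  by rewrite -scalerAl down_eps; apply/CZ/Cif/esym/Acombo_down.
- have [ok1 ->] := path_elt_cons ok; have [ok2 ->] := path_elt_cons ok1.
  rewrite !(rmorphM pi) /=.
  rewrite (path_nil ok2).
  rewrite triv mulrA.
  have [[i ->]|[c [i ->]]] := arrP x; have [[j ->]|[d [j ->]]] := arrP y.
  + by rewrite up_up mul0r combo0.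
  + rewrite -scalerAr -scalerAl up_down; apply/CZ.
    case: ifP => _; last by rewrite mul0r combo0.
    by rewrite mulNr -scaleN1r loop_eps; apply/CZ/Cif/esym/Acombo_loop.
  + rewrite -!scalerAl down_up; apply/CZ.
    case: ifP => _; last by rewrite mul0r combo0.
    by rewrite loop_eps; apply/Cif/esym/Acombo_loop.
  + by rewrite -scalerAl -scalerAr down_down !scaler0 mul0r combo0.
- have [ok1 ->] := path_elt_cons ok; have [ok2 ->] := path_elt_cons ok1.
  have [ok3 ->] := path_elt_cons ok2.
  rewrite !(rmorphM pi) /=; move: (pi (pelt _)) => r; rewrite !mulrA.
  suff -> : pi (arr x) * pi (arr y) * pi (arr z) = 0 by rewrite mul0r combo0.
  have [[i ->]|[c [i ->]]] := arrP x; have [[j ->]|[d [j ->]]] := arrP y;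
    have [[l ->]|[f [l ->]]] := arrP z;
    rewrite -?(scalerAl, scalerAr) ?(up_up, down_down) ?mul0r ?scaler0 //
      ?up_down ?down_up; case: ifP => _;
    by rewrite ?mul0r ?scaler0 ?mulNr ?(loop_up, loop_down) ?oppr0 ?scaler0 ?mul0r.
Qed.

Definition quiver_zigzag_basis : zigzag_basis A e :=
  @ZigzagBasis k A e Z Achi Achi_linear AchiE Achi_eps Achi_up Achi_down Achi_loop.
End ZigzagOfQuiver.

Section AeZigzag.
Variables (k : fieldType) (e : nat).
Hypothesis e_gt1 : (1 < e)%N.
Local Notation Q := (Ae_quiver e).

Definition path_elt (p : qpath Q) : path_algebra Q k := pmbase k (p : paths Q).

Definition path_fun (f : qpath Q -> k) (u : path_algebra Q k) : k^o :=
  lext (fun p : paths Q => f p : k^o) u.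

Definition Ae_zigzag : zigzag_basis (Ae k e) e.
Proof.
apply: (@quiver_zigzag_basis k e e_gt1 (path_algebra Q k) (Ae k e) path_elt path_fun
  (@Ae_rel k e) (qpi (@Ae_proper k e))).
- by move=> p q; apply: pmbaseM.
- by rewrite [LHS](@pmalg_one k (paths Q)) big_map big_enum.
- by move=> f; apply: lext_is_linear.
- by move=> f p; apply: lextU.
- exact: pmbase_span.
- exact: qpi_surj.
- by move=> u; apply: lpi_eq0.
- move=> u; split=> [[i j ij|i j ij|i j ij|i ie]|].
  + by apply: Or41; exists i, j.
  + by apply: Or42; exists i, j.
  + by apply: Or43; exists i, j.
  + by apply: Or44; exists i.
  by case=> [[i [j [ij ->]]]|[i [j [ij ->]]]|[i [j [ij ->]]]|[i [ie ->]]];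
    [apply: Ae_rel_alpha | apply: Ae_rel_alpham | apply: Ae_rel_comm | apply: Ae_rel_last].
Defined.
End AeZigzag.

(** * The enveloping algebra *)

(* An algebra [E] with the universal properties of A (x) A^op that are used
   below, and an E-module [M] isomorphic to the A-bimodule A; [tker chi] is the
   map [a (x) b |-> chi a b]. *)
Record tensor_env (K : comNzRingType) (A : algType K) := TensorEnv {
  tenv : algType K;
  tns : A -> A -> tenv;
  tnsM : forall a b a' b', tns a b * tns a' b' = tns (a * a') (b' * b);
  tns1 : tns 1 1 = 1;
  tns_linearl : forall b, linear (tns^~ b);
  tns_linearr : forall a, linear (tns a);
  tns_span : forall P : tenv -> Prop,
    (forall c u v, P u -> P v -> P (c *: u + v)) -> P 0 ->
    (forall a b, P (tns a b)) -> forall u, P u;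
  tker : (A -> K) -> tenv -> A;
  tker_linear : forall chi, linear (chi : A -> K^o) -> linear (tker chi);
  tkerE : forall chi a b, linear (chi : A -> K^o) -> tker chi (tns a b) = chi a *: b;
  tmod : lmodType tenv;
  tmu : A -> tmod;
  tnu : tmod -> A;
  tmuK : cancel tmu tnu;
  tnuK : cancel tnu tmu;
  tmuD : forall a b, tmu (a + b) = tmu a + tmu b;
  tns_mu : forall a b r, tns a b *: tmu r = tmu (a * r * b) }.

Section EnvOfQuotient.
Variables (K : comNzRingType) (A F E : algType K) (tp : A -> A -> F).
Variables (kf : (A -> K) -> F -> A) (rel : F -> Prop) (pi : {lrmorphism F -> E}).
Hypothesis tpM : forall a b c d, tp a b * tp c d = tp (a * c) (d * b).
Hypothesis tp1 : tp 1 1 = 1.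
Hypothesis tp_span : forall P : F -> Prop,
  (forall c u v, P u -> P v -> P (c *: u + v)) -> P 0 ->
  (forall x : A * A, P (tp x.1 x.2)) -> forall u, P u.
Hypothesis kf_linear : forall chi, linear (kf chi).
Hypothesis kf_tp : forall chi a b, kf chi (tp a b) = chi a *: b.
Hypothesis pi_surj : forall x, exists u, x = pi u.
Hypothesis pi_ker : forall u, pi u = 0 <-> two_sided_ideal rel u.
Hypothesis relP : forall u, rel u <->
  [\/ exists a a' b, u = tp (a + a') b - tp a b - tp a' b,
      exists a b b', u = tp a (b + b') - tp a b - tp a b',
      exists c a b, u = tp (c *: a) b - c *: tp a b
    | exists c a b, u = tp a (c *: b) - c *: tp a b].

Definition qtns a b := pi (tp a b).

Lemma qtnsM a b a' b' : qtns a b * qtns a' b' = qtns (a * a') (b' * b).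
Proof. by rewrite -rmorphM tpM. Qed.

Lemma qtns1 : qtns 1 1 = 1. Proof. by rewrite /qtns tp1 rmorph1. Qed.

Let pi_rel u : rel u -> pi u = 0. Proof. by move=> ru; apply/pi_ker/ideal_gen. Qed.

Lemma qtns_linearl b : linear (qtns^~ b).
Proof.
move=> c a a'; have := pi_rel (proj2 (relP _) (Or41 _ _ _
  (ex_intro _ (c *: a) (ex_intro _ a' (ex_intro _ b erefl))))).
have := pi_rel (proj2 (relP _) (Or43 _ _ _
  (ex_intro _ c (ex_intro _ a (ex_intro _ b erefl))))).
rewrite !raddfB /= linearZ /= => /eqP; rewrite subr_eq0 => /eqP <- /eqP.
by rewrite -addrA -opprD subr_eq0 => /eqP.
Qed.

Lemma qtns_linearr a : linear (qtns a).
Proof.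
move=> c b b'; have := pi_rel (proj2 (relP _) (Or42 _ _ _
  (ex_intro _ a (ex_intro _ (c *: b) (ex_intro _ b' erefl))))).
have := pi_rel (proj2 (relP _) (Or44 _ _ _
  (ex_intro _ c (ex_intro _ a (ex_intro _ b erefl))))).
rewrite !raddfB /= linearZ /= => /eqP; rewrite subr_eq0 => /eqP <- /eqP.
by rewrite -addrA -opprD subr_eq0 => /eqP.
Qed.

Lemma qtns_span (P : E -> Prop) :
  (forall c u v, P u -> P v -> P (c *: u + v)) -> P 0 ->
  (forall a b, P (qtns a b)) -> forall u, P u.
Proof.
move=> PD P0 PT x; have [u ->] := pi_surj x; move: u; apply: tp_span.
- by move=> c u v Pu Pv; rewrite linearP; apply: PD.
- by rewrite raddf0.
- by move=> [a b]; apply: PT.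
Qed.

Definition qker chi (x : E) : A := kf chi (projT1 (cid (pi_surj x))).

(** Linearity of [chi] makes [chi] (x) id compatible with the bilinearity relations. Applied to a
    dual basis, this map reads off the second factor that accompanies a given basis element in the
    first. *)
Lemma qker_pi chi u : linear (chi : A -> K^o) -> qker chi (pi u) = kf chi u.
Proof.
move=> lchi; have lk := kf_linear chi.
rewrite /qker; case: cid => v /= /eqP; rewrite -subr_eq0 -raddfB => /eqP/pi_ker.
suff H : forall x y w, rel w -> kf chi (tp x.1 x.2 * w * tp y.1 y.2) = 0.
  by move=> /(linear_ideal_eq0 tp_span lk H)/eqP; rewrite (rawlinB lk) subr_eq0 => /eqP.
move=> [a b] [c d] w /= /relP[[x [x' [y ->]]]|[x [y [y' ->]]]|[r [x [y ->]]]|[r [x [y ->]]]];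
  rewrite !mulrBr !mulrBl -?scalerAr -?scalerAl !tpM !(rawlinB lk) ?(rawlinZ lk) !kf_tp.
- rewrite mulrDr mulrDl (rawlinD lchi) scalerDl.
  by rewrite -addrA -opprD subrr.
- by rewrite mulrDl mulrDr scalerDr -addrA -opprD subrr.
- by rewrite -scalerAr -scalerAl (rawlinZ lchi) scalerA subrr.
- by rewrite -scalerAl -scalerAr !scalerA mulrC subrr.
Qed.

Lemma qker_linear chi : linear (chi : A -> K^o) -> linear (qker chi).
Proof.
move=> lchi c x y; have [u ->] := pi_surj x; have [v ->] := pi_surj y.
by rewrite -linearP !qker_pi // kf_linear.
Qed.

Lemma qkerE chi a b : linear (chi : A -> K^o) -> qker chi (qtns a b) = chi a *: b.
Proof. by move=> lchi; rewrite qker_pi // kf_tp. Qed.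

End EnvOfQuotient.

Section EnvelopingTensor.
Variables (K : comNzRingType) (A : algType K).
Local Notation E := (enveloping A).
Local Notation F := (pmalg K (env_pmonoid A)).

Definition env_ker (chi : A -> K) (u : F) : A :=
  lext (fun x : A * A => chi x.1 *: x.2) u.

Let tp : A -> A -> F := @env_pair K A.
Let tpM (a b c d : A) : env_pair a b * env_pair c d = env_pair (a * c) (d * b).
Proof. exact: pmbaseM. Qed.
Let tp1 : env_pair (1 : A) 1 = 1.
Proof. by rewrite [RHS](@pmalg_one K (env_pmonoid A)) big_seq1. Qed.
Let kf_linear chi : linear (env_ker chi). Proof. exact: lext_is_linear. Qed.
Let kf_tp chi a b : env_ker chi (env_pair a b) = chi a *: b. Proof. exact: lextU. Qed.
Let pi : {lrmorphism F -> E} := qpi (@env_proper K A).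
Let pi_surj x : exists u, x = pi u. Proof. exact: qpi_surj. Qed.
Let pi_ker u : pi u = 0 <-> two_sided_ideal (@env_rel K A) u.
Proof. exact: lpi_eq0. Qed.
Let tp_span (P : F -> Prop) :
  (forall c u v, P u -> P v -> P (c *: u + v)) -> P 0 ->
  (forall x : A * A, P (env_pair x.1 x.2)) -> forall u, P u.
Proof. by move=> PD P0 PT; apply: pmbase_span => // -[a b]; apply: (PT (a, b)). Qed.
Let relP u : @env_rel K A u <->
  [\/ exists a a' b, u = env_pair (a + a') b - env_pair a b - env_pair a' b,
      exists a b b', u = env_pair a (b + b') - env_pair a b - env_pair a b',
      exists c a b, u = env_pair (c *: a) b - c *: env_pair a b
    | exists c a b, u = env_pair a (c *: b) - c *: env_pair a b].
Proof.
split=> [[a a' b|a b b'|c a b|c a b]|].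
- by apply: Or41; exists a, a', b.
- by apply: Or42; exists a, b, b'.
- by apply: Or43; exists c, a, b.
- by apply: Or44; exists c, a, b.
case=> [[a [a' [b ->]]]|[a [b [b' ->]]]|[c [a [b ->]]]|[c [a [b ->]]]].
- exact: env_addl.
- exact: env_addr.
- exact: env_scalel.
- exact: env_scaler.
Qed.

Lemma bimod_act (a b r : A) :
  (qpi (@env_proper K A) (env_pair a b) *: (r : regular_bimodule A) : regular_bimodule A)
  = a * r * b.
Proof. by rewrite [LHS]bimod_scaleE env_act_pair. Qed.

Definition enveloping_env : tensor_env A :=
  @TensorEnv K A E (qtns tp pi) (qtnsM pi tpM) (qtns1 pi tp1)
    (qtns_linearl pi_ker relP) (qtns_linearr pi_ker relP)
    (qtns_span tp_span pi_surj) (qker env_ker pi_surj)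
    (qker_linear tpM tp_span kf_linear kf_tp pi_surj pi_ker relP)
    (qkerE tpM tp_span kf_linear kf_tp pi_surj pi_ker relP)
    (regular_bimodule A) id id (fun=> erefl) (fun=> erefl) (fun _ _ => erefl) bimod_act.
End EnvelopingTensor.

(** * Independence of the resolution *)

Section ChainMaps.
Variables (K : comNzRingType) (E : algType K) (M : lmodType E).

Record chain_map (P P' : projective_resolution M) := ChainMap {
  cm :> forall n, P n -> P' n;
  cm_linear : forall n, linear (@cm n);
  cm_aug : forall x, res_aug P' (@cm 0%N x) = res_aug P x;
  cm_d : forall n x, res_d P' n (@cm n.+1 x) = @cm n (res_d P n x) }.

Lemma chain_map_exists (P P' : projective_resolution M) :
  exists _ : chain_map P P', True.
Proof.
(* The invariant of the dependent choice: [f] sends boundaries to cycles, which is what the next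
   lift requires. *)
pose good n (f : P n -> P' n) := linear f /\
  forall x, dfull P' n (f (res_d P n x)) = 0.
have [g0 g0P] := @res_projective _ _ P 0%N _ _ (res_aug P') (res_aug P)
  (@res_aug_surj _ _ P').
have gg0 : good 0%N g0.
  split=> [|x]; first exact: linear_bundled.
  by rewrite /= g0P; apply: (@dfull_d _ _ M P 0%N).
pose R n (s : {f | @good n f}) (s' : {f | @good n.+1 f}) :=
  forall x, res_d P' n (sval s' x) = sval s (res_d P n x).
have [|t [t0 tR]] := @dep_choice _ R (exist _ _ gg0).
  move=> n [f [fl fP]].
  have [||||g [gl gP]] := @projective_lift _ (P n.+1) _ _ _ (res_d P' n) (dfull P' n)
    (fun x => f (res_d P n x)) (@res_projective _ _ P n.+1).
  - by apply: linear_comp fl _; apply: linear_bundled.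
  - by move=> v /dfull_exact.
  - exact: dfull_d.
  - exact: fP.
  suff gg : good n.+1 g by exists (exist _ _ gg) => x; apply: gP.
  by split=> // x; rewrite /= gP dd (rawlin0 fl).
unshelve eexists; last by [].
exists (fun n => sval (t n)) => [n|x|n x]; last exact: tR.
  by case: (svalP (t n)).
by rewrite t0 g0P.
Qed.

Lemma null_homotopic (P P' : projective_resolution M) (f : forall n, P n -> P' n) :
  (forall n, linear (f n)) -> (forall x, res_aug P' (f 0%N x) = 0) ->
  (forall n x, res_d P' n (f n.+1 x) = f n (res_d P n x)) ->
  exists H : forall n, P n -> P' n.+1, [/\ forall n, linear (H n),
    forall x, f 0%N x = res_d P' 0%N (H 0%N x)
    & forall n x, f n.+1 x = res_d P' n.+1 (H n.+1 x) + H n (res_d P n x)].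
Proof.
move=> fl fa fd.
(* This invariant makes f_{n+1} - h_n d a map into the cycles, of which the next homotopy is a lift;
   it persists because d d = 0. *)
pose good n (h : P n -> P' n.+1) := linear h /\
  forall x, res_d P' n (h (res_d P n x)) = f n (res_d P n x).
have lift n (g : P n -> P' n) : linear g -> (forall x, dfull P' n (g x) = 0) ->
    exists h : P n -> P' n.+1, linear h /\ forall x, res_d P' n (h x) = g x.
  move=> gl g0; apply: (@projective_lift _ (P n) _ _ _ (res_d P' n) (dfull P' n)) => //.
  - exact: res_projective.
  - by move=> v /dfull_exact.
  - exact: dfull_d.
have [h0 [h0l h0P]] := lift 0%N (f 0%N) (fl 0%N) fa.
have gh0 : good 0%N h0 by split.
pose R n (s : {h | @good n h}) (s' : {h | @good n.+1 h}) :=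
  forall x, f n.+1 x = res_d P' n.+1 (sval s' x) + sval s (res_d P n x).
have [|t [t0 tR]] := @dep_choice _ R (exist _ _ gh0).
  move=> n [h [hl hP]].
  have [||g [gl gP]] := lift n.+1 (fun x => f n.+1 x - h (res_d P n x)).
  - apply: linear_add (fl _) _; apply: linear_opp; apply: linear_comp hl _.
    exact: linear_bundled.
  - by move=> x; rewrite /= linearB /= fd hP subrr.
  suff gg : good n.+1 g by exists (exist _ _ gg) => x /=; rewrite gP subrK.
  by split=> // x; rewrite gP dd (rawlin0 hl) subr0.
exists (fun n => sval (t n)); split=> [n|x|n x]; last exact: tR.
  by case: (svalP (t n)).
by rewrite t0 h0P.
Qed.

Section Pull.
Variables (P P' : projective_resolution M) (th : chain_map P P').

Lemma pull_linear (f : cocycle P') n : linear (fun x => f n (th n x)).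
Proof. by apply: linear_comp; [apply: cc_linear | apply: cm_linear]. Qed.
Lemma pull_finite (f : cocycle P') :
  exists N, forall n x, (N <= n)%N -> f n (th n x) = 0.
Proof. by have [N fN] := cc_finite f; exists N => n x /fN. Qed.
Lemma pull_closed (f : cocycle P') n x : f n (th n (res_d P n x)) = 0.
Proof.
case: n x => [|n] x; first by rewrite -cm_d cc_closed.
by rewrite -cm_d cc_closed.
Qed.

Definition pull (f : cocycle P') : cocycle P :=
  Cocycle (pull_linear f) (pull_finite f) (pull_closed f).

Lemma pull_is_linear c f g : pull (c *: f + g) = c *: pull f + pull g.
Proof. by apply: cocycleP. Qed.

Lemma pull_coboundary f : is_coboundary f -> is_coboundary (pull f).
Proof.
move=> [h [hl f0 fS]]; exists (fun n x => h n (th n x)); split=> [n|x|n x].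
- by apply: linear_comp; [apply: hl | apply: cm_linear].
- exact: f0.
- by rewrite /= fS cm_d.
Qed.

Lemma pull_one : pull (cc_one P') = cc_one P.
Proof. by apply: cocycleP => -[|n] x //=; rewrite cm_aug. Qed.
End Pull.

(** The chain endomorphism id - [th] o [ps] of [P'] covers 0 on M, hence is null-homotopic;
    composing [f] with the homotopy gives the bounding cochain. *)
Lemma pull_pull (P P' : projective_resolution M) (th : chain_map P P')
    (ps : chain_map P' P) (f : cocycle P') : is_coboundary (f - pull ps (pull th f)).
Proof.
have [|||H [Hl H0 HS]] := @null_homotopic P' P' (fun n x => x - th n (ps n x)).
- move=> n; apply: linear_add => //; apply: linear_opp.
  by apply: linear_comp; apply: cm_linear.
- by move=> x; rewrite linearB /= !cm_aug subrr.
- by move=> n x; rewrite linearB /= !cm_d.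
exists (fun n x => f n.+1 (H n x)); split=> [n|x|n x].
- by apply: linear_comp; [apply: cc_linear | apply: Hl].
- by rewrite /= -(rawlinB (@cc_linear _ _ _ _ f 0%N)) H0 cc_closed.
- rewrite /= -(rawlinB (@cc_linear _ _ _ _ f n.+1)) HS (rawlinD (@cc_linear _ _ _ _ f n.+1)).
  by rewrite cc_closed add0r.
Qed.

Variable M_neq0 : exists m : M, m != 0.

Section ExtMap.
Variables (P P' : projective_resolution M) (th : chain_map P P').

Definition ext_pull (x : ext_alg P' M_neq0) : ext_alg P M_neq0 :=
  ext_class M_neq0 (pull th (repr (x : lquot _))).

Lemma ext_pullE f : ext_pull (ext_class M_neq0 f) = ext_class M_neq0 (pull th f).
Proof.
apply/ext_classP.
have -> (g : cocycle P') : pull th g - pull th f = pull th (g - f).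
  by apply: cocycleP.
apply: pull_coboundary; exact: (repr_lpi (coboundaries P') f).
Qed.

Lemma ext_pull_linear : linear ext_pull.
Proof.
move=> c x y; have [f ->] := ext_class_surj x; have [g ->] := ext_class_surj y.
by rewrite -ext_classZ -ext_classD !ext_pullE pull_is_linear ext_classD ext_classZ.
Qed.

Lemma ext_pull_one : ext_pull 1 = 1.
Proof. by rewrite [LHS](ext_pullE (cc_one P')) pull_one. Qed.

Lemma ext_pull_degree n x : ext_degree n x -> ext_degree n (ext_pull x).
Proof.
move=> [f [-> f0]]; exists (pull th f); split; first exact: ext_pullE.
by move=> m u mn; apply: f0.
Qed.
End ExtMap.

Lemma ext_pullK (P P' : projective_resolution M) (th : chain_map P P') (ps : chain_map P' P) :
  cancel (ext_pull th) (ext_pull ps).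
Proof.
move=> x; have [f ->] := ext_class_surj x; rewrite !ext_pullE; apply/esym/ext_classP.
exact: pull_pull.
Qed.

Variables (P P' : projective_resolution M).

(** The lift of [pull th g] is taken to be [ps] o [G] o [th]. This inserts [th] o [ps] between [f]
    and [G], which changes [f] by a coboundary only. *)
Lemma ext_pullM (th : chain_map P P') (x y : ext_alg P' M_neq0) :
  ext_pull th (x * y) = ext_pull th x * ext_pull th y.
Proof.
have [ps _] := chain_map_exists P' P.
have [f ->] := ext_class_surj x; have [g ->] := ext_class_surj y.
pose G := the_lift g.
have [L LE] : exists L : cc_lift (pull th g), forall N m u, L N m u = ps m (G N m (th N u)).
  unshelve eexists; first exists (fun N m u => ps m (G N m (th N u))).
  - move=> N m; apply: linear_comp; first exact: cm_linear.
    by apply: linear_comp; [apply: lf_linear | apply: cm_linear].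
  - by move=> N m u lt; rewrite lf_low // (rawlin0 (@cm_linear _ _ ps m)).
  - have [a Ga] := lf_high G.
    by exists a => N m u le; rewrite Ga // (rawlin0 (@cm_linear _ _ ps m)).
  - by move=> N u; rewrite cm_aug lf_aug.
  - by move=> N m u; rewrite cm_d lf_d cm_d.
  by [].
rewrite (ext_pullE th f) (ext_pullE th g) -(ext_classM M_neq0 (pull th f) L).
have -> : ccomp (pull th f) L = pull th (ccomp (pull ps (pull th f)) G).
  by apply: cocycleP => N u; apply: eq_bigr => m _ /=; rewrite LE.
rewrite -(ext_pullE th (ccomp _ G)) (ext_classM M_neq0 _ G); congr (ext_pull th (_ * _)).
by apply/ext_classP; apply: pull_pull.
Qed.

Lemma ext_alg_resolution : exists f : {lrmorphism ext_alg P' M_neq0 -> ext_alg P M_neq0},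
  bijective f /\ forall n u, ext_degree n u <-> ext_degree n (f u).
Proof.
have [th _] := chain_map_exists P P'; have [ps _] := chain_map_exists P' P.
have mm : monoid_morphism (ext_pull th).
  by split; [apply: ext_pull_one | apply: ext_pullM].
pose f : {lrmorphism ext_alg P' M_neq0 -> ext_alg P M_neq0} :=
  HB.pack (ext_pull th) (GRing.isLinear.Build _ _ _ _ _ (ext_pull_linear th))
    (GRing.isMonoidMorphism.Build _ _ _ mm).
exists f; split=> [|n u].
  by exists (ext_pull ps); apply: ext_pullK.
split=> [|du]; first exact: ext_pull_degree.
by rewrite -[u](ext_pullK th ps); apply: ext_pull_degree.
Qed.
End ChainMaps.

(** * The Clebsch-Gordan complex *)

Section Retract.
Variables (E : nzRingType) (F : lmodType E) (p : F -> F).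
Hypotheses (p_lin : linear p) (p_idem : forall x, p (p x) = p x).

Let q_lin : linear (fun x => x - p x).
Proof. by apply: linear_add => //; apply: linear_opp. Qed.

(** The image of the idempotent [p], realised as the kernel of id - [p] so as to inherit the module
    structure of kernels. Being a direct summand of [F], it is projective when [F] is. *)
Definition retract : lmodType E := Defs.lker (mklin q_lin).
Definition rinc (x : retract) : F := lker_val (mklin q_lin) x.

Lemma rinc_linear : linear rinc.
Proof. by move=> c x y; rewrite /rinc linearP. Qed.

Lemma p_rinc x : p (rinc x) = rinc x.
Proof. by have /eqP := lker_valP x; rewrite subr_eq0 => /eqP/esym. Qed.

Lemma rinc_inj : injective rinc.
Proof. exact: val_inj. Qed.

Let p_ker x : p x \in ker_pred (mklin q_lin).
Proof. by apply/eqP; rewrite /= p_idem subrr. Qed.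

Definition rproj (x : F) : retract := exist _ (p x) (p_ker x).

Lemma rinc_rproj x : rinc (rproj x) = p x.
Proof. by []. Qed.

Lemma rproj_rinc x : rproj (rinc x) = x.
Proof. by apply: rinc_inj; rewrite rinc_rproj p_rinc. Qed.

Lemma rproj_linear : linear rproj.
Proof. by move=> c x y; apply: rinc_inj; rewrite rinc_linear !rinc_rproj p_lin. Qed.

Lemma retract_projective : projective F -> projective retract.
Proof.
move=> Fproj U V s f surj.
have fl : linear (fun x => f (rproj x)).
  by apply: (linear_comp (@linear_bundled _ _ _ f)); apply: rproj_linear.
have [g gP] := Fproj U V s (mklin fl) surj.
have gl : linear (fun x => g (rinc x)).
  by apply: (linear_comp (@linear_bundled _ _ _ g)); apply: rinc_linear.
by exists (mklin gl) => x; rewrite [LHS]gP /= rproj_rinc.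
Qed.
End Retract.

Record free_pairs (E : nzRingType) := FreePairs {
  fmod :> lmodType E;
  fbase : nat -> nat -> fmod;
  flin : forall V : lmodType E, (nat -> nat -> V) -> fmod -> V;
  flin_linear : forall V f, linear (@flin V f);
  flin_base : forall V f i j, @flin V f (fbase i j) = f i j;
  fspan : forall P : fmod -> Prop, (forall c u v, P u -> P v -> P (c *: u + v)) -> P 0 ->
    (forall i j, P (fbase i j)) -> forall u, P u;
  fmod_projective : projective fmod }.

Definition malg_pairs (E : nzRingType) : free_pairs E.
Proof.
apply: (@FreePairs E {malg E[(nat * nat)%type]} (fun i j => << (i, j) >>)
  (fun V f => lext (fun t => f t.1 t.2))).
- by move=> V f; apply: lext_is_linear.
- by move=> V f i j; rewrite lextU.
- move=> P PD P0 Pb u; rewrite [u](malg_linE (E := E)).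
  elim: (enum_fset _) => [|[i j] s IH]; first by rewrite big_nil.
  by rewrite big_cons; apply: PD.
- exact: malg_projective.
Defined.

(* [cg e n i j] says that the n-th term of the minimal
   resolution has the summand A eps_i (x) eps_j A. *)
Definition cg (e n i j : nat) : bool :=
  [&& (n < i + j)%N, (i <= j + n)%N, (j <= i + n)%N, ~~ odd (n + i + j), (i <= e)%N & (j <= e)%N].

(* L/R: the factor acted upon; U/D: the arrow, which need not be the direction in
   which the index moves. *)
Inductive move := LU | LD | RU | RD.
Definition mvi m i := match m with LD => i.+1 | LU => i.-1 | _ => i end.
Definition mvj m j := match m with RU => j.+1 | RD => j.-1 | _ => j end.

Section Moves.
Variables (k : comNzRingType) (A : algType k) (e : nat) (Z : zigzag A e) (W : tensor_env A).
Variable F : free_pairs (tenv W).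
Local Notation eps := (eps Z).
Local Notation up := (up Z).
Local Notation down := (down Z).
Local Notation E := (tenv W).
Local Notation T := (tns W).

(** The generator eps_i (x) eps_j of a summand. The value 0 outside the Clebsch-Gordan range makes
    the moves total: those that leave the range vanish by themselves. *)
Definition om n i j : F := if cg e n i j then T (eps i) (eps j) *: fbase F i j else 0.

Lemma tns0l b : T 0 b = 0. Proof. exact: (rawlin0 (tns_linearl W b)). Qed.
Lemma tns0r a : T a 0 = 0. Proof. exact: (rawlin0 (tns_linearr W a)). Qed.
Lemma tnsDl a a' b : T (a + a') b = T a b + T a' b.
Proof. exact: (rawlinD (tns_linearl W b)). Qed.
Lemma tnsNl a b : T (- a) b = - T a b.
Proof. by rewrite -scaleN1r (rawlinZ (tns_linearl W b)) scaleN1r. Qed.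
Lemma tnsDr a b b' : T a (b + b') = T a b + T a b'.
Proof. exact: (rawlinD (tns_linearr W a)). Qed.
Lemma tnsNr a b : T a (- b) = - T a b.
Proof. by rewrite -scaleN1r (rawlinZ (tns_linearr W a)) scaleN1r. Qed.
Lemma tnsZl c a b : T (c *: a) b = T a (c *: b).
Proof. by rewrite (rawlinZ (tns_linearr W a)) (rawlinZ (tns_linearl W b)). Qed.

Lemma om_out n i j : ~~ cg e n i j -> om n i j = 0.
Proof. by rewrite /om => /negbTE ->. Qed.

Lemma tns_tns (V : lmodType E) a b c d (v : V) : T a b *: (T c d *: v) = T (a * c) (d * b) *: v.
Proof. by rewrite scalerA tnsM. Qed.

Lemma om_eps n i j : T (eps i) (eps j) *: om n i j = om n i j.
Proof.
by rewrite /om; case: ifP => _; rewrite ?scaler0 // tns_tns !epsM !eqxx.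
Qed.

Lemma om_absorb n i j a b : T a b *: om n i j = T (a * eps i) (eps j * b) *: om n i j.
Proof. by rewrite -{1}om_eps tns_tns. Qed.

Local Notation om_lin := (@flin _ F _).

Lemma om_lin_om V f n i j :
  @flin _ F V f (om n i j) = if cg e n i j then T (eps i) (eps j) *: f i j else 0.
Proof.
rewrite /om; case: ifP => _; last exact: rawlin0 (@flin_linear _ F V f).
by rewrite (rawlinZ (@flin_linear _ F V f)) flin_base.
Qed.

Definition om_proj n : F -> F := om_lin (om n).

Lemma om_proj_linear n : linear (om_proj n). Proof. exact: flin_linear. Qed.

Lemma om_proj_om n i j : om_proj n (om n i j) = om n i j.
Proof.
by rewrite /om_proj om_lin_om om_eps; case: ifP => // /negbT /om_out.
Qed.

Lemma om_ind n (P : F -> Prop) : (forall c u v, P u -> P v -> P (c *: u + v)) -> P 0 ->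
  (forall i j, cg e n i j -> P (om n i j)) -> forall x, P (om_proj n x).
Proof.
move=> PD P0 Pom x; move: x; apply: fspan => [c u v IHu IHv||i j].
- by rewrite om_proj_linear; apply: PD.
- by rewrite (rawlin0 (om_proj_linear n)).
- rewrite /om_proj flin_base.
  by have [/Pom//|/om_out ->] := boolP (cg e n i j).
Qed.

Lemma om_proj_idem n x : om_proj n (om_proj n x) = om_proj n x.
Proof.
apply: (@om_ind n (fun z => om_proj n z = z)) => [c u v IHu IHv||i j _]; last exact: om_proj_om.
  by rewrite om_proj_linear IHu IHv.
exact: rawlin0 (om_proj_linear n).
Qed.

Definition mva m i : A := match m with LD => down i | LU => up i.-1 | _ => 1 end.
Definition mvb m j : A := match m with RU => up j | RD => down j.-1 | _ => 1 end.
Definition mv m n : F -> F :=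
  om_lin (fun i j => T (mva m i) (mvb m j) *: om n (mvi m i) (mvj m j)).

Lemma mv_linear m n : linear (mv m n). Proof. exact: flin_linear. Qed.

Lemma eps_mva m i : eps i * mva m i = mva m i * eps (mvi m i) \/ i = 0%N.
Proof.
case: m; rewrite /= ?mulr1 ?mul1r; try by left.
- by case: i => [|i]; [right | left; rewrite /= eps_up up_eps !eqxx].
- by left; rewrite eps_down down_eps !eqxx.
Qed.

Lemma mvb_eps m j : mvb m j * eps j = eps (mvj m j) * mvb m j \/ j = 0%N.
Proof.
case: m; rewrite /= ?mulr1 ?mul1r; try by left.
- by left; rewrite eps_up up_eps !eqxx.
- by case: j => [|j]; [right | left; rewrite /= eps_down down_eps !eqxx].
Qed.

Lemma mv_om m n i j : mv m n (om n.+1 i j) =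
  if cg e n.+1 i j then T (mva m i) (mvb m j) *: om n (mvi m i) (mvj m j) else 0.
Proof.
rewrite /mv om_lin_om; case: ifP => // cgij.
rewrite tns_tns; case: (eps_mva m i) => [->|i0]; last by move: cgij; rewrite /cg; lia.
case: (mvb_eps m j) => [->|j0]; last by move: cgij; rewrite /cg; lia.
by rewrite -om_absorb.
Qed.

Lemma mv_mv m1 m2 n i j : cg e n.+2 i j -> mv m2 n (mv m1 n.+1 (om n.+2 i j)) =
  T (mva m1 i * mva m2 (mvi m1 i)) (mvb m2 (mvj m1 j) * mvb m1 j)
    *: om n (mvi m2 (mvi m1 i)) (mvj m2 (mvj m1 j)).
Proof.
move=> cgij; rewrite mv_om cgij (rawlinZ (mv_linear m2 n)) mv_om.
have [cgij'|ncg] := boolP (cg e n.+1 _ _); first by rewrite tns_tns.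
have [cg2|/om_out ->] := boolP (cg e n (mvi m2 (mvi m1 i)) (mvj m2 (mvj m1 j))); last first.
  by rewrite !scaler0.
(* A move changes sum and difference by one, so between two admissible pairs only the bound e can be
   violated. The first move then carries an arrow of index e, which is zero. *)
have [ie|je] : (e < mvi m1 i \/ e < mvj m1 j)%N.
  by move: cgij cg2 ncg; case: m1; case: m2; rewrite /cg /=; lia.
- suff -> : mva m1 i = 0 by rewrite mul0r !tns0l !scale0r.
  case: m1 ie {ncg cg2} => //=; move: cgij; rewrite /cg; try lia.
  by move=> ? ?; rewrite down_out //; lia.
- suff -> : mvb m1 j = 0 by rewrite mulr0 !tns0r !scale0r.
  case: m1 je {ncg cg2} => //=; move: cgij; rewrite /cg; try lia.
  by move=> ? ?; rewrite up_out //; lia.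
Qed.

Definition lmv n x := mv LU n x + mv LD n x.
Definition rmv n x := mv RU n x + mv RD n x.
(* The signs make the left and right moves anticommute. *)
Definition dom n x := lmv n x + (-1) ^+ n.+1 *: rmv n x.

Lemma lmv_linear n : linear (lmv n).
Proof. by apply: linear_add; apply: mv_linear. Qed.
Lemma rmv_linear n : linear (rmv n).
Proof. by apply: linear_add; apply: mv_linear. Qed.
Lemma sign_linear (V V' : lmodType E) (f : V -> V') m :
  linear f -> linear (fun x => (-1) ^+ m *: f x).
Proof.
move=> lf c x y; rewrite -signr_odd lf; case: odd; rewrite ?expr0 ?scale1r //.
by rewrite expr1 !scaleN1r opprD scalerN.
Qed.
Lemma dom_linear n : linear (dom n).
Proof. by apply: linear_add; [apply: lmv_linear | apply: sign_linear; apply: rmv_linear]. Qed.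

Lemma om_eq (V : lmodType E) n (f g : F -> V) : linear f -> linear g ->
  (forall i j, cg e n i j -> f (om n i j) = g (om n i j)) ->
  forall x, f (om_proj n x) = g (om_proj n x).
Proof.
move=> lf lg fg; apply: (@om_ind n (fun y => f y = g y)) => [c u v IHu IHv||//].
  by rewrite lf lg IHu IHv.
by rewrite !rawlin0.
Qed.

Lemma om_proj_mv m n x : om_proj n (mv m n x) = mv m n x.
Proof.
have pl := om_proj_linear n; have ml := mv_linear m n.
move: x; apply: fspan => [c u v IHu IHv||i j].
- by rewrite ml pl IHu IHv.
- by rewrite (rawlin0 ml) (rawlin0 pl).
- by rewrite /mv flin_base (rawlinZ pl) om_proj_om.
Qed.

Lemma om_proj_dom n x : om_proj n (dom n x) = dom n x.
Proof.
have pl := om_proj_linear n.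
by rewrite /dom (rawlinD pl) (rawlinZ pl) /lmv /rmv !(rawlinD pl) !om_proj_mv.
Qed.

Lemma mv_LU_LU n x : mv LU n (mv LU n.+1 (om_proj n.+2 x)) = 0.
Proof.
move: x; apply: (@om_eq _ n.+2 (fun y => mv LU n (mv LU n.+1 y)) (fun=> 0)).
- by apply: linear_comp; apply: mv_linear.
- exact: linear_zero.
by move=> i j c; rewrite mv_mv //= up_up tns0l scale0r.
Qed.

Lemma lmv_LU n x : lmv n (mv LU n.+1 (om_proj n.+2 x)) = - mv LU n (lmv n.+1 (om_proj n.+2 x)).
Proof.
move: x; apply: (@om_eq _ n.+2 (fun y => lmv n (mv LU n.+1 y))
  (fun y => - mv LU n (lmv n.+1 y))).
- by apply: linear_comp; [apply: lmv_linear | apply: mv_linear].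
- by apply: linear_opp; apply: linear_comp; [apply: mv_linear | apply: lmv_linear].
move=> i j c; rewrite /lmv (rawlinD (mv_linear LU n)) !mv_mv //= !up_up !tns0l !scale0r add0r.
rewrite mulr1 add0r.
have i0 : (0 < i)%N by move: c; rewrite /cg; lia.
rewrite prednK // down_up eqxx up_down eqxx /=.
(* The routes through i - 1 and i + 1 are opposite by [up_down_eq], except for i = 1, where the
   first is missing. Then j = n + 3, and (1, j) is not a pair of degree n. *)
case: ifP => [i1|/negbT i1]; first by rewrite prednK // tnsNl scaleNr.
by rewrite om_out ?scaler0 ?oppr0 //; move: c; rewrite /cg; lia.
Qed.

Lemma lmv_lmv n x : lmv n (lmv n.+1 (om_proj n.+2 x)) = 0.
Proof.
have E1 : lmv n (mv LD n.+1 (om_proj n.+2 x)) = mv LU n (mv LD n.+1 (om_proj n.+2 x)).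
  rewrite /lmv -[RHS]addr0; congr (_ + _).
  move: x; apply: (@om_eq _ n.+2 (fun y => mv LD n (mv LD n.+1 y)) (fun=> 0)).
  - by apply: linear_comp; apply: mv_linear.
  - exact: linear_zero.
  by move=> i j c; rewrite mv_mv //= down_down tns0l scale0r.
rewrite {2}/lmv (rawlinD (lmv_linear n)) lmv_LU E1.
by rewrite {1}/lmv (rawlinD (mv_linear LU n)) mv_LU_LU add0r addNr.
Qed.

Lemma rmv_rmv n x : rmv n (rmv n.+1 (om_proj n.+2 x)) = 0.
Proof.
move: x; apply: (@om_eq _ n.+2 (fun y => rmv n (rmv n.+1 y)) (fun=> 0)).
- by apply: linear_comp; apply: rmv_linear.
- exact: linear_zero.
move=> i j c; rewrite /rmv !(rawlinD (mv_linear _ n)) !mv_mv //=.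
rewrite up_up down_down !tns0r !scale0r add0r addr0.
have j0 : (0 < j)%N by move: c; rewrite /cg; lia.
rewrite prednK // down_up eqxx up_down eqxx mulr1 /=.
(* The same cancellation in the second factor; at j = 1 the pair (i, 1) is not admissible in degree
   n. *)
case: ifP => [i1|/negbT i1]; first by rewrite prednK // tnsNr scaleNr addNr.
by rewrite om_out ?scaler0 ?addr0 //; move: c; rewrite /cg; lia.
Qed.

Definition is_left m := if m is (LU | LD) then true else false.

Lemma mv_comm m1 m2 n x : is_left m1 -> ~~ is_left m2 ->
  mv m2 n (mv m1 n.+1 (om_proj n.+2 x)) = mv m1 n (mv m2 n.+1 (om_proj n.+2 x)).
Proof.
move=> l1 l2; move: x; apply: (@om_eq _ n.+2 (fun y => mv m2 n (mv m1 n.+1 y))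
  (fun y => mv m1 n (mv m2 n.+1 y))).
1,2: by apply: linear_comp; apply: mv_linear.
by move=> i j c; rewrite !mv_mv //; case: m1 m2 l1 l2 => [] [] //=; rewrite !mul1r !mulr1.
Qed.

Lemma mv_rmv m n x : is_left m ->
  rmv n (mv m n.+1 (om_proj n.+2 x)) = mv m n (rmv n.+1 (om_proj n.+2 x)).
Proof. by move=> l; rewrite /rmv [RHS](rawlinD (mv_linear m n)) !(@mv_comm m). Qed.

Lemma lmv_rmv n x : lmv n (rmv n.+1 (om_proj n.+2 x)) = rmv n (lmv n.+1 (om_proj n.+2 x)).
Proof. by rewrite {1}/lmv -!mv_rmv // -[LHS](rawlinD (rmv_linear n)). Qed.

Lemma dom_dom n x : dom n (dom n.+1 (om_proj n.+2 x)) = 0.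
Proof.
rewrite /dom; set y := om_proj _ _.
rewrite [lmv n _](rawlinD (lmv_linear n)) [X in _ + X + _](rawlinZ (lmv_linear n)).
rewrite [rmv n (_ + _)](rawlinD (rmv_linear n)) [X in _ + (_ *: (_ + X))](rawlinZ (rmv_linear n)).
rewrite lmv_lmv rmv_rmv lmv_rmv scaler0 addr0 add0r.
by rewrite -scalerDl exprS mulN1r addNr scale0r.
Qed.

(** [mv LU] anticommutes with the left part of the differential and commutes with the right part,
    whose sign in [dom] alternates with the degree. The factor (-1)^n turns this into strict
    commutation, as required of a lift. *)
Definition Xom n x := (-1) ^+ n *: mv LU n x.

Lemma dom_Xom n x : dom n (Xom n.+1 (om_proj n.+2 x)) = Xom n (dom n.+1 (om_proj n.+2 x)).
Proof.
rewrite /Xom [LHS](rawlinZ (dom_linear n)) /dom lmv_LU mv_rmv //.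
rewrite [mv LU n (_ + _)](rawlinD (mv_linear LU n)).
rewrite [X in _ = _ *: (_ + X)](rawlinZ (mv_linear LU n)) !scalerDr; congr (_ + _).
  by rewrite scalerN -scaleNr exprS mulN1r opprK.
rewrite !scalerA -!exprD -[LHS]scale1r -signr_odd -[X in _ = X *: _]signr_odd.
by rewrite scale1r !oddD /=; case: odd.
Qed.

End Moves.

(** * Exactness *)

Section Contraction.
Variables (k : comNzRingType) (A : algType k) (e : nat) (Z : zigzag_basis A e).
Variables (W : tensor_env A) (F : free_pairs (tenv W)).
Local Notation eps := (eps Z).
Local Notation up := (up Z).
Local Notation down := (down Z).
Local Notation loop := (loop Z).
Local Notation E := (tenv W).
Local Notation T := (tns W).
Local Notation om := (om Z F).
Local Notation dom := (dom Z).
Local Notation lmv := (lmv Z).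
Local Notation rmv := (rmv Z).
Local Notation om_proj := (om_proj Z).

Definition zb s i : A :=
  match s with Ver => eps i | Up => up i | Down => down i.-1 | Loop => loop i end.
Definition zvalid s i : bool :=
  match s with Ver => 0 < i <= e | Up | Loop => 0 < i < e | Down => 1 < i <= e end%N.

Definition same_shape s s' : bool :=
  match s, s' with
  | Ver, Ver | Up, Up | Down, Down | Loop, Loop => true
  | _, _ => false
  end.

Lemma zchi_zb s i s' i' : zvalid s' i' ->
  zchi Z s i (zb s' i') = (same_shape s s' && (i == i'))%:R.
Proof.
case: s' => /= v.
- by rewrite zchi_eps //; case: s.
- by rewrite zchi_up //; case: s.
- rewrite zchi_down; last by lia.
  by rewrite prednK; [case: s | lia].
- by rewrite zchi_loop //; case: s.
Qed.

Lemma zb_out s i : ~~ zvalid s i -> zb s i = 0.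
Proof.
case: s => /= v; first exact: eps_out.
- exact: up_out.
- by apply: down_out; move: v; case: i => [|[|i]] //=; lia.
- exact: loop_out.
Qed.

Lemma zb_eps s i j : (0 < i)%N -> zb s i * eps j = if i == j then zb s i else 0.
Proof.
move=> i0; case: s => /=.
- exact: epsM.
- exact: up_eps.
- by rewrite down_eps prednK // eq_sym.
- exact: loop_eps.
Qed.

(* A right A-linear contraction of the left part of the differential. *)
Definition hval n s i j : F :=
  match s with
  | Ver => 0
  | Up => om n.+1 i.+1 j
  | Down => if j == (i + n)%N then om n.+1 i.-1 j else 0
  | Loop => T (down i) 1 *: om n.+1 i.+1 j
  end.

Lemma hval_out n s i j : cg e n i j -> ~~ zvalid s i -> hval n s i j = 0.
Proof.
move=> c; case: s => //= v.
- by apply: om_out; move: c v; rewrite /cg; lia.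
- by case: eqP => // ?; apply: om_out; move: c v; rewrite /cg; lia.
- by rewrite om_out ?scaler0 //; move: c v; rewrite /cg; lia.
Qed.

Lemma om_eps1 n i j : T 1 (eps j) *: om n i j = om n i j.
Proof. by rewrite om_absorb mul1r epsM eqxx om_eps. Qed.

Lemma hval_eps n s i j : T 1 (eps j) *: hval n s i j = hval n s i j.
Proof.
case: s => /=; first exact: scaler0.
- exact: om_eps1.
- by case: ifP => _; rewrite ?scaler0 // om_eps1.
- by rewrite om_absorb !tns_tns !mul1r mulr1 epsM eqxx.
Qed.

Lemma hval_proj n s i j : om_proj n.+1 (hval n s i j) = hval n s i j.
Proof.
have pl : linear (om_proj n.+1 : F -> F) := om_proj_linear Z n.+1.
case: s => /=; first exact: rawlin0 pl.
- exact: om_proj_om.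
- by case: ifP => _; [apply: om_proj_om | apply: rawlin0 pl].
- by rewrite (rawlinZ pl) om_proj_om.
Qed.

Definition coef i j : F -> E^o :=
  @flin _ F E^o (fun i' j' => ((i == i') && (j == j'))%:R).
Lemma coef_linear i j : linear (coef i j). Proof. exact: flin_linear. Qed.

(** For an element of [E] written as a sum of terms [zb s i] (x) y, this is the y attached to
    [zb s i]. *)
Definition kap s i : E -> A := tker (zchi Z s i).
Lemma kap_linear s i : linear (kap s i).
Proof. exact/tker_linear/zchi_linear. Qed.
Lemma kapE s i a b : kap s i (T a b) = zchi Z s i a *: b.
Proof. by apply: tkerE; apply: zchi_linear. Qed.

Lemma kap_right s i y x : kap s i (T 1 y * x) = kap s i x * y.
Proof.
move: x; apply: tns_span => [c u v IHu IHv||a b].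
- by rewrite mulrDr -scalerAr !kap_linear IHu IHv mulrDl -scalerAl.
- by rewrite mulr0 (rawlin0 (kap_linear s i)) mul0r.
- by rewrite tnsM mul1r !kapE scalerAl.
Qed.

Definition hterm n s i j x : F := T 1 (kap s i (coef i j x)) *: hval n s i j.
(** Additive and right A-linear, but not E-linear, since the first factor is inspected and replaced.
    Sums, signs and right multiples therefore have lemmas of their own. *)
Definition hF n x : F :=
  \sum_(i < e.+1) \sum_(j < e.+1) (hterm n Up i j x + hterm n Down i j x + hterm n Loop i j x).

Lemma htermD n s i j x y : hterm n s i j (x + y) = hterm n s i j x + hterm n s i j y.
Proof.
by rewrite /hterm (rawlinD (coef_linear i j)) (rawlinD (kap_linear s i)) tnsDr scalerDl.
Qed.

Lemma hterm_right n s i j y x : hterm n s i j (T 1 y *: x) = T 1 y *: hterm n s i j x.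
Proof. by rewrite /hterm (rawlinZ (coef_linear i j)) kap_right tns_tns mul1r. Qed.

Lemma hFD n x y : hF n (x + y) = hF n x + hF n y.
Proof.
rewrite -big_split; apply: eq_bigr => i _; rewrite -big_split; apply: eq_bigr => j _.
by rewrite !htermD [RHS]addrACA; congr (_ + _); apply: addrACA.
Qed.

Lemma hF0 n : hF n 0 = 0.
Proof. by apply: (@addIr _ (hF n 0)); rewrite -hFD !add0r. Qed.

Lemma hFN n x : hF n (- x) = - hF n x.
Proof. by apply: (@addIr _ (hF n x)); rewrite -hFD !addNr hF0. Qed.

Lemma hF_sign n m x : hF n ((-1) ^+ m *: x) = (-1) ^+ m *: hF n x.
Proof. by rewrite -signr_odd; case: odd; rewrite ?expr1 ?scaleN1r ?hFN ?expr0 ?scale1r. Qed.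

Lemma hF_right n y x : hF n (T 1 y *: x) = T 1 y *: hF n x.
Proof.
rewrite scaler_sumr; apply: eq_bigr => i _; rewrite scaler_sumr; apply: eq_bigr => j _.
by rewrite !hterm_right !scalerDr.
Qed.

Lemma om_proj_hF n x : om_proj n.+1 (hF n x) = hF n x.
Proof.
have pl : linear (om_proj n.+1 : F -> F) := om_proj_linear Z n.+1.
rewrite (rawlin_sum pl); apply: eq_bigr => i _; rewrite (rawlin_sum pl); apply: eq_bigr => j _.
by rewrite !(rawlinD pl) /hterm !(rawlinZ pl) !hval_proj.
Qed.

Lemma hterm_om n s i j s' i' j' : cg e n i' j' -> zvalid s' i' ->
  hterm n s i j (T (zb s' i') 1 *: om n i' j') =
  if [&& same_shape s s', i == i' & j == j'] then hval n s i j else 0.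
Proof.
move=> c v; rewrite /hterm /om c tns_tns mulr1 (rawlinZ (coef_linear i j)).
rewrite /coef flin_base andbA.
have i0 : (0 < i')%N by move: c; rewrite /cg; lia.
rewrite zb_eps // eqxx.
case: andP => [[/eqP -> /eqP ->]|ne].
  rewrite [_ *: true%:R](mulr1 (_ : E)) kapE zchi_zb // !eqxx !andbT.
  rewrite ?eqxx ?andbT; case: same_shape; first by rewrite scale1r hval_eps.
  by rewrite scale0r tns0r scale0r.
rewrite scaler0 (rawlin0 (kap_linear s i)) tns0r scale0r ifF //.
by apply/negbTE/negP => /andP[/andP[_ ii] jj]; case: ne.
Qed.

(** No validity of (s, i) is required, because on admissible pairs [zb s i] and [hval] vanish
    together at invalid indices. *)
Lemma hF_gen n s i j y : hF n (T (zb s i) y *: om n i j) =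
  if cg e n i j then T 1 y *: hval n s i j else 0.
Proof.
case: ifP => [c|/negbT/om_out ->]; last by rewrite scaler0 hF0.
have -> : T (zb s i) y *: om n i j = T 1 y *: (T (zb s i) 1 *: om n i j).
  by rewrite tns_tns !mul1r.
rewrite hF_right; congr (_ *: _).
have [v|v] := boolP (zvalid s i); last first.
  by rewrite (zb_out v) tns0l scale0r hF0 (hval_out c v).
have ie : (i < e.+1)%N by move: c; rewrite /cg; lia.
have je : (j < e.+1)%N by move: c; rewrite /cg; lia.
rewrite /hF (bigD1 (Ordinal ie)) //= [X in _ + X]big1 ?addr0; last first.
  move=> i' ne; apply: big1 => j' _; rewrite !hterm_om //.
  by rewrite -[_ == i]/(i' == Ordinal ie) (negbTE ne) /= !andbF !addr0.
rewrite (bigD1 (Ordinal je)) //= [X in _ + X]big1 ?addr0; last first.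
  move=> j' ne; rewrite !hterm_om //.
  by rewrite -[_ == j]/(j' == Ordinal je) (negbTE ne) /= !andbF !addr0.
by rewrite !hterm_om // !eqxx !andbT; case: s {v} => /=; rewrite ?addr0 ?add0r.
Qed.

Lemma lmv_om n i j : lmv n (om n.+1 i j) =
  if cg e n.+1 i j then T (up i.-1) 1 *: om n i.-1 j + T (down i) 1 *: om n i.+1 j else 0.
Proof. by rewrite /lmv !mv_om; case: ifP => _; rewrite ?addr0. Qed.

Lemma rmv_om n i j : rmv n (om n.+1 i j) =
  if cg e n.+1 i j then T 1 (up j) *: om n i j.+1 + T 1 (down j.-1) *: om n i j.-1 else 0.
Proof. by rewrite /rmv !mv_om; case: ifP => _; rewrite ?addr0. Qed.

(** With j fixed, [lmv] sends a generator at i to an up term at i - 1 plus a down term at i + 1.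
    [hval] inverts it on up terms and on loops. In degree n a down term at i is a boundary by itself
    only if j = i + n, when the up term at i - 2 leaves the range; hence the case distinction in
    [hval]. *)
Lemma contraction n s i j : cg e n.+1 i j ->
  lmv n.+1 (hval n.+1 s i j) + hF n (lmv n (T (zb s i) 1 *: om n.+1 i j))
  = T (zb s i) 1 *: om n.+1 i j.
Proof.
move=> c; have i0 : (0 < i)%N by move: c; rewrite /cg; lia.
have ll m : linear (lmv m : F -> F) := lmv_linear Z m.
rewrite (rawlinZ (ll n)) lmv_om c scalerDr !tns_tns !mul1r hFD.
have hU i' j' : hF n (T (up i') 1 *: om n i' j') =
    if cg e n i' j' then om n.+1 i'.+1 j' else 0.
  by rewrite (hF_gen n Up) tns1 scale1r.
have hD i' j' : hF n (T (down i') 1 *: om n i'.+1 j') =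
    if cg e n i'.+1 j' && (j' == i'.+1 + n)%N then om n.+1 i' j' else 0.
  rewrite -[down i']/(zb Down i'.+1) hF_gen tns1 scale1r /=.
  by case: (cg e n _ _).
have hL i' j' : hF n (T (loop i') 1 *: om n i' j') =
    if cg e n i' j' then T (down i') 1 *: om n.+1 i'.+1 j' else 0.
  by rewrite (hF_gen n Loop) tns1 scale1r.
have om1 m i' j' : T (eps i') 1 *: om m i' j' = om m i' j'.
  by rewrite om_absorb mulr1 epsM eqxx om_eps.
case: s => /=.
- rewrite (rawlin0 (ll _)) add0r eps_up prednK // eqxx eps_down eqxx hU hD prednK // om1.
  (* The pair (i - 1, j) is inadmissible in degree n exactly when j = i + 1 + n, so one and only one
     of the two terms is contracted. *)
  case: ifP => c1; case: ifP => c2; rewrite ?addr0 ?add0r //.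
  + by exfalso; move: c c1 c2; rewrite /cg; lia.
  + by exfalso; move: c c1 c2; rewrite /cg; lia.
(* The surplus down term at i + 2 produced by [lmv] on [hval] cancels against the contraction of the
   term with minus the loop at i + 1. *)
- rewrite up_up tns0l scale0r hF0 add0r up_down eqxx i0 /= tnsNl scaleNr hFN hL lmv_om /=.
  case: ifP => c1; last first.
    rewrite add0r up_out ?tns0l ?scale0r; last by move: c c1; rewrite /cg; lia.
    by case: ifP => c2; rewrite ?oppr0 //; exfalso; move: c c1 c2; rewrite /cg; lia.
  case: ifP => c2; first by rewrite addrK.
  rewrite oppr0 addr0 [X in _ + X](_ : _ = 0) ?addr0 //.
  have [c3|/om_out ->] := boolP (cg e n.+1 i.+2 j); last by rewrite scaler0.
  by exfalso; move: c c1 c2 c3; rewrite /cg; lia.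
- rewrite down_down tns0l scale0r hF0 addr0 down_up eqxx hL prednK //.
  case: eqP => ji; last first.
    rewrite (rawlin0 (ll _)) add0r; case: ifP => // c1.
    have [c2|/om_out ->] := boolP (cg e n.+1 i j); last by rewrite scaler0.
    rewrite down_out ?tns0l ?scale0r //.
    by move: c c1 ji; rewrite /cg; lia.
  rewrite ifF ?addr0; last by apply/negP => c1; move: c c1; rewrite /cg; lia.
  rewrite lmv_om; case: ifP => c1.
    rewrite (@om_out _ _ _ _ _ _ n.+1 i.-2) ?scaler0 ?add0r ?prednK //.
      by rewrite /cg; lia.
  by rewrite down_out ?tns0l ?scale0r //; move: c c1; rewrite /cg; lia.
- rewrite loop_up loop_down tns0l !scale0r hF0 !addr0 (rawlinZ (ll _)) lmv_om /=.
  case: ifP => c1.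
    by rewrite scalerDr !tns_tns down_down tns0l scale0r addr0 mulr1.
  by rewrite scaler0 loop_out ?tns0l ?scale0r //; move: c c1; rewrite /cg; lia.
Qed.

(* Membership in the r-th power of the radical, in factored form. *)
Fixpoint radp r (y : A) : Prop :=
  if r is r'.+1 then
    exists y', radp r' y' /\ ((exists i, y = up i * y') \/ exists i, y = down i * y')
  else True.

Lemma radp_scale r c y : radp r y -> radp r (c *: y).
Proof.
elim: r y => [//|r IH] y [y' [/IH cy' [] [i ->]]]; exists (c *: y'); split=> //;
  [left | right]; by exists i; rewrite scalerAr.
Qed.

Lemma radpN r y : radp r y -> radp r (- y).
Proof. by move=> /(radp_scale (-1)); rewrite scaleN1r. Qed.

Lemma radpS r y : radp r.+1 y -> radp r y.
Proof.
elim: r y => [//|r IH] y [y' [ry' yy']]; exists y'; split=> //; exact: IH.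
Qed.

(** The longest nonzero products of arrows are the loops, of length two. *)
Lemma radp3 y : radp 3 y -> y = 0.
Proof.
case=> y1 [[y2 [[y3 [_ e3]] e2]] e1].
have UU i j z : up i * (up j * z) = 0 by rewrite mulrA up_up mul0r.
have DD i j z : down i * (down j * z) = 0 by rewrite mulrA down_down mul0r.
have UDU i j l z : up i * (down j * (up l * z)) = 0.
  by rewrite (mulrA (down j)) down_up; case: ifP => _; rewrite ?mul0r ?mulr0 // mulrA up_loop mul0r.
have DUD i j l z : down i * (up j * (down l * z)) = 0.
  rewrite (mulrA (down i)) down_up; case: ifP => _; rewrite ?mul0r //.
  by rewrite mulrA loop_down mul0r.
case: e1 => [[i ->]|[i ->]]; case: e2 => [[j ->]|[j ->]]; case: e3 => [[l ->]|[l ->]];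
  by rewrite ?(UDU, DUD, UU, DD) ?mulr0.
Qed.

(** The filtered factor is the second one. The first is kept in the basis with source equal to the
    index of [om], so that [hF_gen] applies term by term; [rad_filt_tns] extends this to arbitrary
    first factors. *)
Inductive rad_filt r n : F -> Prop :=
| rad_filt0 : rad_filt r n 0
| rad_filtD s i j y x : cg e n i j -> radp r y -> rad_filt r n x ->
    rad_filt r n (T (zb s i) y *: om n i j + x).

Lemma rad_filt_add r n x y : rad_filt r n x -> rad_filt r n y -> rad_filt r n (x + y).
Proof.
elim=> [|s i j z {}x c rz _ IH] ry; first by rewrite add0r.
by rewrite -addrA; apply: rad_filtD => //; apply: IH.
Qed.

Lemma rad_filt_sum r n I (s : seq I) (P : pred I) (f : I -> F) :
  (forall i, P i -> rad_filt r n (f i)) -> rad_filt r n (\sum_(i <- s | P i) f i).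
Proof.
move=> fP; elim/big_rec: _ => [|i x Pi rx]; first exact: rad_filt0.
by apply: rad_filt_add => //; apply: fP.
Qed.

Lemma rad_filt_gen r n s i j y : radp r y -> rad_filt r n (T (zb s i) y *: om n i j).
Proof.
move=> ry; have [c|/om_out ->] := boolP (cg e n i j); last first.
  by rewrite scaler0; apply: rad_filt0.
by rewrite -[_ *: _]addr0; apply: rad_filtD => //; apply: rad_filt0.
Qed.

Lemma rad_filtN r n x : rad_filt r n x -> rad_filt r n (- x).
Proof.
elim=> [|s i j y {}x c ry _ IH]; first by rewrite oppr0; apply: rad_filt0.
by rewrite opprD -scaleNr -tnsNr; apply: rad_filtD => //; apply: radpN.
Qed.

Lemma rad_filt_sign r n m x : rad_filt r n x -> rad_filt r n ((-1) ^+ m *: x).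
Proof.
move=> rx; rewrite -signr_odd; case: odd; rewrite ?expr0 ?scale1r //.
by rewrite expr1 scaleN1r; apply: rad_filtN.
Qed.

Lemma rad_filt_zb r n s i' c y i j : radp r y -> rad_filt r n (T (zb s i') (c *: y) *: om n i j).
Proof.
move=> /(radp_scale c) ry; have [c1|/om_out ->] := boolP (cg e n i j); last first.
  by rewrite scaler0; apply: rad_filt0.
have [->|ne] := eqVneq i' i; first exact: rad_filt_gen.
rewrite om_absorb; case: i' ne => [|i'] ne.
  case: s => /=; rewrite ?(eps_out Z (i := 0)) ?up_out ?(down_out Z (i := 0)) ?loop_out //;
  by rewrite mul0r tns0l scale0r; apply: rad_filt0.
by rewrite zb_eps // (negbTE ne) tns0l scale0r; apply: rad_filt0.
Qed.

Lemma rad_filt_tns r n a y i j : radp r y -> rad_filt r n (T a y *: om n i j).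
Proof.
move=> ry; rewrite (zchiE Z a) (rawlin_sum (tns_linearl W y)) scaler_suml.
apply: rad_filt_sum => i' _; rewrite !tnsDl !tnsZl !scalerDl.
by do 3?[apply: rad_filt_add];
  [apply: (@rad_filt_zb r n Ver) | apply: (@rad_filt_zb r n Up)
  | apply: (@rad_filt_zb r n Down) | apply: (@rad_filt_zb r n Loop)].
Qed.

Lemma rad_filt_om n (u : E) i j : rad_filt 0 n (u *: om n i j).
Proof.
rewrite -[u]scale1r; move: u (1 : k); apply: tns_span => [c u v IHu IHv d||a b d].
- by rewrite scalerDr scalerDl scalerA; apply: rad_filt_add.
- by move=> d; rewrite scaler0 scale0r; apply: rad_filt0.
- by rewrite -(rawlinZ (tns_linearr W a)); apply: rad_filt_tns.
Qed.

Lemma rad_filt_proj n x : rad_filt 0 n (om_proj n x).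
Proof.
have pl : linear (om_proj n : F -> F) := om_proj_linear Z n.
rewrite -[om_proj n x]scale1r; move: x (1 : E); apply: fspan => [c u v IHu IHv d||i j d].
- by rewrite pl scalerDr scalerA; apply: rad_filt_add.
- by move=> d; rewrite (rawlin0 pl) scaler0; apply: rad_filt0.
- by rewrite /om_proj flin_base; apply: rad_filt_om.
Qed.

Lemma rad_filt_hval r n s i j y : radp r y -> rad_filt r n.+1 (T 1 y *: hval n s i j).
Proof.
move=> ry; case: s => /=.
- by rewrite scaler0; apply: rad_filt0.
- exact: rad_filt_tns.
- by case: ifP => _; [apply: rad_filt_tns | rewrite scaler0; apply: rad_filt0].
- by rewrite tns_tns mul1r mul1r; apply: rad_filt_tns.
Qed.

Lemma rad_filt_hF r n x : rad_filt r n x -> rad_filt r n.+1 (hF n x).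
Proof.
elim=> [|s i j y {}x c ry _ IH]; first by rewrite hF0; apply: rad_filt0.
by rewrite hFD; apply: rad_filt_add => //; rewrite hF_gen c; apply: rad_filt_hval.
Qed.

Lemma rad_filt_rmv r n x : rad_filt r n.+1 x -> rad_filt r.+1 n (rmv n x).
Proof.
have rl : linear (rmv n : F -> F) := rmv_linear Z n.
elim=> [|s i j y {}x c ry _ IH]; first by rewrite (rawlin0 rl); apply: rad_filt0.
rewrite (rawlinD rl); apply: rad_filt_add => //; rewrite (rawlinZ rl) rmv_om c.
rewrite scalerDr !tns_tns; apply: rad_filt_add; apply: rad_filt_tns; exists y; split=> //.
- by left; exists j.
- by right; exists j.-1.
Qed.

Lemma rad_filt3 n x : rad_filt 3 n x -> x = 0.
Proof.
by elim=> // s i j y {}x _ /radp3 -> _ ->; rewrite tns0r scale0r addr0.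
Qed.

Definition defect n x : F := x - dom n.+1 (hF n.+1 x) - hF n (dom n x).

Lemma defectD n x y : defect n (x + y) = defect n x + defect n y.
Proof.
have dl m : linear (dom m : F -> F) := dom_linear Z m.
rewrite /defect hFD (rawlinD (dl n)) (rawlinD (dl n.+1)) hFD.
move: (dom n.+1 _) (dom n.+1 _) (hF n (dom n x)) (hF n (dom n y)) => a b c d.
by rewrite !opprD [X in X + _]addrACA; apply: addrACA.
Qed.

(** By [contraction] and right linearity the left moves reproduce x, so the defect consists of [rmv]
    after [hF] and [hF] after [rmv]. Each contains one right move, which puts one more arrow into
    the second factor, while [hF] preserves the filtration. *)
Lemma rad_filt_defect r n x : rad_filt r n.+1 x -> rad_filt r.+1 n.+1 (defect n x).
Proof.
have dl m : linear (dom m : F -> F) := dom_linear Z m.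
elim=> [|s i j y {}x c ry rx IH].
  by rewrite /defect hF0 (rawlin0 (dl n)) (rawlin0 (dl n.+1)) hF0 !subr0; apply: rad_filt0.
rewrite defectD; apply: rad_filt_add => // {x rx IH}.
set w := _ *: _; have rw : rad_filt r n.+1 w by apply: rad_filt_gen.
have -> : defect n w = - ((-1) ^+ n.+2 *: rmv n.+1 (hF n.+1 w)) - (-1) ^+ n.+1 *: hF n (rmv n w).
  rewrite /defect /dom hFD hF_sign.
  have {1}-> : w = lmv n.+1 (hF n.+1 w) + hF n (lmv n w).
    have -> : w = T 1 y *: (T (zb s i) 1 *: om n.+1 i j) by rewrite tns_tns !mul1r.
    rewrite (rawlinZ (lmv_linear Z n)) !hF_right (rawlinZ (lmv_linear Z n.+1)) -scalerDr.
    by rewrite hF_gen c tns1 scale1r contraction.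
  move: (lmv n.+1 _) (hF n (lmv n w)) (_ *: rmv _ _) (_ *: hF _ _) => a b c' d.
  by rewrite !opprD [X in X + _]addrACA subrr add0r addrACA subrr add0r.
apply: rad_filt_add; apply: rad_filtN; apply: rad_filt_sign.
- exact/rad_filt_rmv/rad_filt_hF.
- exact/rad_filt_hF/rad_filt_rmv.
Qed.
End Contraction.

(** * The augmented complex as a projective resolution *)

Section Resolution.
Variables (k : comNzRingType) (A : algType k) (e : nat) (Z : zigzag_basis A e).
Variables (W : tensor_env A) (F : free_pairs (tenv W)).
Local Notation eps := (eps Z).
Local Notation up := (up Z).
Local Notation E := (tenv W).
Local Notation T := (tns W).
Local Notation M := (tmod W).
Local Notation mu := (@tmu _ _ W).
Local Notation nu := (@tnu _ _ W).
Local Notation om := (om Z F).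
Local Notation dom := (dom Z).
Local Notation lmv := (lmv Z).
Local Notation rmv := (rmv Z).
Local Notation om_proj := (om_proj Z).
Local Notation hF := (hF Z).
Local Notation zb := (zb Z).
Local Notation hval := (hval Z F).
Local Notation defect := (defect Z).
Local Notation rad_filt := (rad_filt Z).

Let dl n : linear (dom n : F -> F). Proof. exact: dom_linear. Qed.
Let pl n : linear (om_proj n : F -> F). Proof. exact: om_proj_linear. Qed.

(** The defect of a cycle x is a cycle that differs from x by a boundary. The third defect lies in
    the vanishing third step of the filtration, so three contractions add up to a preimage of x. *)
Lemma dom_exact n (x : F) : om_proj n.+1 x = x -> dom n x = 0 ->
  exists2 y, om_proj n.+2 y = y & x = dom n.+1 y.
Proof.
have step (z : F) : dom n z = 0 -> z = dom n.+1 (hF n.+1 z) + defect n z.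
  by move=> dz; rewrite /defect dz hF0 subr0 addrC subrK.
have dstep (z : F) : dom n z = 0 -> dom n (defect n z) = 0.
  move=> dz; rewrite /defect dz hF0 subr0 (rawlinB (dl n)) dz sub0r.
  by rewrite -om_proj_hF dom_dom oppr0.
move=> px dx; pose x1 := defect n x; pose x2 := defect n x1.
have x3 : defect n x2 = 0.
  apply: (@rad_filt3 _ _ _ Z _ _ n.+1); do 3!apply: rad_filt_defect.
  by rewrite -px; apply: rad_filt_proj.
exists (hF n.+1 x + hF n.+1 x1 + hF n.+1 x2).
  by rewrite !(rawlinD (pl _)) !om_proj_hF.
have ex : x = dom n.+1 (hF n.+1 x) + x1 := step x dx.
have ex1 : x1 = dom n.+1 (hF n.+1 x1) + x2 := step x1 (dstep x dx).
have ex2 : x2 = dom n.+1 (hF n.+1 x2) by rewrite {1}[x2](step x2 (dstep x1 (dstep x dx))) x3 addr0.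
by rewrite !(rawlinD (dl _)) -ex2 -addrA -ex1 -ex.
Qed.

Lemma tmu0 : mu 0 = 0.
Proof. by apply: (@addIr _ (mu 0)); rewrite -tmuD !add0r. Qed.

Lemma tnuD (x y : M) : nu (x + y) = nu x + nu y.
Proof. by apply: (can_inj (@tmuK _ _ W)); rewrite tmuD !tnuK. Qed.

Lemma tmu_sum I (r : seq I) (f : I -> A) : mu (\sum_(i <- r) f i) = \sum_(i <- r) mu (f i).
Proof.
by elim: r => [|i r IH]; [rewrite !big_nil tmu0 | rewrite !big_cons tmuD IH].
Qed.

Definition augF : F -> M := @flin _ F M (fun i j => if i == j then mu (eps i) else 0).

Lemma augF_linear : linear augF. Proof. exact: flin_linear. Qed.

Lemma augF_om n i j : augF (om n i j) = if cg e n i j && (i == j) then mu (eps i) else 0.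
Proof.
rewrite /augF om_lin_om; case: ifP => //= _.
by case: eqP => [->|_]; rewrite ?scaler0 // tns_mu epsM eqxx epsM eqxx.
Qed.

Lemma augF_dom x : augF (dom 0 (om_proj 1 x)) = 0.
Proof.
move: x; apply: (@om_eq _ _ _ Z W F _ 1 (fun y => augF (dom 0 y)) (fun=> 0)).
- exact: linear_comp augF_linear (dl 0).
- exact: linear_zero.
have al := augF_linear.
move=> i j c; rewrite /dom lmv_om rmv_om c expr1 scaleN1r.
rewrite (rawlinB al) !(rawlinD al) !(rawlinZ al) !augF_om.
have [ij|ij] : i = j.+1 \/ j = i.+1 by move: c; rewrite /cg; lia.
- rewrite ij /= eqxx (_ : j.+2 == j = false) ?andbF; last by lia.
  rewrite (_ : j.+1 == j.-1 = false) ?andbF; last by lia.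
  rewrite !scaler0 !addr0 !ifT; try by move: c; rewrite /cg; lia.
  by rewrite !tns_mu mulr1 up_eps eqxx mul1r eps_up eqxx subrr.
- rewrite ij /= eqxx (_ : i.-1 == i.+1 = false) ?andbF; last by lia.
  rewrite (_ : i == i.+2 = false) ?andbF; last by lia.
  rewrite !scaler0 !add0r !ifT; try by move: c; rewrite /cg; lia.
  by rewrite !tns_mu mulr1 down_eps eqxx mul1r eps_down eqxx subrr.
Qed.

(** The right A-linear section of the augmentation that sends 1 to the sum of the eps_j (x) eps_j:
    the component in degree -1 of the contraction of the augmented complex. *)
Definition etaF (m : M) : F := \sum_(j < e.+1) T 1 (nu m) *: om 0 j j.

Lemma etaFD m m' : etaF (m + m') = etaF m + etaF m'.
Proof.
by rewrite /etaF -big_split; apply: eq_bigr => j _; rewrite tnuD tnsDr scalerDl.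
Qed.

Lemma om_proj_etaF m : om_proj 0 (etaF m) = etaF m.
Proof.
rewrite (rawlin_sum (pl 0)); apply: eq_bigr => j _.
by rewrite (rawlinZ (pl 0)) om_proj_om.
Qed.

Lemma augF_etaF m : augF (etaF m) = m.
Proof.
rewrite (rawlin_sum augF_linear); transitivity (mu (\sum_(j < e.+1) eps j * nu m)); last first.
  by rewrite -mulr_suml sum_eps mul1r tnuK.
rewrite tmu_sum.
apply: eq_bigr => j _; rewrite (rawlinZ augF_linear) augF_om eqxx andbT.
case: ifP => [_|c]; first by rewrite tns_mu mul1r.
by rewrite scaler0 eps_out ?mul0r ?tmu0 //; move: c; rewrite /cg; lia.
Qed.

Definition defect0 (x : F) : F := x - dom 0 (hF 0 x) - etaF (augF x).

Lemma lmv_hval0 s i : cg e 0 i i -> s <> Ver -> lmv 0 (hval 0 s i i) = T (zb s i) 1 *: om 0 i i.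
Proof.
move=> c; case: s => //= _.
- rewrite lmv_om /=; case: ifP => c1.
    by rewrite [X in _ + X](_ : _ = 0) ?addr0 // om_out ?scaler0 // /cg; lia.
  by rewrite up_out ?tns0l ?scale0r //; move: c c1; rewrite /cg; lia.
- rewrite addn0 eqxx lmv_om; case: ifP => c1.
    rewrite prednK; last by move: c1; rewrite /cg; lia.
    by rewrite [X in X + _](_ : _ = 0) ?add0r // om_out ?scaler0 // /cg; lia.
  by rewrite down_out ?tns0l ?scale0r //; move: c c1; rewrite /cg; lia.
- rewrite (rawlinZ (lmv_linear Z 0)) lmv_om /=; case: ifP => c1.
    rewrite [X in _ + X](_ : _ = 0) ?addr0 ?tns_tns ?mulr1 //.
    by rewrite om_out ?scaler0 // /cg; lia.
  by rewrite scaler0 loop_out ?tns0l ?scale0r //; move: c c1; rewrite /cg; lia.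
Qed.

Lemma defect0D x y : defect0 (x + y) = defect0 x + defect0 y.
Proof.
rewrite /defect0 hFD (rawlinD (dl 0)) (rawlinD augF_linear) etaFD.
move: (dom 0 _) (dom 0 _) (etaF _) (etaF _) => a b c d.
by rewrite !opprD [X in X + _]addrACA; apply: addrACA.
Qed.

(** An idempotent in the first factor is recovered exactly by [etaF]. The other basis elements are
    recovered by the left part of [dom] after [hF]; on these [etaF] moves the arrow or loop into the
    second factor, which raises the filtration just as a right move does. *)
Lemma rad_filt_defect0 r x : rad_filt r 0 x -> rad_filt r.+1 0 (defect0 x).
Proof.
have h00 : etaF 0 = 0 by apply: (@addIr _ (etaF 0)); rewrite -etaFD !add0r.
elim=> [|s i j y {}x c ry rx IH].
  rewrite /defect0 hF0 (rawlin0 (dl 0)) (rawlin0 augF_linear) h00 !subr0.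
  exact: rad_filt0.
rewrite defect0D; apply: rad_filt_add => // {x rx IH}.
have ij : j = i by move: c; rewrite /cg; lia.
subst j; set w := _ *: _; have rw : rad_filt r 0 w by apply: rad_filt_gen.
have i0 : (0 < i)%N by move: c; rewrite /cg; lia.
have hw : hF 0 w = T 1 y *: hval 0 s i i by rewrite hF_gen c.
have aw : augF w = mu (zb s i * y).
  by rewrite (rawlinZ augF_linear) augF_om c eqxx tns_mu zb_eps // eqxx.
have ew : etaF (augF w) = \sum_(j < e.+1) T 1 (zb s i * y) *: om 0 j j.
  by rewrite aw /etaF tmuK.
have [sV|sV] : s = Ver \/ s <> Ver by case: s {w rw hw aw ew}; [left|right|right|right].
  rewrite /defect0 ew hw sV /= scaler0 (rawlin0 (dl 0)) subr0.
  have ie : (i < e.+1)%N by move: c; rewrite /cg; lia.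
  rewrite (bigD1 (Ordinal ie)) //= big1 ?addr0.
    rewrite /w sV /= om_absorb epsM eqxx [X in _ - X]om_absorb mulrA epsM eqxx mul1r subrr.
    exact: rad_filt0.
  move=> j ne; rewrite om_absorb mulrA epsM ifF ?mul0r ?tns0r ?scale0r //.
  by rewrite -[_ == i]/(j == Ordinal ie) (negbTE ne).
have -> : defect0 w = rmv 0 (hF 0 w) - etaF (augF w).
  rewrite /defect0 /dom expr1 scaleN1r opprB addrCA; congr (_ - _).
  rewrite [X in _ + (_ - X)](_ : _ = w) ?subrr ?addr0 //.
  by rewrite hw (rawlinZ (lmv_linear Z 0)) lmv_hval0 // tns_tns !mul1r.
apply: rad_filt_add; first exact/rad_filt_rmv/rad_filt_hF.
apply: rad_filtN; rewrite ew; apply: rad_filt_sum => j _; apply: rad_filt_tns.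
case: s sV {w rw hw aw ew c} => //= _.
- by exists y; split=> //; left; exists i.
- by exists y; split=> //; right; exists i.-1.
- exists (up i * y); split; last by right; exists i; rewrite mulrA.
  by apply: radpS; exists y; split=> //; left; exists i.
Qed.

Lemma augF_exact (x : F) : om_proj 0 x = x -> augF x = 0 ->
  exists2 y, om_proj 1 y = y & x = dom 0 y.
Proof.
have e0 : etaF 0 = 0 by apply: (@addIr _ (etaF 0)); rewrite -etaFD !add0r.
have step (z : F) : augF z = 0 -> z = dom 0 (hF 0 z) + defect0 z.
  by move=> dz; rewrite /defect0 dz e0 subr0 addrC subrK.
have dstep (z : F) : augF z = 0 -> augF (defect0 z) = 0.
  move=> dz; rewrite /defect0 dz e0 subr0 (rawlinB augF_linear) dz sub0r.
  by rewrite -om_proj_hF augF_dom oppr0.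
move=> px dx; pose x1 := defect0 x; pose x2 := defect0 x1.
have x3 : defect0 x2 = 0.
  apply: (@rad_filt3 _ _ _ Z _ _ 0); do 3!apply: rad_filt_defect0.
  by rewrite -px; apply: rad_filt_proj.
exists (hF 0 x + hF 0 x1 + hF 0 x2).
  by rewrite !(rawlinD (pl _)) !om_proj_hF.
have ex : x = dom 0 (hF 0 x) + x1 := step x dx.
have ex1 : x1 = dom 0 (hF 0 x1) + x2 := step x1 (dstep x dx).
have ex2 : x2 = dom 0 (hF 0 x2) by rewrite {1}[x2](step x2 (dstep x1 (dstep x dx))) x3 addr0.
by rewrite !(rawlinD (dl _)) -ex2 -addrA -ex1 -ex.
Qed.

Definition cgmod n : lmodType E := retract (pl n).
Definition cginc n (x : cgmod n) : F := rinc x.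
Definition cgmk n (x : F) : cgmod n := rproj (pl n) (om_proj_idem Z n) x.
Definition cgen n i j : cgmod n := cgmk n (om n i j).

Lemma cginc_linear n : linear (@cginc n). Proof. exact: rinc_linear. Qed.
Lemma cgmk_linear n : linear (cgmk n). Proof. exact: rproj_linear. Qed.
Lemma cginc_inj n : injective (@cginc n). Proof. exact: rinc_inj. Qed.
Lemma cginc_mk n x : cginc (cgmk n x) = om_proj n x. Proof. by []. Qed.
Lemma om_proj_inc n (x : cgmod n) : om_proj n (cginc x) = cginc x.
Proof. exact: p_rinc. Qed.
Lemma cgmk_inc n (x : cgmod n) : cgmk n (cginc x) = x.
Proof. by apply: cginc_inj; rewrite cginc_mk om_proj_inc. Qed.
Lemma cginc_gen n i j : cginc (cgen n i j) = om n i j.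
Proof. by rewrite cginc_mk om_proj_om. Qed.

Lemma cgmod_projective n : projective (cgmod n).
Proof. exact: (retract_projective (om_proj_idem Z n) (fmod_projective (f0 := F))). Qed.

Lemma cgmod_eq n (V : lmodType E) (f g : cgmod n -> V) : linear f -> linear g ->
  (forall i j, cg e n i j -> f (cgen n i j) = g (cgen n i j)) -> f =1 g.
Proof.
move=> lf lg fg x; rewrite -[x]cgmk_inc -om_proj_inc.
apply: (@om_eq _ _ _ Z W F _ n (fun y => f (cgmk n y)) (fun y => g (cgmk n y))) => //.
- exact: linear_comp lf (cgmk_linear n).
- exact: linear_comp lg (cgmk_linear n).
Qed.

Definition cgd n (x : cgmod n.+1) : cgmod n := cgmk n (dom n (cginc x)).
Lemma cgd_linear n : linear (@cgd n).
Proof.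
by apply: linear_comp (cgmk_linear n) _; apply: linear_comp (dl n) (@cginc_linear n.+1).
Qed.
Lemma cginc_d n (x : cgmod n.+1) : cginc (cgd x) = dom n (cginc x).
Proof. by rewrite cginc_mk om_proj_dom. Qed.

Definition cgaug (x : cgmod 0) : M := augF (cginc x).
Lemma cgaug_linear : linear cgaug.
Proof. exact: linear_comp augF_linear (@cginc_linear 0). Qed.

Lemma cgaug_surj m : exists x, cgaug x = m.
Proof. by exists (cgmk 0 (etaF m)); rewrite /cgaug cginc_mk om_proj_etaF augF_etaF. Qed.

Lemma cgd_exact0 x : cgaug x = 0 <-> exists y, x = cgd y.
Proof.
split=> [/(augF_exact (om_proj_inc x))[y py xy]|[y ->]].
  by exists (cgmk 1 y); apply: cginc_inj; rewrite cginc_d cginc_mk py.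
by rewrite /cgaug cginc_d -om_proj_inc augF_dom.
Qed.

Lemma cgd_exact n (x : cgmod n.+1) : cgd x = 0 <-> exists y, x = cgd y.
Proof.
split=> [dx|[y ->]].
  have [|y py xy] := dom_exact (om_proj_inc x).
    by rewrite -cginc_d dx (rawlin0 (@cginc_linear n)).
  by exists (cgmk n.+2 y); apply: cginc_inj; rewrite cginc_d cginc_mk py.
apply: cginc_inj; rewrite !cginc_d -om_proj_inc dom_dom.
by rewrite (rawlin0 (@cginc_linear n)).
Qed.

Definition cgres : projective_resolution M :=
  @ProjectiveResolution E M cgmod (fun n => mklin (@cgd_linear n)) (mklin cgaug_linear)
    cgmod_projective cgaug_surj cgd_exact0 cgd_exact.
End Resolution.

(** * Generators and products *)

Section ShiftCocycles.
Variables (k : comNzRingType) (A : algType k) (e : nat) (Z : zigzag_basis A e).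
Variables (W : tensor_env A) (F : free_pairs (tenv W)).
Local Notation loop := (loop Z).
Local Notation E := (tenv W).
Local Notation T := (tns W).
Local Notation M := (tmod W).
Local Notation om := (om Z F).
Local Notation dom := (dom Z).
Local Notation om_proj := (om_proj Z).
Local Notation P := (cgres Z F).
Local Notation cgmod := (cgmod Z F).
Local Notation cgaug := (@cgaug _ _ _ Z W F).
Local Notation cgmk := (@cgmk _ _ _ Z W F).
Local Notation cginc := (@cginc _ _ _ Z W F _).
Local Notation cgd := (@cgd _ _ _ Z W F _).

Let dl n : linear (dom n : F -> F). Proof. exact: dom_linear. Qed.
Let pl n : linear (om_proj n : F -> F). Proof. exact: om_proj_linear. Qed.

Section Shift.
Variables (r : nat) (phi : nat -> F -> F).
Hypothesis phi_linear : forall m, linear (phi m).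
Hypothesis phi_d : forall m x, dom m (om_proj m.+1 (phi m.+1 (om_proj (m + r).+1 x))) =
  om_proj m (phi m (dom (m + r)%N (om_proj (m + r).+1 x))).

(** As [phi m] acts on the common module [F], a boolean comparison of degrees replaces a transport
    between [cgmod N] and [cgmod (m + r)]; the value is 0 in all other pairs of degrees. *)
Definition shift_fun N m (x : cgmod N) : cgmod m :=
  if N == (m + r)%N then cgmk m (phi m (cginc x)) else 0.

Lemma shift_linear N m : linear (@shift_fun N m).
Proof.
rewrite /shift_fun; case: eqP => _; last exact: linear_zero.
by apply: linear_comp (@cgmk_linear _ _ _ Z W F m) _;
   apply: linear_comp (phi_linear m) (@cginc_linear _ _ _ Z W F N).
Qed.

Lemma shift_d N m (x : cgmod N.+1) : cgd (@shift_fun N.+1 m.+1 x) = @shift_fun N m (cgd x).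
Proof.
rewrite /shift_fun addSn eqSS; case: eqP => [eN|_]; last exact: rawlin0 (@cgd_linear _ _ _ Z W F m).
subst N; apply: cginc_inj.
rewrite cginc_d (cginc_mk Z (m.+1)) (cginc_mk Z m) cginc_d.
by rewrite -(om_proj_inc x) phi_d.
Qed.

Definition shift_cc n (x : cgmod n) : M := cgaug (@shift_fun n 0 x).

Lemma shift_cc_linear n : linear (@shift_cc n).
Proof. exact: linear_comp (@cgaug_linear _ _ _ Z W F) (@shift_linear n 0). Qed.

Lemma shift_cc_finite : exists N, forall n x, (N <= n)%N -> @shift_cc n x = 0.
Proof.
exists r.+1 => n x lt; rewrite /shift_cc /shift_fun add0n ifF.
  exact: rawlin0 (@cgaug_linear _ _ _ Z W F).
by apply/negbTE; rewrite gtn_eqF.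
Qed.

Lemma shift_cc_closed n x : @shift_cc n (cgd x) = 0.
Proof.
by rewrite /shift_cc -shift_d; apply/(@cgd_exact0 _ _ _ Z W F); exists (@shift_fun n.+1 1 x).
Qed.

Definition shiftc : cocycle P :=
  @Cocycle k E M P shift_cc shift_cc_linear shift_cc_finite shift_cc_closed.

Definition shift_lift : cc_lift shiftc.
Proof.
apply: (@CcLift k E M P shiftc shift_fun shift_linear) => //.
- move=> N m x lt; rewrite /shift_fun ifF //.
  by apply/negbTE; rewrite neq_ltn (leq_trans lt) ?leq_addr.
- exists r.+1 => N m x le; rewrite /shift_fun ifF //.
  by apply/negbTE; rewrite gtn_eqF // -addnS.
- by move=> N m x; apply: shift_d.
Defined.

Lemma ccomp_shift (f : cocycle P) N (x : cgmod N) :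
  ccomp f shift_lift N x =
  if (r <= N)%N then f (N - r)%N (cgmk (N - r) (phi (N - r) (cginc x))) else 0.
Proof.
rewrite /= /ccomp_fun /=.
have f0 m : f m 0 = 0 := rawlin0 (@cc_linear _ _ _ _ f m).
case: leqP => [le|lt]; last first.
  rewrite big1_seq // => m _; rewrite /shift_fun ifF //; apply/negbTE.
  by rewrite neq_ltn (leq_trans lt) ?leq_addl.
have lt : (N - r < N.+1)%N by rewrite ltnS leq_subr.
rewrite big_mkord (bigD1 (Ordinal lt)) //= big1 ?addr0.
  by rewrite /shift_fun subnK // eqxx.
move=> m ne; rewrite /shift_fun ifF //; apply/negbTE/negP => /eqP eN.
by move/eqP: ne; apply; apply: val_inj => /=; move: (val m) eN => m' ->; rewrite addnK.
Qed.
End Shift.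

Variable M_neq0 : exists m : M, m != 0.
Local Notation Ext := (ext_alg P M_neq0).
Local Notation cls := (ext_class M_neq0).

(** The sum bound only weakens from degree n + 2p to n, and a move changes i - j by one. So if the
    moved pair is admissible in degree n, the original one is admissible in degree n + 1, and both
    sides keep the same terms. *)
Lemma om_proj_mv_shift p m n x : om_proj n (mv Z m (n + p.*2) (om_proj (n + p.*2).+1 x)) =
  mv Z m n (om_proj n.+1 (om_proj (n + p.*2).+1 x) : F).
Proof.
have ml m' n' : linear (mv Z m' n' : F -> F) := mv_linear Z m' n'.
move: x; apply: (@om_eq _ _ _ Z W F _ (n + p.*2).+1 (fun y => om_proj n (mv Z m (n + p.*2) y))
  (fun y => mv Z m n (om_proj n.+1 y))).
- exact: linear_comp (pl n) (ml m _).
- exact: linear_comp (ml m _) (pl _).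
move=> i j c; rewrite mv_om c (rawlinZ (pl n)).
have po n' n'' i' j' : om_proj n' (om n'' i' j') = if cg e n'' i' j' then om n' i' j' else 0.
  by rewrite /om_proj om_lin_om om_eps.
rewrite !po c mv_om.
have [c2|/om_out ->] := boolP (cg e n (mvi m i) (mvj m j)); last first.
  by rewrite !scaler0 !if_same scaler0.
by rewrite !ifT //; move: c c2; case: m; rewrite /cg /=; lia.
Qed.

Lemma om_proj_shift p n x : dom n (om_proj n.+1 (om_proj (n + p.*2).+1 x)) =
  om_proj n (dom (n + p.*2)%N (om_proj (n + p.*2).+1 x) : F).
Proof.
have L : om_proj n (lmv Z (n + p.*2) (om_proj (n + p.*2).+1 x)) =
    lmv Z n (om_proj n.+1 (om_proj (n + p.*2).+1 x) : F).
  by rewrite /lmv [LHS](rawlinD (pl n)) !om_proj_mv_shift.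
have R : om_proj n (rmv Z (n + p.*2) (om_proj (n + p.*2).+1 x)) =
    rmv Z n (om_proj n.+1 (om_proj (n + p.*2).+1 x) : F).
  by rewrite /rmv [LHS](rawlinD (pl n)) !om_proj_mv_shift.
rewrite /dom [RHS](rawlinD (pl n)) [X in _ = _ + X](rawlinZ (pl n)) L R.
congr (_ + _ *: _); rewrite -signr_odd -[RHS]signr_odd.
by rewrite /= oddD odd_double addbF.
Qed.

(** A pair admissible in degrees n and n + 2p + 2q is so in degree n + 2p: the sum bound comes from
    the larger degree, the difference bound from the smaller one. *)
Lemma om_proj_proj p q n x :
  om_proj n (om_proj (n + p.*2) (om_proj (n + p.*2 + q.*2) x)) =
  om_proj n (om_proj (n + p.*2 + q.*2) x : F).
Proof.
move: x.
apply: (@om_eq _ _ _ Z W F _ _ (fun y => om_proj n (om_proj (n + p.*2) y)) (om_proj n)) => //.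
  exact: linear_comp (pl n) (pl _).
have po n' n'' i' j' : om_proj n' (om n'' i' j') = if cg e n'' i' j' then om n' i' j' else 0.
  by rewrite /om_proj om_lin_om om_eps.
move=> i j c; rewrite !po c po; case: ifP => // c2.
by rewrite om_out //; move: c c2; rewrite /cg; lia.
Qed.

Lemma y_phi_d p m x : dom m (om_proj m.+1 (om_proj (m + p.*2).+1 x)) =
  om_proj m (dom (m + p.*2)%N (om_proj (m + p.*2).+1 x) : F).
Proof. exact: om_proj_shift. Qed.

(** A single shift by 2p instead of a power, so that its values are read off directly; [cls_ypow]
    identifies its class with the power of [yE]. *)
Definition ypow p : cocycle P := @shiftc p.*2 (fun _ x => x) (fun _ _ _ _ => erefl) (y_phi_d p).
Definition ypow_lift p : cc_lift (ypow p) :=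
  @shift_lift p.*2 (fun _ x => x) (fun _ _ _ _ => erefl) (y_phi_d p).

Lemma Xom_linear m : linear (Xom Z m : F -> F).
Proof. by apply: sign_linear; apply: mv_linear. Qed.

Lemma om_proj_Xom m x : om_proj m (Xom Z m x : F) = Xom Z m x.
Proof. by rewrite /Xom (rawlinZ (pl m)) om_proj_mv. Qed.

Lemma x_phi_d m x : dom m (om_proj m.+1 (Xom Z m.+1 (om_proj (m + 1).+1 x))) =
  om_proj m (Xom Z m (dom (m + 1)%N (om_proj (m + 1).+1 x) : F)).
Proof. by rewrite !om_proj_Xom addn1 dom_Xom. Qed.

Definition xcc : cocycle P := shiftc Xom_linear x_phi_d.

(** Loops are annihilated by arrows and loops from both sides, so only idempotents contribute, and
    source and target of a loop coincide. *)
Lemma loop_central i a : loop i * a = a * loop i.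
Proof.
rewrite (zchiE Z a) mulr_sumr mulr_suml; apply: eq_bigr => j _.
rewrite !mulrDl !mulrDr -!scalerAl -!scalerAr loop_up up_loop loop_down down_loop !loop_loop.
by rewrite loop_eps eps_loop.
Qed.

Definition zom i (m : nat) (x : F) : F := T (loop i) 1 *: x.

Lemma tns_loop_central i u : T (loop i) 1 * u = u * T (loop i) 1.
Proof.
move: u; apply: tns_span => [c u v IHu IHv||a b].
- by rewrite mulrDr mulrDl -scalerAr -scalerAl IHu IHv.
- by rewrite mulr0 mul0r.
- by rewrite !tnsM mulr1 mul1r loop_central.
Qed.

Lemma zom_linear i m : linear (zom i m).
Proof. by move=> c x y; rewrite /zom scalerDr !scalerA tns_loop_central. Qed.

Lemma z_phi_d i m x : dom m (om_proj m.+1 (zom i m.+1 (om_proj (m + 0).+1 x))) =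
  om_proj m (zom i m (dom (m + 0)%N (om_proj (m + 0).+1 x))).
Proof.
rewrite /zom (rawlinZ (pl _)) !(rawlinZ (dl m)) (rawlinZ (pl m)) addn0.
by rewrite om_proj_dom om_proj_idem.
Qed.

Definition zcc i : cocycle P := shiftc (zom_linear i) (z_phi_d i).

Definition yE : Ext := cls (ypow 1).
Definition xE : Ext := cls xcc.
Definition zE i : Ext := cls (zcc i).

(** The lift of a shift has at most one nonzero component out of each degree, so the sum defining
    the product reduces to one term and products can be compared on cochains. *)
Lemma clsM_shift (f : cocycle P) r (phi : nat -> F -> F) (pL : forall m, linear (phi m))
    (pD : forall m x, dom m (om_proj m.+1 (phi m.+1 (om_proj (m + r).+1 x))) =
       om_proj m (phi m (dom (m + r)%N (om_proj (m + r).+1 x)))) (g : cocycle P) :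
  (forall n (x : cgmod n), g n x =
     if (r <= n)%N then f (n - r)%N (cgmk (n - r) (phi (n - r)%N (cginc x))) else 0) ->
  cls f * cls (shiftc pL pD) = cls g.
Proof.
move=> gE; rewrite -(ext_classM M_neq0 f (shift_lift pL pD)); congr ext_class.
by apply: cocycleP => n x; rewrite (ccomp_shift pL pD) gE.
Qed.

Lemma clsM_shift0 (f : cocycle P) r (phi : nat -> F -> F) (pL : forall m, linear (phi m))
    (pD : forall m x, dom m (om_proj m.+1 (phi m.+1 (om_proj (m + r).+1 x))) =
       om_proj m (phi m (dom (m + r)%N (om_proj (m + r).+1 x)))) :
  (forall n (x : cgmod n), 0 =
     if (r <= n)%N then f (n - r)%N (cgmk (n - r) (phi (n - r)%N (cginc x))) else 0) ->
  cls f * cls (shiftc pL pD) = 0.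
Proof. exact: (@clsM_shift f r phi pL pD 0). Qed.

Lemma shiftcE r (phi : nat -> F -> F) (pL : forall m, linear (phi m))
    (pD : forall m x, dom m (om_proj m.+1 (phi m.+1 (om_proj (m + r).+1 x))) =
       om_proj m (phi m (dom (m + r)%N (om_proj (m + r).+1 x)))) n (x : cgmod n) :
  shiftc pL pD n x = if n == r then augF Z (om_proj 0 (phi 0%N (cginc x))) else 0.
Proof.
rewrite /= /shift_cc /shift_fun add0n; case: eqP => // _.
exact: rawlin0 (@cgaug_linear _ _ _ Z W F).
Qed.

Lemma ypowE p n (x : cgmod n) : ypow p n x = if n == p.*2 then augF Z (om_proj 0 (cginc x)) else 0.
Proof. exact: shiftcE. Qed.
Lemma xccE n (x : cgmod n) : xcc n x = if n == 1%N then augF Z (mv Z LU 0 (cginc x)) else 0.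
Proof. by rewrite [LHS]shiftcE om_proj_Xom /Xom expr0 scale1r. Qed.
Lemma zccE i n (x : cgmod n) :
  zcc i n x = if n == 0%N then T (loop i) 1 *: augF Z (om_proj 0 (cginc x)) else 0.
Proof.
rewrite [LHS]shiftcE /zom (rawlinZ (pl 0)).
by rewrite (rawlinZ (@augF_linear _ _ _ Z W F)).
Qed.

Lemma cls_ypowS p : cls (ypow p) * yE = cls (ypow p.+1).
Proof.
apply: clsM_shift => n x; rewrite !ypowE.
have [n2|n2] := leqP 2 n; last by rewrite ifF //; apply/negbTE/eqP; lia.
have -> : (n - 2 == p.*2)%N = (n == p.+1.*2) by apply/eqP/eqP; lia.
case: eqP => // en; subst n; rewrite cginc_mk.
rewrite -(om_proj_inc x) subn2 /=; congr augF.
by have := om_proj_proj p 1 0 (cginc x); rewrite add0n addn2.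
Qed.

Lemma cls_ypow p : cls (ypow p) = yE ^+ p.
Proof.
elim: p => [|p IH]; last by rewrite exprSr -IH cls_ypowS.
congr ext_class; apply: cocycleP => n x; rewrite ypowE.
by case: n x => [|n] x //; rewrite om_proj_inc.
Qed.

Definition xyc p : cocycle P := ccomp xcc (ypow_lift p).

Lemma xycE p n (x : cgmod n) :
  xyc p n x = if n == p.*2.+1 then augF Z (mv Z LU 0 (om_proj 1 (cginc x))) else 0.
Proof.
rewrite [LHS](ccomp_shift _ _ xcc) xccE.
have [n2|n2] := leqP p.*2 n; last by rewrite ifF //; apply/negbTE/eqP; lia.
have -> : (n - p.*2 == 1)%N = (n == p.*2.+1) by apply/eqP/eqP; lia.
by case: eqP => // en; subst n; rewrite cginc_mk subSnn.
Qed.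

Lemma cls_xyc p : cls (xyc p) = xE * yE ^+ p.
Proof. by rewrite -cls_ypow -(ext_classM M_neq0 xcc (ypow_lift p)). Qed.

Lemma yE_xE : yE * xE = xE * yE.
Proof.
rewrite -[yE in RHS]expr1 -cls_xyc; apply: clsM_shift => n x.
rewrite xycE; have [n1|n1] := leqP 1 n; last by rewrite ifF //; apply/negbTE/eqP; lia.
rewrite ypowE; have -> : (n - 1 == 1.*2)%N = (n == 3) by apply/eqP/eqP; lia.
case: eqP => // en; subst n; rewrite cginc_mk om_proj_Xom.
(* The shift by x is applied here in degree 2, where its sign is trivial. *)
rewrite /Xom sqrrN expr1n scale1r; congr augF.
by have := om_proj_mv_shift 1 LU 0 (cginc x); rewrite om_proj_inc => ->.
Qed.

Lemma xE_xE : xE ^+ 2 = 0.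
Proof.
rewrite expr2; apply: clsM_shift0 => n x.
have [n1|//] := leqP 1 n.
rewrite xccE; have -> : (n - 1 == 1)%N = (n == 2) by apply/eqP/eqP; lia.
case: eqP => // en; subst n; rewrite cginc_mk om_proj_Xom /Xom.
rewrite (rawlinZ (mv_linear Z LU 0)) -(om_proj_inc x) mv_LU_LU scaler0.
exact/esym/(rawlin0 (@augF_linear _ _ _ Z W F)).
Qed.

Lemma zom_LU i n x : zom i n (mv Z LU n (om_proj n.+1 x)) = 0.
Proof.
move: x; apply: (@om_eq _ _ _ Z W F _ n.+1 (fun y => zom i n (mv Z LU n y)) (fun=> 0)).
- exact: linear_comp (zom_linear i n) (mv_linear Z LU n).
- exact: linear_zero.
by move=> i' j c; rewrite mv_om c /zom tns_tns loop_up tns0l scale0r.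
Qed.

Lemma zE_xE i : zE i * xE = 0.
Proof.
have al := @augF_linear _ _ _ Z W F.
apply: clsM_shift0 => n x.
have [n1|//] := leqP 1 n.
rewrite zccE; have -> : (n - 1 == 0)%N = (n == 1%N) by apply/eqP/eqP; lia.
case: eqP => // en; subst n; rewrite cginc_mk !om_proj_Xom /Xom expr0 scale1r -(rawlinZ al).
by rewrite -(om_proj_inc x) [X in augF Z X]zom_LU (rawlin0 al).
Qed.

Lemma xE_zE i : xE * zE i = 0.
Proof.
have al := @augF_linear _ _ _ Z W F.
apply: clsM_shift0 => n x.
rewrite leq0n xccE subn0; case: eqP => // en; subst n; rewrite cginc_mk /zom (rawlinZ (pl 1)).
rewrite (rawlinZ (mv_linear Z LU 0)) om_proj_inc -(om_proj_inc x).
by rewrite [X in augF Z X]zom_LU (rawlin0 al).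
Qed.

Lemma zE_zE i j : zE i * zE j = 0.
Proof.
have al := @augF_linear _ _ _ Z W F.
apply: clsM_shift0 => n x.
rewrite leq0n zccE subn0; case: eqP => // en; subst n; rewrite cginc_mk om_proj_idem /zom.
by rewrite (rawlinZ (pl 0)) (rawlinZ al) tns_tns loop_loop tns0l scale0r.
Qed.

Definition zyc i : cocycle P := ccomp (zcc i) (ypow_lift 1).

Lemma cls_zyc i : cls (zyc i) = zE i * yE.
Proof. by rewrite -(ext_classM M_neq0 (zcc i) (ypow_lift 1)). Qed.

Lemma zycE i n (x : cgmod n) :
  zyc i n x = if n == 2 then T (loop i) 1 *: augF Z (om_proj 0 (cginc x)) else 0.
Proof.
rewrite [LHS](ccomp_shift _ _ (zcc i)) zccE.
have [n2|n2] := leqP 2 n; last by rewrite ifF //; apply/negbTE/eqP; lia.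
have -> : (n - 1.*2 == 0)%N = (n == 2) by apply/eqP/eqP; lia.
by case: eqP => // en; subst n; rewrite cginc_mk subnn om_proj_idem.
Qed.

Lemma yE_zE i : yE * zE i = zE i * yE.
Proof.
have al := @augF_linear _ _ _ Z W F.
rewrite -cls_zyc; apply: clsM_shift => n x; rewrite zycE leq0n ypowE subn0.
case: eqP => // en; subst n; rewrite cginc_mk /zom (rawlinZ (pl 2)) om_proj_inc.
by rewrite (rawlinZ (pl 0)) (rawlinZ al).
Qed.

End ShiftCocycles.

(** * Coordinates on Ext *)

Section Corners.
Variables (k : comNzRingType) (A : algType k) (e : nat) (Z : zigzag_basis A e).
Local Notation eps := (eps Z).
Local Notation up := (up Z).
Local Notation down := (down Z).
Local Notation loop := (loop Z).

Lemma eps_zb s i j : eps j * zb Z s i =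
  if j == (match s with Up => i.+1 | Down => i.-1 | _ => i end) then zb Z s i else 0.
Proof.
case: s => /=.
- by rewrite epsM eq_sym; case: eqP => // ->.
- exact: eps_up.
- by rewrite eps_down eq_sym.
- by rewrite eps_loop eq_sym.
Qed.

Lemma corner i j a : (0 < j)%N -> eps i * a * eps j =
    (if i == j then zchi Z Ver j a *: eps j + zchi Z Loop j a *: loop j else 0)
  + (if i == j.+1 then zchi Z Up j a *: up j else 0)
  + (if j == i.+1 then zchi Z Down j a *: down i else 0).
Proof.
move=> j0; rewrite {1}(zchiE Z a) mulr_sumr mulr_suml.
have zbj s l : zb Z s l * eps j = if l == j then zb Z s l else 0.
  case: l => [|l]; last by rewrite zb_eps.
  rewrite ifF; last by apply/negbTE; rewrite neq_ltn j0.
  by case: s => /=; rewrite ?(eps_out Z (i := 0)) ?(up_out Z (i := 0)) ?(down_out Z (i := 0))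
    ?(loop_out Z (i := 0)) // mul0r.
have term s c l : eps i * (c *: zb Z s l) * eps j = if l == j then c *: (eps i * zb Z s j) else 0.
  by rewrite -scalerAr -scalerAl -mulrA zbj; case: eqP => [->|_]; rewrite ?mulr0 ?scaler0.
pose G := zchi Z Ver j a *: (eps i * zb Z Ver j) + zchi Z Up j a *: (eps i * zb Z Up j)
    + zchi Z Down j a *: (eps i * zb Z Down j) + zchi Z Loop j a *: (eps i * zb Z Loop j).
transitivity (\sum_(l < e.+1) if (l : nat) == j then G else 0).
  apply: eq_bigr => l _; rewrite !mulrDr !mulrDl.
  rewrite (term Ver) (term Up) (term Down) (term Loop).
  by case: eqP => [->|_]; rewrite ?addr0.
transitivity G.
  rewrite -big_mkcond /=; have [je|je] := leqP j e.
    by rewrite (big_pred1 (Ordinal (je : (j < e.+1)%N))).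
  rewrite big_pred0 => [|l]; last by apply/negbTE; have := ltn_ord l; lia.
  by rewrite /G !zb_out ?mulr0 ?scaler0 ?addr0 //=; lia.
rewrite /G !eps_zb /=.
have [->|n1] := eqVneq i j.
  rewrite (_ : j == j.+1 = false); last by lia.
  by rewrite (_ : j == j.-1 = false) ?scaler0 ?addr0; [|lia].
rewrite !scaler0 !add0r addr0.
congr (_ + _); first by case: ifP; rewrite ?scaler0.
have -> : (i == j.-1) = (j == i.+1) by apply/eqP/eqP; lia.
by case: eqP => [->|_]; rewrite ?scaler0.
Qed.

Definition delta n (v : nat -> nat -> A) i j : A :=
  up i.-1 * v i.-1 j + down i * v i.+1 j
  + (-1) ^+ n.+1 * (v i j.+1 * up j + v i j.-1 * down j.-1).

Lemma delta_even_up n v (E L : nat -> k) i : ~~ odd n ->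
  (forall i j, v i j = if i == j then E i *: eps i + L i *: loop i else 0) ->
  delta n v i.+1 i = (E i - E i.+1) *: up i.
Proof.
move=> n2 vE; rewrite /delta /= !vE !eqxx.
rewrite (_ : i.+2 == i = false); last by lia.
rewrite (_ : i.+1 == i.-1 = false); last by lia.
rewrite mulr0 mul0r !addr0 mulrDr mulrDl -!scalerAr -!scalerAl up_eps eps_up !eqxx.
rewrite up_loop loop_up !scaler0 !addr0 -signr_odd /= n2 expr1 mulN1r.
by rewrite scalerBl.
Qed.

Lemma delta_even_down n v (E L : nat -> k) i : ~~ odd n ->
  (forall i j, v i j = if i == j then E i *: eps i + L i *: loop i else 0) ->
  delta n v i i.+1 = (E i.+1 - E i) *: down i.
Proof.
move=> n2 vE; rewrite /delta /= !vE !eqxx.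
rewrite (_ : i.-1 == i.+1 = false); last by lia.
rewrite (_ : i == i.+2 = false); last by lia.
rewrite mulr0 mul0r !add0r mulrDr mulrDl -!scalerAr -!scalerAl down_eps eps_down !eqxx.
rewrite down_loop loop_down !scaler0 !addr0 -signr_odd /= n2 expr1 mulN1r.
by rewrite scalerBl.
Qed.

(** All four neighbours of a diagonal pair contribute multiples of the same loop, those through the
    preceding vertex with a minus sign from [up_down_eq]. Starting at vertex 2 suffices, as (1, 1)
    is not a pair of positive degree. *)
Lemma delta_odd n v (U D : nat -> k) i : odd n ->
  (forall i j, v i j = (if i == j.+1 then U j *: up j else 0)
                     + (if j == i.+1 then D i *: down i else 0)) ->
  delta n v i.+2 i.+2 = (U i.+2 + D i.+2 - (U i.+1 + D i.+1)) *: loop i.+2.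
Proof.
move=> n2 vE; rewrite /delta /= !vE !eqxx.
have F1 j : (j == j.+2) = false by lia.
rewrite !F1 !(addr0, add0r) -!scalerAr -!scalerAl up_down down_up !eqxx /=.
rewrite -signr_odd /= n2 expr0 mul1r scalerBl !scalerDl !scalerN.
by rewrite opprD [in LHS](addrC (- _)) addrACA [in LHS](addrC (- _)).
Qed.
End Corners.

(** * Scalar invariants of cocycles that detect coboundaries *)

Section Coordinates.
Variables (k : comNzRingType) (A : algType k) (e : nat) (Z : zigzag_basis A e).
Variables (W : tensor_env A) (F : free_pairs (tenv W)).
Local Notation eps := (eps Z).
Local Notation up := (up Z).
Local Notation down := (down Z).
Local Notation loop := (loop Z).
Local Notation T := (tns W).
Local Notation M := (tmod W).
Local Notation mu := (@tmu _ _ W).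
Local Notation nu := (@tnu _ _ W).
Local Notation om := (om Z F).
Local Notation dom := (dom Z).
Local Notation P := (cgres Z F).
Local Notation cgmod := (cgmod Z F).
Local Notation cgmk := (@cgmk _ _ _ Z W F).
Local Notation cgen := (@cgen _ _ _ Z W F).
Local Notation cginc := (@cginc _ _ _ Z W F _).
Local Notation cgd := (@cgd _ _ _ Z W F _).

Definition cval n (h : cgmod n -> M) i j : A := nu (h (cgen n i j)).

Lemma nu_tns a b (m : M) : nu (T a b *: m) = a * nu m * b.
Proof. by rewrite -{1}[m]tnuK tns_mu tmuK. Qed.

Lemma nu0 : nu 0 = 0. Proof. by rewrite -(tmu0 W) tmuK. Qed.

Lemma nu_sign r (m : M) : nu ((-1) ^+ r *: m) = (-1) ^+ r * nu m.
Proof.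
rewrite -signr_odd -[in RHS]signr_odd; case: odd; rewrite ?expr0 ?scale1r ?mul1r //.
rewrite expr1 scaleN1r mulN1r; apply: (@addIr _ (nu m)).
by rewrite -tnuD !addNr nu0.
Qed.

Lemma cgen_out n i j : ~~ cg e n i j -> cgen n i j = 0.
Proof.
move=> /(om_out Z F) o; rewrite /cgen o.
exact: rawlin0 (@cgmk_linear _ _ _ Z W F n).
Qed.

Lemma cval_out n h i j : linear h -> ~~ cg e n i j -> @cval n h i j = 0.
Proof. by move=> lh /cgen_out o; rewrite /cval o (rawlin0 lh) nu0. Qed.

Lemma cgen_eps n i j : cgen n i j = T (eps i) (eps j) *: cgen n i j.
Proof.
by rewrite /cgen -(rawlinZ (@cgmk_linear _ _ _ Z W F n)) om_eps.
Qed.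

Lemma cval_eps n h i j : linear h -> @cval n h i j = eps i * cval h i j * eps j.
Proof. by move=> lh; rewrite /cval {1}cgen_eps (rawlinZ lh) nu_tns. Qed.

(** In even degree i - j is even for admissible pairs, and eps_i A eps_j is 0 unless i and j differ
    by at most one, so only the diagonal survives. *)
Lemma cval_even n h i j : linear h -> ~~ odd n -> @cval n h i j =
  if i == j then zchi Z Ver i (cval h i i) *: eps i + zchi Z Loop i (cval h i i) *: loop i else 0.
Proof.
move=> lh n2; have z0 s l : zchi Z s l 0 = 0 := rawlin0 (zchi_linear Z s l).
have [c|nc] := boolP (cg e n i j); last first.
  rewrite (cval_out lh nc); case: eqP nc => // -> nc.
  by rewrite (cval_out lh nc) !z0 !scale0r addr0.
rewrite (cval_eps _ _ lh) corner; last by move: c; rewrite /cg; lia.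
rewrite (_ : i == j.+1 = false); last by move: c n2; rewrite /cg; lia.
rewrite (_ : j == i.+1 = false) ?addr0; last by move: c n2; rewrite /cg; lia.
by case: eqP => // <-.
Qed.

Lemma cval_odd n h i j : linear h -> odd n -> @cval n h i j =
  (if i == j.+1 then zchi Z Up j (cval h j.+1 j) *: up j else 0)
  + (if j == i.+1 then zchi Z Down i.+1 (cval h i i.+1) *: down i else 0).
Proof.
move=> lh n2; have z0 s l : zchi Z s l 0 = 0 := rawlin0 (zchi_linear Z s l).
have [c|nc] := boolP (cg e n i j); last first.
  rewrite (cval_out lh nc); case: eqP nc => [-> nc|_ nc].
    by rewrite (cval_out lh nc) z0 scale0r add0r ifF //; lia.
  by case: eqP nc => // [-> nc|_ _]; rewrite ?addr0 // (cval_out lh nc) z0 scale0r addr0.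
rewrite (cval_eps _ _ lh) corner; last by move: c; rewrite /cg; lia.
rewrite (_ : i == j = false) ?add0r; last by move: c n2; rewrite /cg; lia.
by congr (_ + _); case: eqP => // ->.
Qed.

Lemma cval_cgd n (h : cgmod n -> M) i j : linear h -> cg e n.+1 i j ->
  cval (fun x => h (cgd x)) i j = delta Z n (cval h) i j.
Proof.
move=> lh c; rewrite /cval.
have lk := @cgmk_linear _ _ _ Z W F n.
have -> : cgd (cgen n.+1 i j) = cgmk n (dom n (om n.+1 i j)).
  by rewrite /cgd cginc_gen.
rewrite /dom lmv_om rmv_om c.
rewrite (rawlinD lk) (rawlinD lh) tnuD; congr (_ + _).
  by rewrite (rawlinD lk) (rawlinD lh) tnuD !(rawlinZ lk) !(rawlinZ lh) !nu_tns !mulr1.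
rewrite (rawlinZ lk) (rawlinZ lh) nu_sign; congr (_ * _).
by rewrite (rawlinD lk) (rawlinD lh) tnuD !(rawlinZ lk) !(rawlinZ lh) !nu_tns !mul1r.
Qed.

Lemma cochain_eq n (f g : cgmod n -> M) : linear f -> linear g ->
  (forall i, cg e n i i -> cval f i i = cval g i i) ->
  (forall i, cg e n i.+1 i -> cval f i.+1 i = cval g i.+1 i) ->
  (forall i, cg e n i i.+1 -> cval f i i.+1 = cval g i i.+1) -> f =1 g.
Proof.
move=> lf lg e0 e1 e2; apply: (@cgmod_eq _ _ _ Z W F) => // i j c.
apply: (can_inj (@tnuK _ _ W)); rewrite -/(cval f i j) -/(cval g i j).
have [->|n0] := eqVneq i j.
  have [cj|ncj] := boolP (cg e n j j); first exact: e0.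
  by rewrite !cval_out.
have [-> |n1] := eqVneq i j.+1.
  have [cj|ncj] := boolP (cg e n j.+1 j); first exact: e1.
  by rewrite !cval_out.
have [-> |n2] := eqVneq j i.+1.
  have [cj|ncj] := boolP (cg e n i i.+1); first exact: e2.
  by rewrite !cval_out.
have [no|ne] := boolP (odd n).
  by rewrite (cval_odd i j lf no) (cval_odd i j lg no) (negbTE n1) (negbTE n2).
by rewrite (cval_even i j lf ne) (cval_even i j lg ne) (negbTE n0).
Qed.

Lemma scale_up_eq0 c i : (0 < i < e)%N -> c *: up i = 0 -> c = 0.
Proof.
move=> ie /(congr1 (zchi Z Up i)); rewrite (rawlinZ (zchi_linear Z Up i)) zchi_up // eqxx.
by rewrite (rawlin0 (zchi_linear Z Up i)) => <-; rewrite [RHS]mulr1.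
Qed.

Lemma scale_loop_eq0 c i : (0 < i < e)%N -> c *: loop i = 0 -> c = 0.
Proof.
move=> ie /(congr1 (zchi Z Loop i)); rewrite (rawlinZ (zchi_linear Z Loop i)) zchi_loop // eqxx.
by rewrite (rawlin0 (zchi_linear Z Loop i)) => <-; rewrite [RHS]mulr1.
Qed.

(* The invariants of a class under coboundaries: its coordinates along y^m, x y^m
   and z_i. *)
Definition bco m (f : cocycle P) : k := zchi Z Ver e (@cval m.*2 (f m.*2) e e).
Definition cco m (f : cocycle P) : k :=
  zchi Z Up m.+1 (@cval m.*2.+1 (f m.*2.+1) m.+2 m.+1)
  + zchi Z Down m.+2 (@cval m.*2.+1 (f m.*2.+1) m.+1 m.+2).
Definition lco i (f : cocycle P) : k := zchi Z Loop i (@cval 0 (f 0%N) i i).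

Let cl (f : cocycle P) n : linear (f n : cgmod n -> M) := @cc_linear _ _ _ _ f n.
Let z0 s l : zchi Z s l 0 = 0 := rawlin0 (zchi_linear Z s l).

Lemma cocycle_delta (f : cocycle P) n i j : cg e n.+1 i j ->
  delta Z n (@cval n (f n)) i j = 0.
Proof.
move=> c; rewrite -(cval_cgd (@cl f n) c) /cval.
have E0 : f n (cgd (cgen n.+1 i j)) = 0 by apply: (cc_closed f).
by rewrite E0 nu0.
Qed.

(** The cocycle equation at (i + 1, i) equates the coefficients at i and i + 1. The reference vertex
    e is admissible whenever some diagonal pair is, these being the pairs with m < i. *)
Lemma bco_const (f : cocycle P) m i : (m < i <= e)%N ->
  zchi Z Ver i (@cval m.*2 (f m.*2) i i) = bco m f.
Proof.
move=> mi; have [d ed] : exists d, e = (i + d)%N by exists (e - i)%N; lia.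
rewrite /bco; elim: d i mi ed => [|d IH] i mi ed.
  by move: ed; rewrite addn0 => <-.
rewrite -(IH i.+1); [|lia|lia].
have c : cg e m.*2.+1 i.+1 i by rewrite /cg; lia.
have n2 : ~~ odd m.*2 by rewrite odd_double.
have := cocycle_delta f c.
rewrite (delta_even_up _ n2 (fun i j => cval_even i j (@cl f m.*2) n2)) => /scale_up_eq0 E0.
by apply/eqP; rewrite -subr_eq0; apply/eqP/E0; lia.
Qed.

(** The cocycle equation on the diagonal equates the sums at consecutive indices; the reference is
    the smallest admissible index, m + 1. *)
Lemma cco_const (f : cocycle P) m i : (m < i < e)%N ->
  zchi Z Up i (@cval m.*2.+1 (f m.*2.+1) i.+1 i)
  + zchi Z Down i.+1 (@cval m.*2.+1 (f m.*2.+1) i i.+1) = cco m f.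
Proof.
move=> mi; have [d ed] : exists d, i = (m.+1 + d)%N by exists (i - m.+1)%N; lia.
rewrite {}ed /cco in mi *; elim: d mi => [|d IH] mi; first by rewrite addn0.
rewrite -IH; last by lia.
have c : cg e m.*2.+2 (m + d).+2 (m + d).+2 by rewrite /cg; lia.
have n2 : odd m.*2.+1 by rewrite /= odd_double.
have := cocycle_delta f c.
rewrite (delta_odd _ n2 (fun i j => cval_odd i j (@cl f m.*2.+1) n2)) => /scale_loop_eq0 E0.
rewrite !addSn addnS; apply/eqP; rewrite -subr_eq0; apply/eqP/E0; lia.
Qed.

(** In positive even degrees coboundaries take values in loops, and there is none at e. In odd
    degrees the up and down coefficients are opposite differences, so their sum vanishes. In degree
    0 there are no nonzero coboundaries. *)
Lemma coboundary_coords f : is_coboundary f ->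
  [/\ forall m, bco m f = 0, forall m, cco m f = 0 & forall i, lco i f = 0].
Proof.
case=> h [hl f0 fS].
have cS n i j : @cval n.+1 (f n.+1) i j =
    if cg e n.+1 i j then delta Z n (@cval n (h n)) i j else 0.
  case: ifP => [c|/negbT c]; last by rewrite (cval_out (@cl f n.+1) c).
  by rewrite -(cval_cgd (hl n) c) /cval fS.
have c0 i j : @cval 0 (f 0%N) i j = 0 by rewrite /cval f0 nu0.
split=> [[|m]|m|i]; rewrite /bco /cco /lco ?c0 ?z0 //.
- rewrite doubleS cS; case: ifP => [c|_]; last exact: z0.
  have n2 : odd m.*2.+1 by rewrite /= odd_double.
  have loopE i : (1 < i)%N ->
      exists c', delta Z m.*2.+1 (@cval m.*2.+1 (h m.*2.+1)) i i = c' *: loop i.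
    case: i => [|[|i]] // _; eexists.
    exact: (delta_odd _ n2 (fun i j => cval_odd i j (hl m.*2.+1) n2)).
  have [|c' ->] := loopE e; first by move: c; rewrite /cg; lia.
  by rewrite loop_out ?scaler0 ?z0 //; lia.
- have n2 : ~~ odd m.*2 by rewrite odd_double.
  rewrite !cS (delta_even_up _ n2 (fun i j => cval_even i j (hl m.*2) n2)).
  rewrite (delta_even_down _ n2 (fun i j => cval_even i j (hl m.*2) n2)).
  case: ifP => [c|c]; last first.
    by rewrite ifF ?z0 ?addr0 //; move: c; rewrite /cg; lia.
  rewrite ifT; last by move: c; rewrite /cg; lia.
  rewrite !(rawlinZ (zchi_linear Z _ _)) zchi_up; last by move: c; rewrite /cg; lia.
  rewrite zchi_down; last by move: c; rewrite /cg; lia.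
  by rewrite !eqxx [X in X + _]mulr1 [X in _ + X]mulr1 addrA subrK subrr.
Qed.

Definition ofval n (w : nat -> nat -> A) (x : cgmod n) : M :=
  flin (fun i j => mu (w i j)) (cginc x).

Lemma ofval_linear n w : linear (@ofval n w).
Proof. by apply: linear_comp; [apply: flin_linear | apply: cginc_linear]. Qed.

Lemma cval_ofval n w i j : cval (@ofval n w) i j =
  if cg e n i j then eps i * w i j * eps j else 0.
Proof.
rewrite /cval /ofval cginc_gen om_lin_om; case: ifP => _; last exact: nu0.
by rewrite nu_tns tmuK.
Qed.

(** Discrete integration: [U] and [L] are partial sums of the up and loop coefficients, and the
    cochain [w] built from them has these as differences. The down coefficients need no separate
    primitive, since the vanishing of [cco] makes them opposite to the up coefficients. *)
Lemma coords_coboundary f : (forall m, (m < e)%N -> bco m f = 0) ->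
  (forall m, (m.+1 < e)%N -> cco m f = 0) -> (forall i, (0 < i < e)%N -> lco i f = 0) ->
  is_coboundary f.
Proof.
move=> fb fc fl.
pose U n j := \sum_(l < j) zchi Z Up l (@cval n.+1 (f n.+1) l.+1 l).
pose L n j := \sum_(l < j.+1) zchi Z Loop l (@cval n.+1 (f n.+1) l l).
pose w n i j : A := if odd n then (if i == j.+1 then L n j *: up j else 0)
                    else (if i == j then - U n i *: eps i else 0).
exists (fun n => @ofval n (w n)); split=> [n|x|n x].
- exact: ofval_linear.
- rewrite -[RHS]/((fun=> 0) x); move: x; apply: cochain_eq.
  + exact: (@cl f 0).
  + exact: linear_zero.
  + move=> i c; rewrite [RHS]nu0 (cval_even _ _ (@cl f 0)) // eqxx.
    rewrite (@bco_const f 0 i) ?fb; [|by move: c; rewrite /cg; lia..].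
    rewrite scale0r add0r; have [ie|ie] := boolP (0 < i < e)%N.
      by rewrite -/(lco i f) fl // scale0r.
    by rewrite loop_out ?scaler0.
  + by move=> i; rewrite /cg; lia.
  + by move=> i; rewrite /cg; lia.
rewrite -[RHS]/((fun y => @ofval n (w n) (cgd y)) x); move: x.
have lh := @ofval_linear n (w n).
have vE a b : ~~ odd n -> cval (@ofval n (w n)) a b =
    if a == b then (if cg e n a a then - U n a else 0) *: eps a + 0 *: loop a else 0.
  move=> n2; rewrite cval_ofval /w (negbTE n2) scale0r addr0.
  case: eqP => [<-|_]; last by rewrite mulr0 mul0r if_same.
  rewrite -scalerAr -scalerAl epsM eqxx epsM eqxx.
  by case: ifP => _; rewrite ?scale0r.
have [n2|n2] := boolP (odd n); apply: cochain_eq; try exact: (@cl f n.+1).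
- by apply: linear_comp lh _; apply: cgd_linear.
- move=> [|[|i]] c; rewrite (cval_cgd lh c); try by move: c; rewrite /cg; lia.
  have vO a b : cval (@ofval n (w n)) a b =
      (if a == b.+1 then (if cg e n b.+1 b then L n b else 0) *: up b else 0)
      + (if b == a.+1 then 0 *: down a else 0).
    rewrite cval_ofval /w n2 scale0r if_same addr0.
    case: eqP => [->|_]; last by rewrite mulr0 mul0r if_same.
    rewrite -scalerAr -scalerAl eps_up eqxx up_eps eqxx.
    by case: ifP => _; rewrite ?scale0r.
  rewrite (delta_odd _ n2 (U := fun b => if cg e n b.+1 b then L n b else 0) (D := fun=> 0) vO).
  rewrite (cval_even _ _ (@cl f n.+1)) ?eqxx /= ?n2 //.
  have [m nm] : exists m, n.+1 = m.*2 by exists n.+1./2; lia.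
  have -> : zchi Z Ver i.+2 (@cval n.+1 (f n.+1) i.+2 i.+2) = 0.
    rewrite nm (@bco_const f m) ?fb //; move: c; rewrite nm /cg; lia.
  rewrite scale0r add0r !addr0; have [ie|ie] := boolP (0 < i.+2 < e)%N; last first.
    by rewrite loop_out ?scaler0.
  rewrite !ifT; [|by move: c n2; rewrite /cg; lia..].
  by rewrite [L n i.+2]big_ord_recr /= -/(L n i.+1) addrAC subrr add0r.
- by move=> i; move: n2; rewrite /cg; lia.
- by move=> i; move: n2; rewrite /cg; lia.
- by apply: linear_comp lh _; apply: cgd_linear.
- by move=> i; move: n2; rewrite /cg; lia.
- move=> i c; rewrite (cval_cgd lh c) (delta_even_up _ n2 (fun a b => vE a b n2)).
  rewrite (cval_odd _ _ (@cl f n.+1)) /= ?n2 // eqxx ifF ?addr0; last by lia.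
  rewrite !ifT; [|by move: c n2; rewrite /cg; lia..].
  by rewrite opprK [U n i.+1]big_ord_recr /= -/(U n i) addKr.
- move=> i c; rewrite (cval_cgd lh c) (delta_even_down _ n2 (fun a b => vE a b n2)).
  rewrite (cval_odd _ _ (@cl f n.+1)) /= ?n2 // eqxx ifF ?add0r; last by lia.
  rewrite !ifT; [|by move: c n2; rewrite /cg; lia..].
  rewrite opprK [U n i.+1]big_ord_recr /= -/(U n i) opprD addrAC addNr add0r.
  congr (_ *: _); apply/eqP; rewrite -addr_eq0 addrC; apply/eqP.
  have [m nm] : exists m, n = m.*2 by exists n./2; lia.
  subst n; rewrite (@cco_const f m) ?fc //; move: c; rewrite /cg; lia.
Qed.
End Coordinates.

(** * Coordinates of the generators and the remaining relations *)

Section ExtCoordinates.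
Variables (k : comNzRingType) (A : algType k) (e : nat) (Z : zigzag_basis A e).
Variables (W : tensor_env A) (F : free_pairs (tenv W)).
Local Notation eps := (eps Z).
Local Notation up := (up Z).
Local Notation loop := (loop Z).
Local Notation T := (tns W).
Local Notation M := (tmod W).
Local Notation nu := (@tnu _ _ W).
Local Notation dom := (dom Z).
Local Notation om_proj := (om_proj Z).
Local Notation P := (cgres Z F).
Local Notation cgmod := (cgmod Z F).
Local Notation cgen := (@cgen _ _ _ Z W F).
Variable M_neq0 : exists m : M, m != 0.
Local Notation Ext := (ext_alg P M_neq0).
Local Notation cls := (ext_class M_neq0).
Local Notation yE := (yE Z F M_neq0).
Local Notation xE := (xE Z F M_neq0).
Local Notation zE := (zE Z F M_neq0).
Local Notation ypow := (ypow Z F).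
Local Notation xyc := (xyc Z F).
Local Notation zcc := (zcc Z F).
Local Notation zyc := (zyc Z F).
Local Notation cval := (@cval _ _ _ Z W F _).
Local Notation bco := (@bco _ _ _ Z W F).
Local Notation cco := (@cco _ _ _ Z W F).
Local Notation lco := (@lco _ _ _ Z W F).

Let z0 s l : zchi Z s l 0 = 0 := rawlin0 (zchi_linear Z s l).

Lemma nu_kscale c (m : M) : nu (kscale c m) = c *: nu m.
Proof.
have -> : kscale c m = T (c *: 1) 1 *: m.
  by rewrite (rawlinZ (tns_linearl W 1)) tns1.
by rewrite nu_tns mulr1 -scalerAl mul1r.
Qed.

Lemma cval_lin c (f g : cocycle P) n i j :
  cval ((c *: f + g) n : cgmod n -> M) i j =
  c *: cval (f n : cgmod n -> M) i j + cval (g n : cgmod n -> M) i j.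
Proof. by rewrite /cval -nu_kscale -tnuD. Qed.

Let zl c a b s i : zchi Z s i (c *: a + b) = c * zchi Z s i a + zchi Z s i b.
Proof. by rewrite (zchi_linear Z s i). Qed.

Lemma bco_linear m c f g : bco m (c *: f + g) = c * bco m f + bco m g :> k.
Proof. by rewrite /bco cval_lin zl. Qed.
Lemma cco_linear m c f g : cco m (c *: f + g) = c * cco m f + cco m g :> k.
Proof. by rewrite /cco !cval_lin !zl mulrDr addrACA. Qed.
Lemma lco_linear m c f g : lco m (c *: f + g) = c * lco m f + lco m g :> k.
Proof. by rewrite /lco cval_lin zl. Qed.

Lemma cval_ypow p n i j : cval (ypow p n : cgmod n -> M) i j =
  if [&& n == p.*2, cg e n i j & i == j] then eps i else 0.
Proof.
rewrite /cval [X in nu X](@ypowE _ _ _ Z W F p n (cgen n i j)).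
case: eqP => [->|_] /=; last exact: nu0.
rewrite cginc_gen /om_proj om_lin_om om_eps.
case: ifP => c /=; last by rewrite (rawlin0 (@augF_linear _ _ _ Z W F)) nu0.
rewrite augF_om; case: eqP => [ij|_]; last by rewrite andbF nu0.
by rewrite ifT ?tmuK //; move: c; rewrite /cg; lia.
Qed.

Lemma cval_xyc p n i j : cval (xyc p n : cgmod n -> M) i j =
  if [&& n == p.*2.+1, cg e n i j & i == j.+1] then up j else 0.
Proof.
rewrite /cval [X in nu X](@xycE _ _ _ Z W F p n (cgen n i j)).
case: eqP => [->|_] /=; last exact: nu0.
have al := @augF_linear _ _ _ Z W F.
rewrite cginc_gen /om_proj om_lin_om om_eps.
case: ifP => c /=; last first.
  by rewrite (rawlin0 (mv_linear Z LU 0)) (rawlin0 al) nu0.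
rewrite mv_om; case: ifP => c1 /=; last first.
  by rewrite (rawlin0 al) nu0 ifF //; apply/eqP => ij; move: c c1; rewrite ij /cg; lia.
rewrite (rawlinZ al) augF_om nu_tns mulr1.
have -> : cg e 0 i.-1 j && (i.-1 == j) = (i == j.+1) by move: c c1; rewrite /cg; lia.
by case: eqP => [->|_]; rewrite ?tmuK /= ?up_eps ?eqxx // nu0 mulr0.
Qed.

Lemma cval_zcc l n i j : cval (zcc l n : cgmod n -> M) i j =
  if [&& n == 0%N, cg e n i j, i == j & l == i] then loop l else 0.
Proof.
rewrite /cval [X in nu X](@zccE _ _ _ Z W F l n (cgen n i j)).
case: eqP => [->|_] /=; last exact: nu0.
rewrite cginc_gen om_proj_om augF_om nu_tns mulr1.
case: (cg e 0 i j) => /=; last by rewrite nu0 mulr0.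
by case: eqP => _ /=; rewrite ?nu0 ?mulr0 // tmuK loop_eps.
Qed.

Lemma cval_zyc l n i j : cval (zyc l n : cgmod n -> M) i j =
  if [&& n == 2, cg e n i j, i == j & l == i] then loop l else 0.
Proof.
rewrite /cval [X in nu X](@zycE _ _ _ Z W F l n (cgen n i j)).
case: eqP => [->|_] /=; last exact: nu0.
rewrite cginc_gen nu_tns mulr1 /om_proj om_lin_om om_eps.
case: ifP => c /=; last by rewrite (rawlin0 (@augF_linear _ _ _ Z W F)) nu0 mulr0.
rewrite augF_om; case: eqP => [ij|_]; last by rewrite andbF nu0 mulr0.
rewrite ifT /=; last by move: c; rewrite /cg; lia.
by rewrite tmuK loop_eps.
Qed.

Lemma bco_ypow m p : (p < e)%N -> bco m (ypow p) = (m == p)%:R :> k.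
Proof.
move=> pe; rewrite /bco cval_ypow eqxx andbT.
have -> : (m.*2 == p.*2) && cg e m.*2 e e = (m == p) by rewrite /cg; lia.
by case: eqP => _; rewrite ?z0 // zchi_eps ?eqxx //; lia.
Qed.
Lemma bco_ypow0 m p : (e <= p)%N -> bco m (ypow p) = 0 :> k.
Proof.
move=> pe; rewrite /bco cval_ypow ifF ?z0 //.
by rewrite /cg; lia.
Qed.
Lemma cco_ypow m p : cco m (ypow p) = 0 :> k.
Proof. by rewrite /cco !cval_ypow !ifF ?z0 ?addr0 //; lia. Qed.
Lemma lco_ypow i p : lco i (ypow p) = 0 :> k.
Proof.
rewrite /lco cval_ypow; case: ifP => [|_]; last exact: z0.
by case/and3P => _ c _; rewrite zchi_eps //; move: c; rewrite /cg; lia.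
Qed.

Lemma cco_xyc m p : (p.+1 < e)%N -> cco m (xyc p) = (m == p)%:R :> k.
Proof.
move=> pe; rewrite /cco !cval_xyc eqxx andbT.
have -> : (m.*2.+1 == p.*2.+1) && cg e m.*2.+1 m.+2 m.+1 = (m == p) by rewrite /cg; lia.
rewrite (_ : m.+1 == m.+3 = false) ?andbF ?z0 ?addr0; last by lia.
by case: eqP => [->|_]; rewrite ?z0 // zchi_up ?eqxx //; lia.
Qed.
Lemma cco_xyc0 m p : (e <= p.+1)%N -> cco m (xyc p) = 0 :> k.
Proof. by move=> pe; rewrite /cco !cval_xyc !ifF ?z0 ?addr0 //; rewrite /cg; lia. Qed.
Lemma bco_xyc m p : bco m (xyc p) = 0 :> k.
Proof. by rewrite /bco cval_xyc ifF ?z0 //; lia. Qed.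
Lemma lco_xyc i p : lco i (xyc p) = 0 :> k.
Proof. by rewrite /lco cval_xyc /= z0. Qed.

Lemma bco_zcc m l : bco m (zcc l) = 0 :> k.
Proof.
rewrite /bco cval_zcc; case: ifP => [|_]; last exact: z0.
by case/and4P => _ _ _ /eqP ->; rewrite loop_out ?z0 //; lia.
Qed.
Lemma cco_zcc m l : cco m (zcc l) = 0 :> k.
Proof. by rewrite /cco !cval_zcc /= !z0 addr0. Qed.
Lemma lco_zcc i l : (0 < l < e)%N -> lco i (zcc l) = (i == l)%:R :> k.
Proof.
move=> le; rewrite /lco cval_zcc !eqxx /=.
have -> : cg e 0 i i && (l == i) = (i == l) by rewrite /cg; lia.
by case: eqP => [->|_]; rewrite ?z0 // zchi_loop ?eqxx.
Qed.

(** The product need not vanish as a cocycle. It takes loop values in degree 2, where the only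
    coordinate is the idempotent coefficient at vertex e; hence it is a coboundary. *)
Lemma zE_yE l : zE l * yE = 0.
Proof.
rewrite -cls_zyc; apply/(lpi_eq0 (coboundaries P)); apply: coords_coboundary => [m|m|i] _.
- rewrite /bco cval_zyc; case: ifP => [|_]; last exact: z0.
  by case/and4P => _ _ _ /eqP ->; rewrite loop_out ?z0 //; lia.
- by rewrite /cco !cval_zyc !ifF ?z0 ?addr0 //; lia.
- by rewrite /lco !cval_zyc /= z0.
Qed.

Lemma yE_e : yE ^+ e = 0.
Proof.
rewrite -cls_ypow; apply/(lpi_eq0 (coboundaries P)); apply: coords_coboundary => [m|m|i] _.
- exact: bco_ypow0.
- exact: cco_ypow.
- exact: lco_ypow.
Qed.

Lemma xE_yE_e : xE * yE ^+ e.-1 = 0.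
Proof.
rewrite -cls_xyc; apply/(lpi_eq0 (coboundaries P)); apply: coords_coboundary => [m|m|i] _.
- exact: bco_xyc.
- by apply: cco_xyc0; lia.
- exact: lco_xyc.
Qed.

Definition ext_coord (co : cocycle P -> k) (u : Ext) : k := co (repr (u : lquot _)).

Lemma ext_coordE (co : cocycle P -> k) :
  (forall c f g, co (c *: f + g) = c * co f + co g) ->
  (forall f, is_coboundary f -> co f = 0) -> forall f, ext_coord co (cls f) = co f.
Proof.
move=> colin cob f; rewrite /ext_coord; set g := repr _.
have cgf : is_coboundary (g - f) := repr_lpi (coboundaries P) f.
transitivity (co (1 *: (g - f) + f)); first by rewrite scale1r subrK.
by rewrite colin cob // mulr0 add0r.
Qed.

Lemma ext_coord_linear (co : cocycle P -> k) :
  (forall c f g, co (c *: f + g) = c * co f + co g) ->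
  (forall f, is_coboundary f -> co f = 0) ->
  forall c u v, ext_coord co (c *: u + v) = c * ext_coord co u + ext_coord co v.
Proof.
move=> colin cob c u v; have [f ->] := ext_class_surj u; have [g ->] := ext_class_surj v.
by rewrite -ext_classZ -ext_classD !ext_coordE.
Qed.

Let bcob m f : is_coboundary f -> bco m f = 0 :> k.
Proof. by case/(@coboundary_coords _ _ _ Z W F). Qed.
Let ccob m f : is_coboundary f -> cco m f = 0 :> k.
Proof. by case/(@coboundary_coords _ _ _ Z W F). Qed.
Let lcob m f : is_coboundary f -> lco m f = 0 :> k.
Proof. by case/(@coboundary_coords _ _ _ Z W F). Qed.

Definition bE m := ext_coord (bco m).
Definition cE m := ext_coord (cco m).
Definition lE i := ext_coord (lco i).

Lemma bE_cls m f : bE m (cls f) = bco m f.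
Proof. exact: ext_coordE (bco_linear m) (@bcob m) f. Qed.
Lemma cE_cls m f : cE m (cls f) = cco m f.
Proof. exact: ext_coordE (cco_linear m) (@ccob m) f. Qed.
Lemma lE_cls m f : lE m (cls f) = lco m f.
Proof. exact: ext_coordE (lco_linear m) (@lcob m) f. Qed.

Lemma bE_linear m c u v : bE m (c *: u + v) = c * bE m u + bE m v.
Proof. exact: ext_coord_linear (bco_linear m) (@bcob m) c u v. Qed.
Lemma cE_linear m c u v : cE m (c *: u + v) = c * cE m u + cE m v.
Proof. exact: ext_coord_linear (cco_linear m) (@ccob m) c u v. Qed.
Lemma lE_linear m c u v : lE m (c *: u + v) = c * lE m u + lE m v.
Proof. exact: ext_coord_linear (lco_linear m) (@lcob m) c u v. Qed.

Lemma coordsE_inj u : (forall m, (m < e)%N -> bE m u = 0) ->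
  (forall m, (m.+1 < e)%N -> cE m u = 0) -> (forall i, (0 < i < e)%N -> lE i u = 0) -> u = 0.
Proof.
have [f ->] := ext_class_surj u => b0 c0 l0; apply/(lpi_eq0 (coboundaries P)).
apply: coords_coboundary => [m me|m me|i ie].
- by rewrite -bE_cls b0.
- by rewrite -cE_cls c0.
- by rewrite -lE_cls l0.
Qed.

Lemma degree_coords n u : ext_degree n u ->
  [/\ forall m, m.*2 <> n -> bE m u = 0, forall m, m.*2.+1 <> n -> cE m u = 0
    & forall i, 0%N <> n -> lE i u = 0].
Proof.
case=> f [-> f0].
have c0 m i j : m <> n -> cval (f m : cgmod m -> M) i j = 0.
  by move=> /f0 fm; rewrite /cval fm nu0.
split=> [m|m|i] mn.
- by rewrite bE_cls /bco c0.
- by rewrite cE_cls /cco !c0 // !z0 addr0.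
- by rewrite lE_cls /lco c0.
Qed.

Lemma degree_shift n r u (phi : nat -> F -> F) (pL : forall m, linear (phi m))
    (pD : forall m x, dom m (om_proj m.+1 (phi m.+1 (om_proj (m + r).+1 x))) =
       om_proj m (phi m (dom (m + r)%N (om_proj (m + r).+1 x)))) :
  ext_degree n u -> ext_degree (n + r) (u * cls (shiftc pL pD)).
Proof.
case=> f [-> f0]; exists (ccomp f (shift_lift pL pD)); split.
  by rewrite -(ext_classM M_neq0 f (shift_lift pL pD)).
move=> m x mn; rewrite (ccomp_shift pL pD f); case: leqP => // le.
by apply: f0; lia.
Qed.

Lemma degree_yE n u : ext_degree n u -> ext_degree (n + 2) (u * yE).
Proof. exact: degree_shift. Qed.
Lemma degree_xE n u : ext_degree n u -> ext_degree (n + 1) (u * xE).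
Proof. exact: degree_shift. Qed.
Lemma degree_zE n u i : ext_degree n u -> ext_degree (n + 0) (u * zE i).
Proof. exact: degree_shift. Qed.

Lemma degree_one : ext_degree 0 (1 : Ext).
Proof. by exists (cc_one P); split=> // -[|m] x. Qed.

Lemma degree_lin n c (u v : Ext) : ext_degree n u -> ext_degree n v -> ext_degree n (c *: u + v).
Proof.
move=> [f [-> f0]] [g [-> g0]]; exists (c *: f + g); split.
  by rewrite ext_classD ext_classZ.
by move=> m x mn; rewrite /= f0 // g0 // kscale0 addr0.
Qed.

Lemma degree_zero n : ext_degree n (0 : Ext).
Proof. by exists 0. Qed.

End ExtCoordinates.

(** * The presentation *)

Section Presentation.
Variables (k : fieldType) (e : nat) (H : algType k) (deg : nat -> H -> Prop).
Variables (x y : H) (z : nat -> H) (bE cE lE : nat -> H -> k).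
Hypothesis e_gt1 : (1 < e)%N.
Hypotheses (yx : y * x = x * y) (xx : x ^+ 2 = 0) (zx : forall i, z i * x = 0)
  (xz : forall i, x * z i = 0) (zz : forall i j, z i * z j = 0)
  (zy : forall i, z i * y = 0) (yz : forall i, y * z i = 0)
  (ye : y ^+ e = 0) (xye : x * y ^+ e.-1 = 0).
Hypotheses (b_lin : forall m, linear (bE m : H -> k^o))
  (c_lin : forall m, linear (cE m : H -> k^o)) (l_lin : forall i, linear (lE i : H -> k^o)).
Hypothesis coords_inj : forall u, (forall m, (m < e)%N -> bE m u = 0) ->
  (forall m, (m.+1 < e)%N -> cE m u = 0) -> (forall i, (0 < i < e)%N -> lE i u = 0) -> u = 0.
Hypotheses
  (b_y : forall m p, (p < e)%N -> bE m (y ^+ p) = (m == p)%:R)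
  (c_y : forall m p, cE m (y ^+ p) = 0) (l_y : forall i p, lE i (y ^+ p) = 0)
  (b_xy : forall m p, bE m (x * y ^+ p) = 0)
  (c_xy : forall m p, (p.+1 < e)%N -> cE m (x * y ^+ p) = (m == p)%:R)
  (l_xy : forall i p, lE i (x * y ^+ p) = 0)
  (b_z : forall m l, bE m (z l) = 0) (c_z : forall m l, cE m (z l) = 0)
  (l_z : forall i l, (0 < l < e)%N -> lE i (z l) = (i == l)%:R).
Hypotheses
  (deg_coords : forall n u, deg n u -> [/\ forall m, m.*2 <> n -> bE m u = 0,
     forall m, m.*2.+1 <> n -> cE m u = 0 & forall i, 0%N <> n -> lE i u = 0])
  (deg_y : forall n u, deg n u -> deg (n + 2) (u * y))
  (deg_x : forall n u, deg n u -> deg (n + 1) (u * x))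
  (deg_z : forall n u i, deg n u -> deg (n + 0) (u * z i))
  (deg_one : deg 0 1) (deg_zero : forall n, deg n 0)
  (deg_lin : forall n c u v, deg n u -> deg n v -> deg n (c *: u + v)).

(** Stated for an arbitrary algebra because the same normal form is used in [H] and in the
    polynomial quotient, and the isomorphism matches the two. *)
Definition comb (V : algType k) (vz : 'I_e.-1 -> V) (vx vy : V) (l b c : nat -> k) : V :=
  \sum_(i < e.-1) l i *: vz i + \sum_(m < e) b m *: vy ^+ m
  + \sum_(m < e.-1) c m *: (vx * vy ^+ m).

Lemma comb_lin V vz vx vy t l b c l' b' c' :
  t *: @comb V vz vx vy l b c + comb vz vx vy l' b' c' =
  comb vz vx vy (fun i => t * l i + l' i) (fun i => t * b i + b' i) (fun i => t * c i + c' i).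
Proof.
have S n (f f' : nat -> k) (w : 'I_n -> V) :
    t *: (\sum_(i < n) f i *: w i) + \sum_(i < n) f' i *: w i =
    \sum_(i < n) (t * f i + f' i) *: w i.
  rewrite scaler_sumr -big_split; apply: eq_bigr => i _.
  by rewrite scalerDl scalerA.
by rewrite /comb -!S !scalerDr addrACA [X in X + _ = _]addrACA.
Qed.

Lemma comb_zero V vz vx vy : @comb V vz vx vy (fun=> 0) (fun=> 0) (fun=> 0) = 0.
Proof. by rewrite /comb !big1 ?addr0 // => i _; rewrite scale0r. Qed.

Lemma sum_delta (V : lmodType k) n (w : 'I_n -> V) (i : 'I_n) :
  \sum_(j < n) ((j : nat) == i)%:R *: w j = w i.
Proof.
rewrite (bigD1 i) //= eqxx scale1r big1 ?addr0 // => j ne.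
by rewrite -[_ == _]/(j == i) (negbTE ne) scale0r.
Qed.

Lemma sum_zero (V : lmodType k) n (w : 'I_n -> V) : \sum_(j < n) 0 *: w j = 0.
Proof. by rewrite big1 // => j _; rewrite scale0r. Qed.

Lemma comb_z V vz vx vy i :
  vz i = @comb V vz vx vy (fun j => (j == i)%:R) (fun=> 0) (fun=> 0).
Proof. by rewrite /comb sum_delta !sum_zero !addr0. Qed.
Lemma comb_y V vz vx vy m : (m < e)%N ->
  vy ^+ m = @comb V vz vx vy (fun=> 0) (fun j => (j == m)%:R) (fun=> 0).
Proof.
move=> me; rewrite /comb !sum_zero addr0 add0r.
by rewrite -(sum_delta (fun j : 'I_e => vy ^+ j) (Ordinal me)).
Qed.
Lemma comb_xy V vz vx vy m : (m.+1 < e)%N ->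
  vx * vy ^+ m = @comb V vz vx vy (fun=> 0) (fun=> 0) (fun j => (j == m)%:R).
Proof.
move=> me; have me' : (m < e.-1)%N by lia.
rewrite /comb !sum_zero !add0r.
by rewrite -(sum_delta (fun j : 'I_e.-1 => vx * vy ^+ j) (Ordinal me')).
Qed.

Local Notation combH := (comb (fun i : 'I_e.-1 => z i.+1) x y).

Let scale_ind (f : nat -> k) n m : (m < n)%N -> \sum_(j < n) f j *: ((m == j)%:R : k^o) = f m.
Proof.
move=> mn; rewrite (bigD1 (Ordinal mn)) //= eqxx big1 ?addr0; first exact: mulr1.
move=> j ne; rewrite eq_sym -[_ == m]/(j == Ordinal mn) (negbTE ne); exact: mulr0.
Qed.
Let scale_zero (f : nat -> k) n : \sum_(j < n) f j *: (0 : k^o) = 0.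
Proof. by rewrite big1 // => j _; rewrite scaler0. Qed.

Lemma bE_comb l b c m : (m < e)%N -> bE m (combH l b c) = b m.
Proof.
move=> me; rewrite /comb !(rawlinD (b_lin m)) !(rawlin_sum (b_lin m)).
under eq_bigr => i _ do rewrite (rawlinZ (b_lin m)) b_z.
under [X in _ + X + _]eq_bigr => i _ do rewrite (rawlinZ (b_lin m)) b_y //.
under [X in _ + X]eq_bigr => i _ do rewrite (rawlinZ (b_lin m)) b_xy.
by rewrite !scale_zero addr0 add0r scale_ind.
Qed.
Lemma cE_comb l b c m : (m.+1 < e)%N -> cE m (combH l b c) = c m.
Proof.
move=> me; rewrite /comb !(rawlinD (c_lin m)) !(rawlin_sum (c_lin m)).
under eq_bigr => i _ do rewrite (rawlinZ (c_lin m)) c_z.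
under [X in _ + X + _]eq_bigr => i _ do rewrite (rawlinZ (c_lin m)) c_y.
under [X in _ + X]eq_bigr => i _.
  rewrite (rawlinZ (c_lin m)) c_xy; last by have := ltn_ord i; lia.
  over.
by rewrite !scale_zero !add0r scale_ind //; lia.
Qed.
Lemma lE_comb l b c i : (i.+1 < e)%N -> lE i.+1 (combH l b c) = l i.
Proof.
move=> me; rewrite /comb !(rawlinD (l_lin _)) !(rawlin_sum (l_lin _)).
under eq_bigr => j _.
  rewrite (rawlinZ (l_lin _)) l_z; last by have := ltn_ord j; lia.
  rewrite eqSS; over.
under [X in _ + X + _]eq_bigr => j _ do rewrite (rawlinZ (l_lin _)) l_y.
under [X in _ + X]eq_bigr => j _ do rewrite (rawlinZ (l_lin _)) l_xy.
by rewrite !scale_zero !addr0 scale_ind //; lia.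
Qed.

Lemma combH_coords u : u = combH (fun i => lE i.+1 u) (bE^~ u) (cE^~ u).
Proof.
apply/eqP; rewrite -subr_eq0; apply/eqP/coords_inj => [m me|m me|[|i] ie] //.
- by rewrite (rawlinB (b_lin m)) bE_comb // subrr.
- by rewrite (rawlinB (c_lin m)) cE_comb // subrr.
- by rewrite (rawlinB (l_lin _)) lE_comb // subrr.
Qed.

(** Commutativity of [H] is not known beforehand, while evaluating polynomials in [H]
    multiplicatively needs the images of the variables to commute with everything. It suffices to
    commute with the generators, as these give all of [H] by [combH_coords]. *)
Lemma H_central (v : H) : (forall i, v * z i = z i * v) -> v * x = x * v -> v * y = y * v ->
  forall u, u * v = v * u.
Proof.
move=> vz vx vy u; rewrite (combH_coords u) /comb !mulrDl !mulrDr !mulr_suml !mulr_sumr.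
have vyn n : v * y ^+ n = y ^+ n * v by apply: commrX.
congr (_ + _ + _); apply: eq_bigr => i _; rewrite -scalerAl -scalerAr; congr (_ *: _).
- by rewrite vz.
- by rewrite vyn.
- by rewrite mulrA vx -!mulrA vyn.
Qed.

Lemma x_central u : u * x = x * u.
Proof. by apply: H_central => // i; rewrite xz zx. Qed.
Lemma y_central u : u * y = y * u.
Proof. by apply: H_central => // i; rewrite yz zy. Qed.
Lemma z_central i u : u * z i = z i * u.
Proof. by apply: H_central => [j||]; rewrite ?zz // ?zx ?xz ?zy ?yz. Qed.

Local Notation kzxy := (mpoly.mpoly (e.-1 + 2) k).
Local Notation R := (poly_mod_J k e).
Local Notation qJ := (qpi (@J_proper k e)).

Definition gen (i : 'I_(e.-1 + 2)) : H :=
  match split i with inl a => z a.+1 | inr b => if (b : nat) is 0 then x else y end.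

Lemma gen_z a : gen (lshift 2 a) = z a.+1.
Proof. by rewrite /gen (unsplitK (inl a)). Qed.
Lemma gen_x : gen (rshift e.-1 (ord0 : 'I_2)) = x.
Proof. by rewrite /gen (unsplitK (inr (ord0 : 'I_2))). Qed.
Lemma gen_y : gen (rshift e.-1 (ord_max : 'I_2)) = y.
Proof. by rewrite /gen (unsplitK (inr (ord_max : 'I_2))). Qed.

Definition rho : kzxy -> H := mmap (GRing.in_alg H) gen.

Lemma rho_multiplicative : monoid_morphism rho.
Proof.
have [M1 M2] : multiplicative rho.
  apply: commr_mmap_is_multiplicative => [i u|p m m'].
    rewrite /GRing.comm /gen; case: (split i) => [a|[[|b] lt]] /=.
    - exact: z_central.
    - exact: x_central.
    - exact: y_central.
  by rewrite /GRing.comm /= mulr_algl mulr_algr.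
by split.
Qed.

Lemma rho_linear : linear rho.
Proof. by move=> c p q; rewrite /rho mmapD mmapZ /= mulr_algl. Qed.

Definition rho_morphism : {lrmorphism kzxy -> H} :=
  HB.pack rho (GRing.isLinear.Build _ _ _ _ rho rho_linear)
    (GRing.isMonoidMorphism.Build _ _ rho rho_multiplicative).

Lemma rhoX i : rho_morphism 'X_i = gen i.
Proof. by rewrite /= /rho mmapX mmap1U. Qed.

Lemma rho_ideal p : two_sided_ideal (@J_gen k e) p -> rho p = 0.
Proof.
have rz i : rho (@zvar k e i) = z i.+1 by rewrite -gen_z -rhoX.
have rx : rho (xvar k e) = x by rewrite -gen_x -rhoX.
have ry : rho (yvar k e) = y by rewrite -gen_y -rhoX.
have [_ rM] := rho_multiplicative.
have rX w n : rho (w ^+ n) = rho w ^+ n := rmorphXn rho_morphism n w.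
apply: (two_sided_ideal_ker (chi := rho_morphism)) => _ [i j|i|i|||]; rewrite -[LHS]/(rho _).
- by rewrite rM !rz zz.
- by rewrite rM rz rx zx.
- by rewrite rM rz ry zy.
- by rewrite rX rx xx.
- by rewrite rM rX rx ry xye.
- by rewrite rX ry prednK ?ye //; lia.
Qed.

Definition Jmap (u : R) : H := rho (repr (u : lquot _)).

Lemma Jmap_pi p : Jmap (qJ p) = rho p.
Proof.
apply/eqP; rewrite -subr_eq0 -(rawlinB rho_linear); apply/eqP.
exact/rho_ideal/(repr_lpi (ideal_submodule (@J_gen k e))).
Qed.

Lemma Jmap_linear : linear Jmap.
Proof.
move=> c u v; have [p ->] := qpi_surj u; have [q ->] := qpi_surj v.
by rewrite -qpiZ -qpiD !Jmap_pi rho_linear.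
Qed.
Lemma Jmap_multiplicative : monoid_morphism Jmap.
Proof.
have [r1 rM] := rho_multiplicative; split.
  by rewrite -[1]/(qJ 1) Jmap_pi.
move=> u v; have [p ->] := qpi_surj u; have [q ->] := qpi_surj v.
by rewrite -qpiM !Jmap_pi rM.
Qed.

Definition Jmap_morphism : {lrmorphism R -> H} :=
  HB.pack Jmap (GRing.isLinear.Build _ _ _ _ Jmap Jmap_linear)
    (GRing.isMonoidMorphism.Build _ _ Jmap Jmap_multiplicative).

Local Notation zv i := (qJ (@zvar k e i)).
Local Notation xv := (qJ (xvar k e)).
Local Notation yv := (qJ (yvar k e)).
Local Notation combR := (comb (fun i : 'I_e.-1 => zv i) xv yv).

Lemma Jmap_comb l b c : Jmap (combR l b c) = combH l b c.
Proof.
rewrite -[Jmap _]/(Jmap_morphism _) /comb !raddfD /= !(rawlin_sum Jmap_linear).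
have Jz i : Jmap (zv i) = z i.+1 by rewrite Jmap_pi [LHS]rhoX gen_z.
have Jx : Jmap xv = x by rewrite Jmap_pi [LHS]rhoX gen_x.
have Jy m : Jmap (yv ^+ m) = y ^+ m.
  by rewrite -[LHS]/(Jmap_morphism _) rmorphXn /= Jmap_pi [rho _]rhoX gen_y.
congr (_ + _ + _); apply: eq_bigr => i _; rewrite (rawlinZ Jmap_linear) ?Jz ?Jy //.
by rewrite (Jmap_multiplicative.2) Jx Jy.
Qed.

Let spanned (u : R) := exists l b c, u = combR l b c.

Lemma spanned_lin t u v : spanned u -> spanned v -> spanned (t *: u + v).
Proof.
by move=> [l [b [c ->]]] [l' [b' [c' ->]]]; rewrite comb_lin; do 3!eexists.
Qed.
Lemma spannedD u v : spanned u -> spanned v -> spanned (u + v).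
Proof. by move=> su sv; rewrite -[u]scale1r; apply: spanned_lin. Qed.
Lemma spanned0 : spanned 0.
Proof. by exists (fun=> 0), (fun=> 0), (fun=> 0); rewrite comb_zero. Qed.
Lemma spanned_z i : spanned (zv i).
Proof. by rewrite (comb_z (fun i => zv i) xv yv i); do 3!eexists. Qed.

Let J0 p : J_gen p -> qJ p = 0.
Proof. by move=> Jp; apply/lpi_eq0/ideal_gen. Qed.
Let Jcomm p q : qJ p * qJ q = qJ q * qJ p.
Proof. by rewrite -!qpiM mulrC. Qed.
Let yvn m : yv ^+ m = qJ (yvar k e ^+ m).
Proof. by rewrite rmorphXn. Qed.
Let Rzz i j : zv i * zv j = 0. Proof. by rewrite -qpiM; apply/J0/J_zz. Qed.
Let Rzx i : zv i * xv = 0. Proof. by rewrite -qpiM; apply/J0/J_zx. Qed.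
Let Rzy i : zv i * yv = 0. Proof. by rewrite -qpiM; apply/J0/J_zy. Qed.
Let Rxx : xv * xv = 0. Proof. by rewrite -qpiM -expr2; apply/J0/J_xx. Qed.
Let Rye : yv ^+ e = 0.
Proof.
rewrite yvn -[X in _ ^+ X](prednK (ltnW e_gt1)); exact/J0/J_yy.
Qed.
Let Rxye : xv * yv ^+ e.-1 = 0.
Proof. by rewrite yvn -qpiM; apply/J0/J_xy. Qed.

Lemma spanned_y m : spanned (yv ^+ m).
Proof.
have [me|me] := ltnP m e; first by rewrite (comb_y (fun i => zv i) xv yv me); do 3!eexists.
by rewrite -(subnK me) exprD Rye mulr0; apply: spanned0.
Qed.
Lemma spanned_xy m : spanned (xv * yv ^+ m).
Proof.
have [me|me] := ltnP m.+1 e; first by rewrite (comb_xy (fun i => zv i) xv yv me); do 3!eexists.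
have me' : (e.-1 <= m)%N by lia.
by rewrite -(subnKC me') exprD mulrA Rxye mul0r; apply: spanned0.
Qed.

Lemma spanned_sum n (f : nat -> k) (w : 'I_n -> R) :
  (forall i, spanned (w i)) -> spanned (\sum_(i < n) f i *: w i).
Proof.
move=> sw; elim/big_rec: _ => [|i u _ su]; first exact: spanned0.
exact: spanned_lin.
Qed.

(** A variable takes each basis monomial to another one, or to 0 by a generator of J; commutativity
    of the quotient brings the variable next to the factor with which it forms that generator. *)
Lemma spanned_gen i u : spanned u -> spanned (u * qJ 'X_i).
Proof.
move=> [l [b [c ->]]]; rewrite /comb !mulrDl !mulr_suml.
have sc n (f : nat -> k) (w : 'I_n -> R) v : (forall i, spanned (w i * v)) ->
    spanned (\sum_(i < n) (f i *: w i) * v).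
  move=> sw; rewrite (eq_bigr (fun i : 'I_n => f i *: (w i * v))); first exact: spanned_sum.
  by move=> j _; rewrite -scalerAl.
suff [gz gy gx] : [/\ forall j, spanned (zv j * qJ 'X_i), forall m, spanned (yv ^+ m * qJ 'X_i)
    & forall m, spanned (xv * yv ^+ m * qJ 'X_i)].
  by apply/spannedD; [apply/spannedD|]; apply: sc.
rewrite -[i]splitK; case: (split i) => [a|[[|[|//]] lt]] /=.
- rewrite -/(zvar k a); split=> [j|m|m].
  + by rewrite Rzz; apply: spanned0.
  + rewrite yvn Jcomm -yvn; case: m => [|m]; first by rewrite mulr1; apply: spanned_z.
    by rewrite exprS mulrA Rzy mul0r; apply: spanned0.
  + rewrite yvn -qpiM Jcomm qpiM mulrA Rzx mul0r; exact: spanned0.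
- have -> : 'X_(rshift e.-1 (Ordinal lt)) = xvar k e.
    by congr 'X_(rshift _ _); apply: val_inj.
  split=> [j|m|m].
  + by rewrite Rzx; apply: spanned0.
  + by rewrite yvn Jcomm -yvn; apply: spanned_xy.
  + rewrite yvn -qpiM Jcomm qpiM mulrA Rxx mul0r; exact: spanned0.
- have -> : 'X_(rshift e.-1 (Ordinal lt)) = yvar k e.
    by congr 'X_(rshift _ _); apply: val_inj.
  split=> [j|m|m].
  + by rewrite Rzy; apply: spanned0.
  + by rewrite -exprSr; apply: spanned_y.
  + by rewrite -mulrA -exprSr; apply: spanned_xy.
Qed.

Lemma spanned_pi p : spanned (qJ p).
Proof.
suff sp v : spanned v -> spanned (v * qJ p).
  by rewrite -[qJ p]mul1r; apply: sp; rewrite -(expr0 yv); apply: spanned_y.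
rewrite [p]mpolyE rmorph_sum mulr_sumr => sv.
elim/big_rec: _ => [|m u _ su]; first exact: spanned0.
rewrite /=.
rewrite linearZ -scalerAr; apply: spanned_lin => //.
rewrite mpolyXE_id rmorph_prod.
elim/big_rec: _ v sv => [|i q _ IH] v sv; first by rewrite mulr1.
rewrite mulrA; apply: IH; rewrite rmorphXn.
elim: (m i) => [|n IHn]; first by rewrite mulr1.
by rewrite exprSr mulrA; apply: spanned_gen.
Qed.

Lemma comb_eq l b c l' b' c' :
  (forall i, (i.+1 < e)%N -> l i = l' i) -> (forall m, (m < e)%N -> b m = b' m) ->
  (forall m, (m.+1 < e)%N -> c m = c' m) -> combR l b c = combR l' b' c'.
Proof.
move=> le be ce; rewrite /comb; congr (_ + _ + _); apply: eq_bigr => i _.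
- by rewrite le //; have := ltn_ord i; lia.
- by rewrite be.
- by rewrite ce //; have := ltn_ord i; lia.
Qed.

(** The 3e - 2 monomials span the quotient, and their images in [H] are separated by the
    coordinates, so the coefficients of a normal form can be recovered from its image. *)
Lemma Jmap_inj u : Jmap u = 0 -> u = 0.
Proof.
have [p ->] := qpi_surj u; have [l [b [c ->]]] := spanned_pi p; rewrite Jmap_comb => h0.
rewrite -(comb_zero (fun i : 'I_e.-1 => zv i) xv yv); apply: comb_eq => m me.
- by rewrite -(lE_comb l b c me) h0 (rawlin0 (l_lin _)).
- by rewrite -(bE_comb l b c me) h0 (rawlin0 (b_lin _)).
- by rewrite -(cE_comb l b c me) h0 (rawlin0 (c_lin _)).
Qed.

Definition Jinv (u : H) : R := combR (fun i => lE i.+1 u) (bE^~ u) (cE^~ u).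

Lemma JinvK : cancel Jinv Jmap.
Proof. by move=> u; rewrite Jmap_comb -combH_coords. Qed.

Lemma JmapK : cancel Jmap Jinv.
Proof.
move=> u; apply/eqP; rewrite -subr_eq0; apply/eqP/Jmap_inj.
by rewrite (rawlinB Jmap_linear) JinvK subrr.
Qed.

Lemma Jinv_linear : linear Jinv.
Proof. exact: (@can2_linear _ _ _ Jmap_morphism Jinv JmapK JinvK). Qed.

Lemma Jinv_multiplicative : monoid_morphism Jinv.
Proof. exact: (@can2_monoid_morphism _ _ Jmap_morphism Jinv JmapK JinvK). Qed.

Lemma deg_gen n i v : deg n v -> deg (n + var_degree i) (v * gen i).
Proof.
rewrite /var_degree /gen; case: (split i) => [a|[[|[|//]] lt]] /= dv.
- exact: deg_z.
- exact: deg_x.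
- exact: deg_y.
Qed.

Lemma deg_monomial n m v : deg n v -> deg (n + mon_degree m) (v * mmap1 gen m).
Proof.
rewrite /mon_degree /mmap1; elim/big_rec2: _ n v => [|i d u _ IH] n v dv.
  by rewrite mulr1 addn0.
rewrite mulrA addnA; apply: IH.
elim: (m i) => [|r IHr]; first by rewrite mulr1 addn0.
by rewrite exprSr mulrA mulSn addnCA addnC; apply: deg_gen.
Qed.

Lemma Jmap_degree n u : poly_mod_J_degree n u -> deg n (Jmap u).
Proof.
move=> [p [-> pn]]; rewrite Jmap_pi /rho /mmap big_seq.
elim/big_rec: _ => [|m v mp dv]; first exact: deg_zero.
rewrite mulr_algl; apply: deg_lin => //.
by have := deg_monomial m deg_one; rewrite mul1r add0n pn.
Qed.

Lemma Jdegree_lin n c (u v : R) : poly_mod_J_degree n u -> poly_mod_J_degree n v ->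
  poly_mod_J_degree n (c *: u + v).
Proof.
move=> [p [-> pn]] [q [-> qn]]; exists (c *: p + q); rewrite qpiD qpiZ; split=> // m.
rewrite mcoeff_msupp mcoeffD mcoeffZ => nz.
have [pm|] := boolP (m \in msupp p); first exact: pn.
have [qm|] := boolP (m \in msupp q); first by move=> _; apply: qn.
rewrite !mcoeff_msupp !negbK => /eqP q0 /eqP p0.
by move: nz; rewrite p0 q0 mulr0 addr0 eqxx.
Qed.

Lemma JdegreeD n (u v : R) : poly_mod_J_degree n u -> poly_mod_J_degree n v ->
  poly_mod_J_degree n (u + v).
Proof. by move=> du dv; rewrite -[u]scale1r; apply: Jdegree_lin. Qed.

Lemma Jdegree0 n : poly_mod_J_degree n (0 : R).
Proof. by exists 0; split=> [|m]; rewrite ?raddf0 // msupp0. Qed.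

Lemma Jdegree_sum n r (f : nat -> k) (w : 'I_r -> R) :
  (forall i : 'I_r, f i = 0 \/ poly_mod_J_degree n (w i)) ->
  poly_mod_J_degree n (\sum_(i < r) f i *: w i).
Proof.
move=> fw; elim/big_rec: _ => [|i u _ du]; first exact: Jdegree0.
by case: (fw i) => [->|dw]; [rewrite scale0r add0r | apply: Jdegree_lin].
Qed.

Lemma mon_degreeD m m' : mon_degree (m + m')%MM = (@mon_degree e m + mon_degree m')%N.
Proof.
by rewrite /mon_degree -big_split; apply: eq_bigr => i _; rewrite mnmDE mulnDl.
Qed.
Lemma mon_degreeU i : @mon_degree e U_(i)%MM = var_degree i.
Proof.
rewrite /mon_degree (bigD1 i) //= mnm1E eqxx mul1n big1 ?addn0 // => j ne.
by rewrite mnm1E eq_sym (negbTE ne).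
Qed.
Lemma mon_degreeMn m n : @mon_degree e (m *+ n)%MM = (n * mon_degree m)%N.
Proof.
rewrite /mon_degree big_distrr /=; apply: eq_bigr => i _.
by rewrite mulmnE mulnA (mulnC n).
Qed.

Lemma Jdegree_X m : poly_mod_J_degree (mon_degree m) (qJ 'X_[m]).
Proof. by exists 'X_[m]; split=> // m'; rewrite msuppX inE => /eqP ->. Qed.

(** Each coordinate is supported in the degree of its monomial: 0 for z_i, 2m for y^m, 2m + 1 for x
    y^m. A homogeneous element therefore has a normal form with monomials of its own degree only. *)
Lemma Jinv_degree n u : deg n u -> poly_mod_J_degree n (Jinv u).
Proof.
move=> /deg_coords[b0 c0 l0].
have vx : var_degree (rshift e.-1 (ord0 : 'I_2)) = 1%N by rewrite /var_degree (unsplitK (inr _)).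
have vy : var_degree (rshift e.-1 (ord_max : 'I_2)) = 2 by rewrite /var_degree (unsplitK (inr _)).
have dz i : poly_mod_J_degree 0 (zv i).
  have := Jdegree_X U_(lshift 2 i)%MM.
  by rewrite mon_degreeU /var_degree (unsplitK (inl _)).
have dy m : poly_mod_J_degree m.*2 (yv ^+ m).
  have := Jdegree_X (U_(rshift e.-1 (ord_max : 'I_2)) *+ m)%MM.
  by rewrite mon_degreeMn mon_degreeU vy muln2 yvn /yvar mpolyXn.
have dxy m : poly_mod_J_degree m.*2.+1 (xv * yv ^+ m).
  have := Jdegree_X (U_(rshift e.-1 (ord0 : 'I_2)) + U_(rshift e.-1 (ord_max : 'I_2)) *+ m)%MM.
  by rewrite mon_degreeD mon_degreeMn !mon_degreeU vx vy muln2 yvn -qpiM /yvar mpolyXn -mpolyXD.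
rewrite /Jinv /comb; apply/JdegreeD; [apply/JdegreeD|].
- apply: (@Jdegree_sum n e.-1 (fun i => lE i.+1 u)) => i.
  by case: (eqVneq 0%N n) => [<-|/eqP ne]; [right | left; apply: l0].
- apply: (@Jdegree_sum n e (bE^~ u) (fun m => yv ^+ m)) => m.
  by case: (eqVneq m.*2 n) => [<-|/eqP ne]; [right | left; apply: b0].
- apply: (@Jdegree_sum n e.-1 (cE^~ u) (fun m => xv * yv ^+ m)) => m.
  by case: (eqVneq m.*2.+1 n) => [<-|/eqP ne]; [right | left; apply: c0].
Qed.

Lemma presentation_iso : exists f : {lrmorphism H -> poly_mod_J k e},
  bijective f /\ forall n u, deg n u <-> poly_mod_J_degree n (f u).
Proof.
pose f : {lrmorphism H -> R} :=
  HB.pack Jinv (GRing.isLinear.Build _ _ _ _ Jinv Jinv_linear)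
    (GRing.isMonoidMorphism.Build _ _ Jinv Jinv_multiplicative).
exists f; split; first by exists Jmap; [apply: JinvK | apply: JmapK].
move=> n u; split; first exact: Jinv_degree.
by move=> /Jmap_degree; rewrite JinvK.
Qed.
End Presentation.

(** * The presentation of Ext over the Clebsch-Gordan resolution *)

Section ExtPresentation.
Variables (k : fieldType) (A : algType k) (e : nat) (Z : zigzag_basis A e).
Variables (W : tensor_env A) (F : free_pairs (tenv W)).
Variable M_neq0 : exists m : tmod W, m != 0.
Hypothesis e_gt1 : (1 < e)%N.
Local Notation Ext := (ext_alg (cgres Z F) M_neq0).
Local Notation yE := (yE Z F M_neq0).
Local Notation xE := (xE Z F M_neq0).
Local Notation zE := (zE Z F M_neq0).

Lemma cgres_presentation : exists f : {lrmorphism Ext -> poly_mod_J k e},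
  bijective f /\ forall n u, ext_degree n u <-> poly_mod_J_degree n (f u).
Proof.
have zE_cls i : zE i = ext_class M_neq0 (zcc Z F i) by [].
apply: (@presentation_iso k e Ext (@ext_degree _ _ _ _ _) xE yE zE
  (@bE _ _ _ Z W F M_neq0) (@cE _ _ _ Z W F M_neq0) (@lE _ _ _ Z W F M_neq0) e_gt1).
- exact: yE_xE.
- exact: xE_xE.
- exact: zE_xE.
- exact: xE_zE.
- exact: zE_zE.
- exact: zE_yE.
- by move=> i; rewrite yE_zE zE_yE.
- exact: yE_e.
- exact: xE_yE_e.
- exact: bE_linear.
- exact: cE_linear.
- exact: lE_linear.
- exact: coordsE_inj.
- by move=> m p pe; rewrite -cls_ypow bE_cls bco_ypow.
- by move=> m p; rewrite -cls_ypow cE_cls cco_ypow.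
- by move=> m p; rewrite -cls_ypow lE_cls lco_ypow.
- by move=> m p; rewrite -cls_xyc bE_cls bco_xyc.
- by move=> m p pe; rewrite -cls_xyc cE_cls cco_xyc.
- by move=> m p; rewrite -cls_xyc lE_cls lco_xyc.
- by move=> m l; rewrite zE_cls bE_cls bco_zcc.
- by move=> m l; rewrite zE_cls cE_cls cco_zcc.
- by move=> m l le; rewrite zE_cls lE_cls lco_zcc.
- exact: degree_coords.
- exact: degree_yE.
- exact: degree_xE.
- exact: degree_zE.
- exact: degree_one.
- exact: degree_zero.
- exact: degree_lin.
Qed.
End ExtPresentation.

Theorem theorem3p11 (k : fieldType) (q : k) (e : nat) (hq : q != 0)
    (he : is_quantum_char q e) :
  exists f : {lrmorphism HH (Ae k e) -> poly_mod_J k e},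
    bijective f /\
    forall (n : nat) (u : HH (Ae k e)),
      HH_degree n u <-> poly_mod_J_degree n (f u).
Proof.
(* For e = 1 the vanishing sum would be q^0 = 1. *)
have e_gt1 : (1 < e)%N.
  case: he => [e0 s0 _]; case: e e0 s0 => [|[|//]] // _.
  by rewrite big_ord1 expr0 => /eqP; rewrite oner_eq0.
pose Z := Ae_zigzag k e_gt1; pose W := enveloping_env (Ae k e).
pose F := malg_pairs (tenv W).
pose M0 := regular_bimodule_neq0 (Ae k e) : exists m : tmod W, m != 0.
have [f1 [f1b f1d]] := ext_alg_resolution M0 (cgres Z F)
  (free_resolution (regular_bimodule (Ae k e) : lmodType (enveloping (Ae k e)))).
have [f2 [f2b f2d]] := cgres_presentation Z F M0 e_gt1.
exists (f2 \o f1 : {lrmorphism _ -> _}); split; first exact: bij_comp f2b f1b.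
by move=> n u; split=> [/f1d/f2d|/f2d/f1d].
Qed.
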